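(* There is an absolute positive constant $\widetilde{c}$ such that the following holds. Let $\ell \in \mathbb{N}$ and $\beta \in [0,1)$ be fixed. (A) Let $c$ be a positive number less than $\sqrt{2(1-\beta)}$. If $T$ is sufficiently large, then $$\max_{T^{\beta}\leqslant t\leqslant T}\left|\zeta^{(\ell)}\Big(\frac{1}{2}+it\Big)\right| \geqslant \exp\Big\{c\sqrt{\frac{\log T\,\log_3 T}{\log_2 T}}\Big\}.$$ (B) Let $\sigma \in (\frac{1}{2},1)$ be given and let $\kappa$ be a positive number less than $1-\beta$. Then for sufficiently large $T$, we have $$\max_{T^{\beta}\leqslant t\leqslant T}\left|\zeta^{(\ell)}(\sigma+it)\right| \geqslant \exp\Big\{\frac{\widetilde{c}\cdot\kappa^{1-\sigma}}{1-\sigma}\cdot\frac{(\log T)^{1-\sigma}}{(\log_2 T)^{\sigma}}\Big\}.$$ Here ''sufficiently large'' may depend on the fixed parameters ($\ell,\beta,c$ in (A); $\ell,\beta,\sigma,\kappa$ in (B)), while $\widetilde{c}$ does not depend on any of them.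
   Context: $\zeta$ is the Riemann zeta function and $\zeta^{(\ell)}$ its $\ell$-th derivative. $\mathbb{N}$ is the set of positive integers. Notation: $\log_2 T := \log\log T$ and $\log_3 T := \log\log\log T$ (iterated natural logarithms). *)

(* Defs.v *)
(* Stdlib reals with Coquelicot's complex numbers. *)
From Stdlib Require Import Reals.
From Coquelicot Require Import Coquelicot.
Open Scope R_scope.

Definition Cexp (z : C) : C :=
  (exp (Re z) * cos (Im z), exp (Re z) * sin (Im z)).

(* The Dirichlet monomial n^{-s}, meaningful for n >= 1. *)
Definition nat_Cpow_opp (n : nat) (s : C) : C :=
  Cexp (- s * RtoC (ln (INR n)))%C.

Definition C_analytic_at (f : C -> C) (z0 : C) : Prop :=
  exists (a : nat -> C) (r : R), 0 < r /\
    forall z : C, Cmod (z - z0)%C < r ->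
      @is_pseries C_AbsRing C_NormedModule a (z - z0)%C (f z).

(* The Riemann zeta function is the analytic continuation to C \ {1} of the
   Dirichlet series sum_{n >= 1} n^{-s}, Re s > 1.  By the identity theorem the
   predicate determines zeta on C \ {1}; the value at the pole s = 1 is
   left arbitrary. *)
Definition is_riemann_zeta (zeta : C -> C) : Prop :=
  (forall s : C, s <> RtoC 1 -> C_analytic_at zeta s) /\
  (forall s : C, 1 < Re s ->
     @is_series C_AbsRing C_NormedModule
       (fun n => nat_Cpow_opp (S n) s) (zeta s)).

(* C_derive is total, and returns the limit of the difference quotient along the
   real direction.  Where f is analytic this is the complex derivative
   (is_C_derive_unique), and f^(k) is again analytic there. *)
Definition C_derive_n (f : C -> C) (k : nat) : C -> C :=
  Nat.iter k C_derive f.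

Definition is_max_on (f : R -> R) (a b m : R) : Prop :=
  (exists t : R, a <= t <= b /\ f t = m) /\
  (forall t : R, a <= t <= b -> f t <= m).

Definition log2 (T : R) : R := ln (ln T).
Definition log3 (T : R) : R := ln (ln (ln T)).

(* Main.v *)
Require Import Defs.
From Stdlib Require Import ZArith Reals Lra Lia.
From Corelib Require Import ssreflect.
From Coquelicot Require Import Coquelicot.
From HB Require structures.
From mathcomp Require ssreflect ssrfun ssrbool eqtype ssrnat seq div fintype finfun bigop prime binomial.
From mathcomp Require zify_ssreflect.
Open Scope R_scope.

(** The proof is by the resonance method. Write [T = exp y], and let [V] bound the modulus of the derivative of
   order [l] on the vertical line of abscissa [sigma], for ordinates between [T ^ beta] and [T].

   Smoothing. By an Euler-Maclaurin expansion ([zeta_approx]), zeta on the line is, up to a small error, a partial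
   sum of its Dirichlet series of length [N] between [T ^ 3] and [T ^ 4], plus the term [N^(1-s) / (s - 1)]. Apply
   [l] central differences and [2 * J] central averages of step [u], where [u * ln N = PI / 2] and [J] is
   proportional to [y]. The differences of zeta are at most [(2 * u) ^ l * V] by the mean value inequality. On the
   partial sum, smoothing multiplies the coefficient of [n] by powers of the cosine and of the sine of [u * ln n],
   which are nonnegative in this range. In the last term the wave [N^(- i t)] exchanges differences and
   averages, so that it receives [2 * J] differences and becomes negligible. Hence ([smooth_poly_le_max]) a
   Dirichlet polynomial with nonnegative coefficients, close to those of the derivative for small [n] and of sum at
   most [T ^ eps], is bounded by [V + 1] for ordinates between [T ^ beta1] and [T / 2], where [beta1] is any
   number above [beta]. Working with the polynomial itself, instead of moments of zeta, avoids all contour integrals.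

   Resonance. Multiply the real part of this polynomial by the square of the modulus of a resonator whose
   support has at most [T ^ kappa] elements, with [kappa < 1 - beta], and average against a Fejer kernel. All
   terms are nonnegative, so the average is at least the contribution of the solutions of [k * m = n] with [m] and [n]
   in the support; it is at most a constant times [V + 1] times the norm of the resonator, plus the contribution
   of the ordinates below [T ^ beta1], which the size of the support keeps bounded ([resonance]).

   Resonators. The support consists of products of powers [p ^ j], with [j] in [{0, 1, 2}], over a set of primes. The
   weights form a product measure centred at [j = 1], truncated by a linear price condition. The size
   of the support is bounded by Rankin's trick, and the mass lost by the truncation by Markov's inequality
   ([numerator_lower]). The outcome is [zeta_resonance]: [V] is at least, up to factors of lower order, the
   product over the primes of the ratio between the total weight of the pairs and the norm.

   Choice of the primes. On the critical line ([partA_window]) the primes are those from [ln T] times a power of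
   [ln ln T] to [(ln T) ^ (1 + del)], with weights proportional to [1 / (sqrt p * (ln p - ln ln T))]. The sum of
   [1 / (p * (ln p - ln ln T))] over these primes is close to [ln ln ln T / ln ln T], and the exponent is
   [sqrt (2 * kappa * ln T * ln ln ln T / ln ln T)] up to a factor close to [1]. To the right of the critical line
   ([partB_window]), equal weights on the primes of an interval [(v * exp (- 9 r), v]], with [v] a constant multiple
   of [kappa * ln T * ln ln T], already give the right order of magnitude. Both choices only need the estimates of
   Chebyshev and Mertens. *)

(** * Complex power series *)

Lemma C_series_eps (a : nat -> C) (l : C) :
  @is_series C_AbsRing C_NormedModule a l <->
  (forall eps : R, 0 < eps -> exists N : nat, forall n : nat, (N <= n)%nat ->
     Cmod (@sum_n C_AbelianMonoid a n - l)%C < eps).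
Proof.
  split.
  - intros H eps Heps.
    pose proof (proj1 (filterlim_locally_ball_norm (K:=C_AbsRing) (U:=C_NormedModule)
       (@sum_n C_AbelianMonoid a) l) H (mkposreal _ Heps)) as [N HN].
    exists N. intros n Hn. exact (HN n Hn).
  - intros H.
    apply (proj2 (filterlim_locally_ball_norm (K:=C_AbsRing) (U:=C_NormedModule)
       (@sum_n C_AbelianMonoid a) l)).
    intros eps. destruct (H eps (cond_pos eps)) as [N HN].
    exists N. intros n Hn. exact (HN n Hn).
Qed.

Lemma C_sum_n_S (a : nat -> C) n :
  @sum_n C_AbelianMonoid a (S n) = (@sum_n C_AbelianMonoid a n + a (S n))%C.
Proof. exact (sum_Sn (G:=C_AbelianMonoid) a n). Qed.

Lemma C_sum_n_0 (a : nat -> C) : @sum_n C_AbelianMonoid a 0 = a 0%nat.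
Proof. exact (sum_O (G:=C_AbelianMonoid) a). Qed.

Lemma C_series_bound (a : nat -> C) (b : nat -> R) (l : C) (M : R) :
  @is_series C_AbsRing C_NormedModule a l ->
  (forall n, Cmod (a n) <= b n) -> is_series b M -> Cmod l <= M.
Proof.
  intros Ha Hab Hb.
  assert (Hpart : forall n, Cmod (@sum_n C_AbelianMonoid a n) <= sum_n b n).
  { induction n as [|n IH].
    - rewrite C_sum_n_0 sum_O. apply Hab.
    - rewrite C_sum_n_S sum_Sn.
      eapply Rle_trans; [apply Cmod_triangle|]. apply Rplus_le_compat; auto. }
  assert (Hb0 : forall n, 0 <= b n).
  { intros n. eapply Rle_trans; [apply Cmod_ge_0|apply Hab]. }
  apply Rnot_lt_le. intros Hlt.
  assert (He : 0 < (Cmod l - M) / 2) by lra.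
  destruct (proj1 (C_series_eps a l) Ha _ He) as [N HN].
  specialize (HN N (le_n N)).
  assert (HM : sum_n b N <= M).
  { apply is_lim_seq_incr_compare with (u := sum_n b).
    - exact Hb.
    - intros n. rewrite sum_Sn. unfold plus; simpl. specialize (Hb0 (S n)). lra. }
  specialize (Hpart N).
  assert (Htri : Cmod l <= Cmod (@sum_n C_AbelianMonoid a N) + Cmod (@sum_n C_AbelianMonoid a N - l)%C).
  { replace l with (@sum_n C_AbelianMonoid a N + - (@sum_n C_AbelianMonoid a N - l))%C at 1 by ring.
    eapply Rle_trans; [apply Cmod_triangle|]. rewrite Cmod_opp. lra. }
  lra.
Qed.

(** Completeness is used for the real and imaginary parts separately. *)
Lemma C_ex_series_le (a : nat -> C) (b : nat -> R) :
  (forall n, Cmod (a n) <= b n) -> ex_series b ->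
  exists l : C, @is_series C_AbsRing C_NormedModule a l.
Proof.
  intros H Hb.
  assert (Hc : forall (p : C -> R), (forall x y, p (x + y)%C = p x + p y) ->
     (forall x, Rabs (p x) <= Cmod x) -> ex_series (fun n => p (a n))).
  { intros p _ Hp. apply (ex_series_le (K:=R_AbsRing) (V:=R_CompleteNormedModule) _ b); [|exact Hb].
    intros n. eapply Rle_trans; [apply Hp|apply H]. }
  destruct (Hc Re) as [l1 H1]; [reflexivity|intros; apply re_le_Cmod|].
  assert (Him : forall x, Rabs (Im x) <= Cmod x).
  { intros x. eapply Rle_trans; [|apply Rmax_Cmod]. apply Rmax_r. }
  destruct (Hc Im) as [l2 H2]; [reflexivity|apply Him|].
  exists (l1, l2).
  apply C_series_eps. intros eps Heps.
  assert (He : 0 < eps / 2) by lra.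
  pose proof (proj1 (filterlim_locally _ _) H1 (mkposreal _ He)) as [N1 HN1].
  pose proof (proj1 (filterlim_locally _ _) H2 (mkposreal _ He)) as [N2 HN2].
  exists (max N1 N2). intros n Hn.
  specialize (HN1 n (Nat.le_trans _ _ _ (Nat.le_max_l N1 N2) Hn)).
  specialize (HN2 n (Nat.le_trans _ _ _ (Nat.le_max_r N1 N2) Hn)).
  assert (Hs : forall n, @sum_n C_AbelianMonoid a n =
     (sum_n (fun k => Re (a k)) n, sum_n (fun k => Im (a k)) n)).
  { induction n0 as [|m IH].
    - rewrite C_sum_n_0 !sum_O. apply surjective_pairing.
    - rewrite C_sum_n_S !sum_Sn IH. reflexivity. }
  rewrite Hs.
  change (Rabs (sum_n (fun k => Re (a k)) n - l1) < eps / 2) in HN1.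
  change (Rabs (sum_n (fun k => Im (a k)) n - l2) < eps / 2) in HN2.
  set (x := sum_n (fun k => Re (a k)) n - l1) in *.
  set (y := sum_n (fun k => Im (a k)) n - l2) in *.
  replace (((sum_n (fun k => Re (a k)) n, sum_n (fun k => Im (a k)) n) - (l1, l2))%C)
    with (RtoC x + Ci * RtoC y)%C.
  2:{ unfold Cminus, Cplus, Copp, Cmult, RtoC, Ci, x, y; simpl. f_equal; ring. }
  eapply Rle_lt_trans; [apply Cmod_triangle|].
  rewrite Cmod_mult Cmod_Ci !Cmod_R. lra.
Qed.

Lemma C_series_lin (a b c : nat -> C) (la lb lc k m : C) :
  @is_series C_AbsRing C_NormedModule a la ->
  @is_series C_AbsRing C_NormedModule b lb ->
  (forall n, c n = (k * a n + m * b n)%C) -> lc = (k * la + m * lb)%C ->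
  @is_series C_AbsRing C_NormedModule c lc.
Proof.
  intros Ha Hb Hc ->.
  apply (is_series_ext (fun n => plus (scal k (a n)) (scal m (b n)))).
  { intros n. symmetry. apply Hc. }
  apply (is_series_plus (K:=C_AbsRing) (V:=C_NormedModule)).
  - apply (is_series_scal (K:=C_AbsRing) (V:=C_NormedModule)). exact Ha.
  - apply (is_series_scal (K:=C_AbsRing) (V:=C_NormedModule)). exact Hb.
Qed.

Lemma pow_n_Cpow (z : C) n : @pow_n C_AbsRing z n = (z ^ n)%C.
Proof. induction n as [|n IH]; [reflexivity|]. simpl. rewrite IH. reflexivity. Qed.

Lemma C_pseries_eq (a : nat -> C) (z l : C) :
  @is_pseries C_AbsRing C_NormedModule a z l <->
  @is_series C_AbsRing C_NormedModule (fun n => a n * z ^ n)%C l.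
Proof.
  unfold is_pseries. split; apply is_series_ext; intros n; rewrite pow_n_Cpow;
  unfold scal; simpl; unfold mult; simpl; ring.
Qed.

(** Convergence at a real point beyond [x] bounds the terms there. This turns the pointwise
   convergence in [C_analytic_at] into absolute convergence inside the disc. *)
Lemma C_pseries_radius (a : nat -> C) (r : R) :
  0 < r ->
  (forall z : C, Cmod z < r -> exists l, @is_series C_AbsRing C_NormedModule (fun n => a n * z ^ n)%C l) ->
  forall x : R, 0 <= x -> x < r -> Rbar_lt x (CV_radius (fun n => Cmod (a n))).
Proof.
  intros Hr H x Hx Hxr.
  set (y := (x + r) / 2).
  assert (Hy : x < y < r) by (unfold y; lra).
  apply Rbar_lt_le_trans with (Finite y); [simpl; lra|].
  apply CV_radius_bounded.
  destruct (H (RtoC y)) as [l Hl].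
  { rewrite Cmod_R Rabs_pos_eq; lra. }
  (* the terms of a convergent series are bounded *)
  destruct (proj1 (C_series_eps _ _) Hl 1 Rlt_0_1) as [N HN].
  set (s := @sum_n C_AbelianMonoid (fun n => a n * RtoC y ^ n)%C) in *.
  assert (Hbd : exists M, forall n, Cmod (s n) <= M).
  { assert (Hfin : forall N, exists M, forall n, (n <= N)%nat -> Cmod (s n) <= M).
    { induction N0 as [|m [M HM]].
      - exists (Cmod (s 0%nat)). intros n Hn. replace n with 0%nat by lia. lra.
      - exists (Rmax M (Cmod (s (S m)))). intros n Hn.
        destruct (Nat.eq_dec n (S m)) as [->|Hne]; [apply Rmax_r|].
        eapply Rle_trans; [apply HM; lia|apply Rmax_l]. }
    destruct (Hfin N) as [M HM].
    exists (Rmax M (1 + Cmod l)). intros n.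
    destruct (Nat.le_gt_cases n N) as [Hle|Hgt].
    - eapply Rle_trans; [apply HM; exact Hle|apply Rmax_l].
    - eapply Rle_trans; [|apply Rmax_r].
      specialize (HN n (Nat.lt_le_incl _ _ Hgt)).
      replace (s n) with (s n - l + l)%C by ring.
      eapply Rle_trans; [apply Cmod_triangle|]. lra. }
  destruct Hbd as [M HM].
  exists (2 * M). intros n.
  rewrite Rabs_mult (Rabs_pos_eq (Cmod (a n))); [|apply Cmod_ge_0].
  replace (Cmod (a n) * Rabs (y ^ n)) with (Cmod (a n * RtoC y ^ n)%C).
  2:{ rewrite Cmod_mult Cmod_pow Cmod_R RPow_abs. reflexivity. }
  destruct n as [|n].
  - specialize (HM 0%nat). unfold s in HM. rewrite C_sum_n_0 in HM. cbv beta in HM.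
    pose proof (Cmod_ge_0 (a 0%nat * RtoC y ^ 0)%C). lra.
  - pose proof (HM (S n)) as H1. pose proof (HM n) as H2.
    unfold s in H1 at 1. rewrite C_sum_n_S in H1. fold (s n) in H1.
    set (w := (a (S n) * RtoC y ^ S n)%C) in *.
    replace w with (s n + w + - s n)%C by ring.
    eapply Rle_trans; [apply Cmod_triangle|]. rewrite Cmod_opp. lra.
Qed.

(** An epsilon-delta form, so that estimates need not go through filters on the complex plane. *)
Definition C_diff (f : C -> C) (z l : C) : Prop :=
  forall eps : R, 0 < eps -> exists delta : R, 0 < delta /\
    forall h : C, Cmod h < delta ->
      Cmod (f (z + h) - f z - h * l)%C <= eps * Cmod h.

Lemma C_diff_is_derive f z l : C_diff f z l -> C_derive f z = l.
Proof.
  intros H. apply is_C_derive_unique. split.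
  - exact (is_linear_scal_l (K:=C_AbsRing) (V:=C_NormedModule) l).
  - intros x Hx.
    assert (Ex : z = x) by (exact (is_filter_lim_locally_unique (V:=AbsRing_NormedModule C_AbsRing) z x Hx)). subst x.
    intros eps.
    destruct (H eps (cond_pos eps)) as [d [Hd HH]].
    apply (locally_le_locally_norm (K:=C_AbsRing) (V:=AbsRing_NormedModule C_AbsRing)).
    exists (mkposreal d Hd). intros y Hy.
    change C in y, z.
    specialize (HH (y - z)%C Hy).
    replace (z + (y - z))%C with y in HH; [exact HH|].
    unfold Cplus, Cminus, Copp; destruct y, z; simpl; f_equal; ring.
Qed.

(** Induction on the exponent. The factor [q ^ n] is what makes the remainders summable against
   the coefficients of a power series whose radius exceeds [q]. *)
Lemma C_pow_taylor (z h : C) (q : R) (n : nat) :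
  Cmod z <= q -> Cmod (z + h)%C <= q ->
  Cmod ((z + h) ^ (S (S n)) - z ^ (S (S n)) - RtoC (INR (S (S n))) * h * z ^ (S n))%C
   <= INR (S (S n)) * INR (S n) * q ^ n * Cmod h ^ 2.
Proof.
  intros Hz Hzh.
  assert (Hq : 0 <= q) by (eapply Rle_trans; [apply Cmod_ge_0|exact Hz]).
  assert (Hd : forall m, Cmod ((z + h) ^ (S m) - z ^ (S m))%C <= INR (S m) * q ^ m * Cmod h).
  { induction m as [|m IH].
    - replace ((z + h) ^ 1 - z ^ 1)%C with h by (simpl; ring). simpl. lra.
    - replace ((z + h) ^ S (S m) - z ^ S (S m))%C with
        ((z + h) * ((z + h) ^ S m - z ^ S m) + h * z ^ (S m))%C by (simpl; ring).
      eapply Rle_trans; [apply Cmod_triangle|].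
      rewrite !Cmod_mult Cmod_pow.
      assert (H1 : Cmod (z + h)%C * Cmod ((z + h) ^ S m - z ^ S m)%C <= q * (INR (S m) * q ^ m * Cmod h)).
      { apply Rmult_le_compat; auto using Cmod_ge_0. }
      assert (H2 : Cmod h * Cmod z ^ S m <= Cmod h * q ^ S m).
      { apply Rmult_le_compat_l; [apply Cmod_ge_0|]. apply pow_incr. split; [apply Cmod_ge_0|exact Hz]. }
      rewrite (S_INR (S m)). simpl pow in *. lra. }
  induction n as [|n IH].
  - replace ((z + h) ^ 2 - z ^ 2 - RtoC (INR 2) * h * z ^ 1)%C with (h * h)%C.
    2:{ replace (INR 2) with 2 by (simpl; ring). rewrite RtoC_plus. simpl. ring. }
    rewrite Cmod_mult. simpl. pose proof (Rle_0_sqr (Cmod h)) as Hs. unfold Rsqr in Hs. lra.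
  - replace ((z + h) ^ S (S (S n)) - z ^ S (S (S n)) - RtoC (INR (S (S (S n)))) * h * z ^ S (S n))%C with
      (z * ((z + h) ^ S (S n) - z ^ S (S n) - RtoC (INR (S (S n))) * h * z ^ S n)
        + h * ((z + h) ^ (S (S n)) - z ^ (S (S n))))%C.
    2:{ rewrite (S_INR (S (S n))) RtoC_plus. simpl Cpow. ring. }
    eapply Rle_trans; [apply Cmod_triangle|]. rewrite !Cmod_mult.
    assert (H1 : Cmod z * Cmod ((z + h) ^ S (S n) - z ^ S (S n) - RtoC (INR (S (S n))) * h * z ^ S n)%C
       <= q * (INR (S (S n)) * INR (S n) * q ^ n * Cmod h ^ 2)).
    { apply Rmult_le_compat; auto using Cmod_ge_0. }
    assert (H2 : Cmod h * Cmod ((z + h) ^ S (S n) - z ^ S (S n))%C <= Cmod h * (INR (S (S n)) * q ^ (S n) * Cmod h)).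
    { apply Rmult_le_compat_l; [apply Cmod_ge_0|apply Hd]. }
    assert (H3 : 0 <= INR (S (S n)) * q ^ (S n) * Cmod h ^ 2).
    { apply Rmult_le_pos; [apply Rmult_le_pos; [apply pos_INR|apply pow_le; exact Hq]|apply pow2_ge_0]. }
    rewrite (S_INR (S (S n))). rewrite (S_INR (S n)) in H1 H2 H3 |- *. simpl pow in *. nra.
Qed.

Lemma C_series_decr (a : nat -> C) (l : C) :
  @is_series C_AbsRing C_NormedModule (fun n => a (S n)) l ->
  @is_series C_AbsRing C_NormedModule a (a 0%nat + l)%C.
Proof.
  intros H. apply (is_series_decr_1 (K:=C_AbsRing) (V:=C_NormedModule)).
  assert (E : @plus (NormedModule.AbelianMonoid C_AbsRing C_NormedModule) (a 0%nat + l)%C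
     (@opp (NormedModule.AbelianGroup C_AbsRing C_NormedModule) (a 0%nat)) = l).
  { change (a 0%nat + l + - a 0%nat = l)%C. ring. }
  rewrite E. exact H.
Qed.

Lemma R_series_decr (a : nat -> R) (l : R) : a 0%nat = 0 ->
  is_series (fun n => a (S n)) l -> is_series a l.
Proof.
  intros H0 H. apply is_series_decr_1.
  assert (E : plus l (opp (a 0%nat)) = l) by (rewrite H0; unfold plus, opp; simpl; ring).
  rewrite E. exact H.
Qed.

(** [C_pow_taylor] bounds the remainder by [Cmod h ^ 2] times the second derivative of the series
   of moduli, taken at a radius [q] strictly inside the disc. *)
Lemma C_pseries_diff (f : C -> C) (z0 : C) (a : nat -> C) (r : R) :
  0 < r ->
  (forall z : C, Cmod (z - z0)%C < r -> @is_pseries C_AbsRing C_NormedModule a (z - z0)%C (f z)) ->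
  forall z : C, Cmod (z - z0)%C < r -> exists l : C,
   @is_pseries C_AbsRing C_NormedModule (fun n => RtoC (INR (S n)) * a (S n))%C (z - z0)%C l
   /\ C_diff f z l.
Proof.
  intros Hr Hf z Hz.
  set (al := fun n => Cmod (a n)).
  assert (Hrad : forall x : R, 0 <= x -> x < r -> Rbar_lt x (CV_radius al)).
  { apply C_pseries_radius; [exact Hr|]. intros w Hw. exists (f (z0 + w)%C).
    apply (proj1 (C_pseries_eq _ _ _)). replace w with (z0 + w - z0)%C at 1 by ring. apply Hf.
    replace (z0 + w - z0)%C with w by ring. exact Hw. }
  set (w := (z - z0)%C) in *.
  assert (Hw0 := Cmod_ge_0 w).
  set (q := (Cmod w + r) / 2).
  assert (Hq : Cmod w < q < r) by (unfold q; lra).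
  assert (Hser : ex_series (fun n => PS_derive al n * Cmod w ^ n)).
  { assert (Hd := CV_disk_inside (PS_derive al) (Cmod w)).
    rewrite CV_radius_derive in Hd. rewrite (Rabs_pos_eq (Cmod w)) in Hd; [|lra].
    apply ex_series_Rabs. apply Hd. apply Hrad; lra. }
  assert (HserM : ex_series (fun n => PS_derive (PS_derive al) n * q ^ n)).
  { assert (Hd := CV_disk_inside (PS_derive (PS_derive al)) q).
    rewrite !CV_radius_derive in Hd. rewrite (Rabs_pos_eq q) in Hd; [|lra].
    apply ex_series_Rabs. apply Hd. apply Hrad; lra. }
  destruct (C_ex_series_le (fun n => RtoC (INR (S n)) * a (S n) * w ^ n)%C _
     ltac:(intros n; rewrite !Cmod_mult Cmod_R Cmod_pow Rabs_pos_eq; [apply Rle_refl|apply pos_INR]) Hser)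
    as [l Hl].
  exists l. split; [apply (proj2 (C_pseries_eq _ _ _)); exact Hl|].
  destruct HserM as [M HM].
  assert (HM0 : 0 <= M).
  { eapply Rle_trans; [|apply (is_lim_seq_incr_compare (sum_n (fun n => PS_derive (PS_derive al) n * q ^ n)) M HM)
       with (n := 0%nat)].
    - rewrite sum_O. unfold PS_derive. simpl.
      assert (0 <= al 2%nat) by apply Cmod_ge_0. lra.
    - intros n. rewrite sum_Sn. unfold plus; simpl.
      assert (0 <= PS_derive (PS_derive al) (S n) * q ^ (S n)); [|simpl in *; lra].
      apply Rmult_le_pos; [|apply pow_le; lra].
      unfold PS_derive. repeat apply Rmult_le_pos; try apply pos_INR; apply Cmod_ge_0. }
  intros eps Heps.
  exists (Rmin (q - Cmod w) (eps / (M + 1))). split.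
  { apply Rmin_pos; [lra|]. apply Rdiv_lt_0_compat; lra. }
  intros h Hh.
  assert (Hh1 : Cmod h < q - Cmod w) by (eapply Rlt_le_trans; [exact Hh|apply Rmin_l]).
  assert (Hh2 : Cmod h < eps / (M + 1)) by (eapply Rlt_le_trans; [exact Hh|apply Rmin_r]).
  assert (Hwh : Cmod (w + h)%C < q) by (eapply Rle_lt_trans; [apply Cmod_triangle|lra]).
  assert (E1 : @is_series C_AbsRing C_NormedModule (fun n => a n * (w + h) ^ n)%C (f (z + h)%C)).
  { apply (proj1 (C_pseries_eq _ _ _)). replace (w + h)%C with (z + h - z0)%C by (unfold w; ring).
    apply Hf. replace (z + h - z0)%C with (w + h)%C by (unfold w; ring). lra. }
  assert (E2 : @is_series C_AbsRing C_NormedModule (fun n => a n * w ^ n)%C (f z)).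
  { apply (proj1 (C_pseries_eq _ _ _)). apply Hf. exact Hz. }
  set (dd := fun n => match n with O => RtoC 0 | S m => (RtoC (INR (S m)) * a (S m) * w ^ m)%C end).
  assert (E3 : @is_series C_AbsRing C_NormedModule dd l).
  { replace l with (dd 0%nat + l)%C by (simpl; ring). apply C_series_decr. exact Hl. }
  pose proof (C_series_lin _ _ (fun n => a n * (w + h) ^ n - a n * w ^ n)%C _ _ (f (z + h) - f z)%C 1 (- (1))%C E1 E2
     ltac:(intros n; cbv beta; ring) ltac:(ring)) as E4.
  pose proof (C_series_lin _ _ (fun n => a n * (w + h) ^ n - a n * w ^ n - h * dd n)%C _ _
     (f (z + h) - f z - h * l)%C 1 (- h)%C E4 E3
     ltac:(intros n; cbv beta; ring) ltac:(ring)) as E5.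
  set (bb := fun n => match n with S (S m) => PS_derive (PS_derive al) m * q ^ m * Cmod h ^ 2 | _ => 0 end).
  assert (Hb : is_series bb (M * Cmod h ^ 2)).
  { apply R_series_decr; [reflexivity|]. apply R_series_decr; [reflexivity|]. simpl.
    apply (is_series_ext (fun n => scal (Cmod h ^ 2) (PS_derive (PS_derive al) n * q ^ n))).
    { intros n. unfold scal; simpl; unfold mult; simpl. ring. }
    replace (M * (Cmod h * (Cmod h * 1))) with (scal (Cmod h ^ 2) M) by (unfold scal; simpl; unfold mult; simpl; ring).
    apply (is_series_scal (K:=R_AbsRing) (V:=R_NormedModule)). exact HM. }
  assert (Hfin : Cmod (f (z + h) - f z - h * l)%C <= M * Cmod h ^ 2).
  { apply (C_series_bound _ bb _ _ E5); [|exact Hb].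
    intros [|[|n]].
    - simpl. replace (a 0%nat * 1 - a 0%nat * 1 - h * 0)%C with (RtoC 0) by ring. rewrite Cmod_0. lra.
    - simpl. replace (a 1%nat * ((w + h) * 1) - a 1%nat * (w * 1) - h * (1 * a 1%nat * 1))%C with (RtoC 0) by ring.
      rewrite Cmod_0. lra.
    - unfold bb, dd, PS_derive. fold (al (S (S n))).
      replace (a (S (S n)) * (w + h) ^ S (S n) - a (S (S n)) * w ^ S (S n) - h * (RtoC (INR (S (S n))) * a (S (S n)) * w ^ S n))%C
       with (a (S (S n)) * ((w + h) ^ (S (S n)) - w ^ (S (S n)) - RtoC (INR (S (S n))) * h * w ^ (S n)))%C by ring.
      rewrite Cmod_mult.
      pose proof (C_pow_taylor w h q n ltac:(lra) ltac:(lra)) as Ht.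
      apply (Rmult_le_compat_l (al (S (S n)))) in Ht; [|apply Cmod_ge_0].
      unfold al at 1 in Ht. lra. }
  eapply Rle_trans; [exact Hfin|].
  assert (Hhp := Cmod_ge_0 h).
  assert (M * Cmod h <= eps).
  { apply Rlt_le. apply Rle_lt_trans with ((M + 1) * Cmod h); [nra|].
    apply (Rmult_lt_compat_l (M + 1)) in Hh2; [|lra].
    replace ((M + 1) * (eps / (M + 1))) with eps in Hh2 by (field; lra). exact Hh2. }
  simpl. nra.
Qed.

Lemma C_analytic_derive (f : C -> C) (z : C) :
  C_analytic_at f z -> C_analytic_at (C_derive f) z /\ C_diff f z (C_derive f z).
Proof.
  intros (a & r & Hr & Hf).
  pose proof (C_pseries_diff f z a r Hr Hf) as H.
  split.
  - exists (fun n => RtoC (INR (S n)) * a (S n))%C, r. split; [exact Hr|].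
    intros w Hw. destruct (H w Hw) as (l & Hl & Hd).
    rewrite (C_diff_is_derive f w l Hd). exact Hl.
  - destruct (H z) as (l & Hl & Hd).
    { replace (z - z)%C with (RtoC 0) by ring. rewrite Cmod_0. exact Hr. }
    rewrite (C_diff_is_derive f z l Hd). exact Hd.
Qed.

Lemma C_derive_n_analytic (f : C -> C) (s0 : C) :
  (forall s, s <> s0 -> C_analytic_at f s) ->
  forall k s, s <> s0 -> C_analytic_at (C_derive_n f k) s.
Proof.
  intros Hf k. induction k as [|k IH]; intros s Hs; [apply Hf; exact Hs|].
  unfold C_derive_n. simpl. apply C_analytic_derive. apply IH. exact Hs.
Qed.

(** * Complex-valued functions of a real variable *)

Definition vderiv (F : R -> C) (t : R) (l : C) : Prop :=
  is_derive (fun x => Re (F x)) t (Re l) /\ is_derive (fun x => Im (F x)) t (Im l).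

Lemma im_le_Cmod (z : C) : Rabs (Im z) <= Cmod z.
Proof. eapply Rle_trans; [|apply Rmax_Cmod]. apply Rmax_r. Qed.

Lemma C_diff_line (f : C -> C) (a d l : C) (x0 : R) :
  C_diff f (a + d * RtoC x0)%C l ->
  vderiv (fun x => f (a + d * RtoC x)%C) x0 (d * l)%C.
Proof.
  intros H.
  assert (Hp : forall p : C -> R, (forall x y, p (x - y)%C = p x - p y) ->
     (forall (h : R) x, p (RtoC h * x)%C = h * p x) -> (forall x, Rabs (p x) <= Cmod x) ->
     is_derive (fun x => p (f (a + d * RtoC x)%C)) x0 (p (d * l)%C)).
  { intros p p1 p2 p3. apply is_derive_Reals. intros eps Heps.
    assert (Hd := Cmod_ge_0 d).
    assert (He : 0 < eps / (2 * (Cmod d + 1))) by (apply Rdiv_lt_0_compat; lra).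
    destruct (H _ He) as [dl [Hdl HH]].
    assert (Hd2 : 0 < dl / (Cmod d + 1)) by (apply Rdiv_lt_0_compat; lra).
    exists (mkposreal _ Hd2). intros h Hh0 Hh. simpl in Hh.
    assert (Hdh : Cmod (d * RtoC h)%C < dl).
    { rewrite Cmod_mult Cmod_R. apply (Rmult_lt_compat_l (Cmod d + 1)) in Hh; [|lra].
      replace ((Cmod d + 1) * (dl / (Cmod d + 1))) with dl in Hh by (field; lra).
      pose proof (Rabs_pos h). lra. }
    specialize (HH _ Hdh).
    replace (a + d * RtoC x0 + d * RtoC h)%C with (a + d * RtoC (x0 + h))%C in HH
      by (rewrite RtoC_plus; ring).
    assert (E : (p (f (a + d * RtoC (x0 + h))%C) - p (f (a + d * RtoC x0)%C)) / h - p (d * l)%C =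
      p (f (a + d * RtoC (x0 + h)) - f (a + d * RtoC x0) - d * RtoC h * l)%C / h).
    { rewrite !p1. replace (d * RtoC h * l)%C with (RtoC h * (d * l))%C by ring. rewrite p2. field. exact Hh0. }
    rewrite E. rewrite Rabs_div; [|exact Hh0].
    pose proof (Rabs_pos_lt h Hh0) as Hhp.
    apply (Rmult_lt_reg_r (Rabs h)); [exact Hhp|].
    replace (Rabs (p (f (a + d * RtoC (x0 + h)) - f (a + d * RtoC x0) - d * RtoC h * l)%C) / Rabs h * Rabs h)
      with (Rabs (p (f (a + d * RtoC (x0 + h)) - f (a + d * RtoC x0) - d * RtoC h * l)%C)) by (field; lra).
    eapply Rle_lt_trans; [apply p3|]. eapply Rle_lt_trans; [exact HH|].
    rewrite Cmod_mult Cmod_R.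
    apply Rle_lt_trans with (eps / 2 * Rabs h); [|nra].
    rewrite -Rmult_assoc. apply Rmult_le_compat_r; [lra|].
    replace (eps / 2) with (eps / (2 * (Cmod d + 1)) * (Cmod d + 1)) by (field; lra).
    apply Rmult_le_compat_l; lra. }
  split; apply Hp.
  - intros x y. unfold Re, Cminus, Cplus, Copp; simpl. ring.
  - intros h x. unfold Re, Cmult, RtoC; simpl. ring.
  - apply re_le_Cmod.
  - intros x y. unfold Im, Cminus, Cplus, Copp; simpl. ring.
  - intros h x. unfold Im, Cmult, RtoC; simpl. ring.
  - apply im_le_Cmod.
Qed.

(** The real function whose increment is the squared modulus of that of [F] turns the scalar
   mean value theorem into a vector one without loss. *)
Lemma C_mvt (F F' : R -> C) (a b M : R) : a <= b ->
  (forall t, a <= t <= b -> vderiv F t (F' t) /\ Cmod (F' t) <= M) ->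
  Cmod (F b - F a)%C <= M * (b - a).
Proof.
  intros Hab H.
  set (w := (F b - F a)%C).
  set (phi := fun t => Re w * Re (F t) + Im w * Im (F t)).
  assert (Hphi : forall t, a <= t <= b -> is_derive phi t (Re w * Re (F' t) + Im w * Im (F' t))).
  { intros t Ht. destruct (H t Ht) as [[H1 H2] _].
    apply (is_derive_plus (K:=R_AbsRing) (V:=R_NormedModule)); apply is_derive_scal; assumption. }
  destruct (MVT_gen phi a b (fun t => Re w * Re (F' t) + Im w * Im (F' t))) as [c [Hc E]].
  { rewrite (Rmin_left a b Hab) (Rmax_right a b Hab). intros x Hx. apply Hphi. lra. }
  { rewrite (Rmin_left a b Hab) (Rmax_right a b Hab). intros x Hx.
    apply derivable_continuous_pt. exists (Re w * Re (F' x) + Im w * Im (F' x)).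
    apply is_derive_Reals. apply Hphi. exact Hx. }
  rewrite (Rmin_left a b Hab) (Rmax_right a b Hab) in Hc.
  destruct (H c Hc) as [_ HM].
  assert (Ew : phi b - phi a = Cmod w ^ 2).
  { rewrite Cmod2_alt. unfold phi, w, Re, Im, Cminus, Cplus, Copp; simpl. ring. }
  rewrite Ew in E.
  assert (Hcs : Re w * Re (F' c) + Im w * Im (F' c) <= Cmod w * M).
  { apply Rle_trans with (Rabs (Re (Cconj w * F' c)%C)).
    - eapply Rle_trans; [|apply Rle_abs]. right. unfold Re, Im, Cconj, Cmult; simpl. ring.
    - eapply Rle_trans; [apply re_le_Cmod|]. rewrite Cmod_mult Cmod_conj.
      apply Rmult_le_compat_l; [apply Cmod_ge_0|exact HM]. }
  destruct (Rle_lt_or_eq_dec 0 (Cmod w) (Cmod_ge_0 w)) as [Hw|Hw].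
  - apply (Rmult_le_reg_l (Cmod w)); [exact Hw|].
    fold w. replace (Cmod w * Cmod w) with (Cmod w ^ 2) by ring. rewrite E -Rmult_assoc.
    apply Rmult_le_compat_r; [lra|exact Hcs].
  - fold w. rewrite -Hw. apply Rmult_le_pos; [|lra].
    eapply Rle_trans; [apply Cmod_ge_0|exact HM].
Qed.

Lemma vderiv_shift (F : R -> C) (t u : R) (l : C) :
  vderiv F (t + u) l -> vderiv (fun x => F (x + u)) t l.
Proof.
  assert (Hg : forall (g : R -> R) (k : R), is_derive g (t + u) k -> is_derive (fun x => g (x + u)) t k).
  { intros g k Hg. replace k with (scal 1 k) by (unfold scal; simpl; unfold mult; simpl; ring).
    apply (is_derive_comp g (fun x => x + u)); [exact Hg|]. auto_derive; [exact I|ring]. }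
  intros [H1 H2]. split; [apply (Hg _ _ H1)|apply (Hg _ _ H2)].
Qed.

Lemma vderiv_minus (F G : R -> C) (t : R) (l k : C) :
  vderiv F t l -> vderiv G t k -> vderiv (fun x => F x - G x)%C t (l - k)%C.
Proof.
  intros [F1 F2] [G1 G2]. split.
  - apply (is_derive_minus (K:=R_AbsRing) (V:=R_NormedModule)); assumption.
  - apply (is_derive_minus (K:=R_AbsRing) (V:=R_NormedModule)); assumption.
Qed.

(** * Central differences and averages *)

Definition sdiff (u : R) (F : R -> C) (t : R) : C := (F (t + u)%R - F (t - u)%R)%C.
Definition savg (u : R) (F : R -> C) (t : R) : C := (F (t + u)%R + F (t - u)%R)%C.

(** Each difference costs one derivative and one factor [2 * u], by the mean value inequality;
   [F j] stands for the derivative of order [j]. *)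
Lemma iter_sdiff_bound (u M : R) : 0 <= u -> forall (n : nat) (F : nat -> R -> C) (t : R),
  (forall j x, (j < n)%nat -> Rabs (x - t) <= INR n * u -> vderiv (F j) x (F (S j) x)) ->
  (forall x, Rabs (x - t) <= INR n * u -> Cmod (F n x) <= M) ->
  Cmod (Nat.iter n (sdiff u) (F 0%nat) t) <= (2 * u) ^ n * M.
Proof.
  intros Hu n. revert M. induction n as [|n IH]; intros M F t Hd Hb.
  - simpl. rewrite Rmult_1_l. apply Hb. rewrite Rminus_diag Rabs_R0. simpl. lra.
  - rewrite Nat.iter_succ_r.
    replace ((2 * u) ^ S n * M) with ((2 * u) ^ n * (2 * u * M)) by (simpl; ring).
    assert (Hsub : forall x v, Rabs (x - t) <= INR n * u -> Rabs v <= u ->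
       Rabs (x + v - t) <= INR (S n) * u).
    { intros x v Hx Hv. replace (x + v - t) with (x - t + v) by ring.
      eapply Rle_trans; [apply Rabs_triang|]. rewrite S_INR. lra. }
    apply (IH (2 * u * M) (fun j => sdiff u (F j)) t).
    + intros j x Hj Hx. apply (vderiv_minus (fun y => F j (y + u)) (fun y => F j (y - u))).
      * apply vderiv_shift. apply Hd; [lia|]. apply Hsub; [exact Hx|]. rewrite Rabs_pos_eq; lra.
      * apply (vderiv_shift _ _ (- u)). apply Hd; [lia|]. apply Hsub; [exact Hx|]. rewrite Rabs_Ropp Rabs_pos_eq; lra.
    + intros x Hx. unfold sdiff.
      replace (2 * u * M) with (M * ((x + u) - (x - u))) by ring.
      apply (C_mvt (F n) (F (S n))); [lra|].
      intros s Hs. assert (Hs' : Rabs (s - t) <= INR (S n) * u).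
      { replace (s - t) with (x + (s - x) - t) by ring. apply Hsub; [exact Hx|].
        apply Rabs_le. lra. }
      split; [apply Hd; [lia|exact Hs']|apply Hb; exact Hs'].
Qed.

Lemma iter_pm_bound (op : R -> (R -> C) -> R -> C) (u : R) : 0 <= u ->
  (op = sdiff \/ op = savg) -> forall (n : nat) (F : R -> C) (t M : R),
  (forall x, Rabs (x - t) <= INR n * u -> Cmod (F x) <= M) ->
  Cmod (Nat.iter n (op u) F t) <= 2 ^ n * M.
Proof.
  intros Hu Hop n. induction n as [|n IH]; intros F t M Hb.
  - simpl. rewrite Rmult_1_l. apply Hb. rewrite Rminus_diag Rabs_R0. simpl. lra.
  - rewrite Nat.iter_succ_r.
    replace (2 ^ S n * M) with (2 ^ n * (2 * M)) by (simpl; ring).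
    apply IH. intros x Hx.
    assert (Hsub : forall v, Rabs v <= u -> Cmod (F (x + v)) <= M).
    { intros v Hv. apply Hb. replace (x + v - t) with (x - t + v) by ring.
      eapply Rle_trans; [apply Rabs_triang|]. rewrite S_INR. lra. }
    assert (H1 := Hsub u ltac:(rewrite Rabs_pos_eq; lra)).
    assert (H2 := Hsub (- u) ltac:(rewrite Rabs_Ropp Rabs_pos_eq; lra)).
    destruct Hop as [-> | ->]; unfold sdiff, savg;
    (eapply Rle_trans; [apply Cmod_triangle|]); rewrite ?Cmod_opp; unfold Rminus; lra.
Qed.

Lemma vderiv_cont_Cmod (F : R -> C) (t : R) (l : C) :
  vderiv F t l -> continuity_pt (fun x => Cmod (F x)) t.
Proof.
  intros [H1 H2].
  assert (C1 : continuity_pt (fun x => Re (F x)) t).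
  { apply derivable_continuous_pt. exists (Re l). apply is_derive_Reals. exact H1. }
  assert (C2 : continuity_pt (fun x => Im (F x)) t).
  { apply derivable_continuous_pt. exists (Im l). apply is_derive_Reals. exact H2. }
  unfold Cmod.
  apply (continuity_pt_comp (fun x => Re (F x) ^ 2 + Im (F x) ^ 2) sqrt).
  - apply (continuity_pt_plus (fun x => Re (F x) ^ 2) (fun x => Im (F x) ^ 2)).
    + apply (continuity_pt_comp (fun x => Re (F x)) (fun y => y ^ 2)); [exact C1|].
      apply derivable_continuous_pt. apply derivable_pt_pow.
    + apply (continuity_pt_comp (fun x => Im (F x)) (fun y => y ^ 2)); [exact C2|].
      apply derivable_continuous_pt. apply derivable_pt_pow.
  - apply continuity_pt_sqrt.
    apply Rplus_le_le_0_compat; apply pow2_ge_0.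
Qed.

(** * Real-analytic continuation and double series *)

Definition R_analytic_at (f : R -> R) (x0 : R) : Prop :=
  exists (a : nat -> R) (r : R), 0 < r /\
    forall x : R, Rabs (x - x0) < r -> is_series (fun n => a n * (x - x0) ^ n) (f x).

(** The constant coefficient vanishes by continuity of the sum at [0]; dividing by [x] shifts the
   others down. *)
Lemma R_pseries_zero (r : R) : 0 < r -> forall (n : nat) (a : nat -> R),
  (forall x, 0 < x < r -> is_pseries a x 0) -> a n = 0.
Proof.
  intros Hr.
  assert (H0 : forall a : nat -> R, (forall x, 0 < x < r -> is_pseries a x 0) -> a 0%nat = 0).
  { intros a Ha.
    assert (Hcv : Rbar_lt (Rabs 0) (CV_radius a)).
    { apply Rbar_lt_le_trans with (Finite (Rabs (r / 2))).
      - rewrite Rabs_R0. rewrite Rabs_pos_eq; simpl; lra.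
      - apply Rbar_not_lt_le. intros Hlt. apply (CV_disk_outside a (r / 2) Hlt).
        apply is_lim_seq_ext with (fun n => scal (pow_n (r / 2) n) (a n)).
        { intros n. rewrite pow_n_pow. unfold scal; simpl; unfold mult; simpl. ring. }
        apply ex_series_lim_0. exists 0. apply Ha. lra. }
    pose proof (PSeries_continuity a 0 Hcv) as Hc.
    rewrite -(PSeries_0 a).
    destruct (Req_dec (PSeries a 0) 0) as [E|E]; [exact E|exfalso].
    assert (He : 0 < Rabs (PSeries a 0)) by (apply Rabs_pos_lt; exact E).
    apply continuity_pt_filterlim in Hc.
    pose proof (proj1 (filterlim_locally _ _) Hc (mkposreal _ He)) as [d Hd].
    assert (Hm : 0 < Rmin (d / 2) (r / 2)).
    { apply Rmin_pos; [pose proof (cond_pos d)|]; lra. }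
    pose proof (Rmin_l (d / 2) (r / 2)) as Hl. pose proof (Rmin_r (d / 2) (r / 2)) as Hr'.
    specialize (Hd (Rmin (d / 2) (r / 2))).
    rewrite (is_pseries_unique a _ 0 (Ha (Rmin (d / 2) (r / 2)) ltac:(lra))) in Hd.
    assert (Hball : ball 0 d (Rmin (d / 2) (r / 2))).
    { change (Rabs (Rmin (d / 2) (r / 2) - 0) < d). pose proof (cond_pos d).
      rewrite Rminus_0_r Rabs_pos_eq; lra. }
    specialize (Hd Hball). change (Rabs (0 - PSeries a 0) < Rabs (PSeries a 0)) in Hd.
    rewrite Rminus_0_l Rabs_Ropp in Hd. lra. }
  induction n as [|n IH]; intros a Ha; [apply H0; exact Ha|].
  apply (IH (PS_decr_1 a)). intros x Hx.
  pose proof (is_pseries_decr_1 a x (/ x) 0 ltac:(unfold mult, one; simpl; field; lra) (Ha x Hx)) as Hd.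
  rewrite (H0 a Ha) in Hd.
  replace 0 with (scal (/ x) (plus 0 (opp 0)) : R); [exact Hd|].
  unfold scal, plus, opp; simpl. unfold mult; simpl. ring.
Qed.

(** At the supremum [s] of the points where [f] is nonzero, [f] vanishes to the right of [s], so all
   the coefficients of its expansion vanish and [f] is zero on both sides of [s]. *)
Theorem R_identity_theorem (f : R -> R) :
  (forall x, 0 < x -> R_analytic_at f x) -> (forall x, 1 < x -> f x = 0) ->
  forall x, 0 < x -> f x = 0.
Proof.
  intros Hf H1 y Hy.
  destruct (Req_dec (f y) 0) as [E|E]; [exact E|exfalso].
  destruct (completeness (fun x => 0 < x /\ f x <> 0)) as [s [Hub Hlub]].
  - exists 1. intros x [_ Hx]. apply Rnot_lt_le. intros Hlt. apply Hx. apply H1. exact Hlt.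
  - exists y. split; assumption.
  - assert (Hys : y <= s) by (apply Hub; split; assumption).
    assert (Hzero : forall x, s < x -> f x = 0).
    { intros x Hx. destruct (Req_dec (f x) 0) as [Ex|Ex]; [exact Ex|exfalso].
      assert (x <= s); [apply Hub; split; [lra|exact Ex]|lra]. }
    destruct (Hf s ltac:(lra)) as (a & r & Hr & Ha).
    assert (Hcoef : forall n, a n = 0).
    { intros n. apply (R_pseries_zero r Hr). intros x Hx. apply (proj2 (is_pseries_R _ _ _)).
      rewrite -(Hzero (s + x) ltac:(lra)).
      apply is_series_ext with (fun n => a n * (s + x - s) ^ n).
      { intros m. do 2 f_equal. ring. }
      apply Ha. replace (s + x - s) with x by ring. rewrite Rabs_pos_eq; lra. }
    assert (Hs' : s <= s - r); [|lra].
    apply Hlub. intros x [Hx0 Hx].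
    apply Rnot_lt_le. intros Hlt. apply Hx.
    destruct (Rle_lt_dec x s) as [Hxs|Hxs]; [|apply Hzero; exact Hxs].
    assert (Hser := Ha x ltac:(apply Rabs_def1; lra)).
    apply is_series_unique in Hser. rewrite -Hser.
    apply is_series_unique. apply is_series_ext with (fun n => 0).
    { intros n. rewrite Hcoef. symmetry. apply Rmult_0_l. }
    change (is_lim_seq (sum_n (fun _ => 0)) 0).
    apply (is_lim_seq_ext (fun _ => 0)); [|apply is_lim_seq_const].
    intros n. rewrite sum_n_const. ring.
Qed.

(** The geometric factor makes the tails of the inner series small uniformly against the summable
   [tau], so the two limits may be exchanged. *)
Lemma double_series (c : nat -> nat -> R) (g tau : nat -> R) (q : R) :
  0 <= q < 1 -> ex_series tau ->
  (forall n k, Rabs (c n k) <= tau n * q ^ k) ->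
  (forall n, is_series (c n) (g n)) ->
  is_series (fun k => Series (fun n => c n k)) (Series g).
Proof.
  intros Hq Htau Hc Hg.
  assert (Hexk : forall k, ex_series (fun n => c n k)).
  { intros k. apply (ex_series_le (K:=R_AbsRing) (V:=R_CompleteNormedModule) _ (fun n => tau n * q ^ k)).
    - intros n. apply Hc.
    - apply ex_series_scal_r. exact Htau. }
  assert (Hgeo : forall m, is_series (fun k => q ^ (S m + k)) (q ^ (S m) / (1 - q))).
  { intros m. apply is_series_ext with (fun k => scal (q ^ S m) (q ^ k)).
    { intros k. rewrite pow_add. reflexivity. }
    replace (q ^ S m / (1 - q)) with (scal (q ^ S m) (/ (1 - q)) : R) by reflexivity.
    apply (is_series_scal (K:=R_AbsRing) (V:=R_NormedModule)).
    apply is_series_geom. rewrite Rabs_pos_eq; lra. }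
  assert (Htail : forall m n, Rabs (g n - sum_n (c n) m) <= tau n * (q ^ (S m) / (1 - q))).
  { intros m n.
    assert (E : g n - sum_n (c n) m = Series (fun k => c n (S m + k)%nat)).
    { rewrite -(is_series_unique _ _ (Hg n)).
      rewrite (Series_incr_n (c n) (S m)); [|lia|eexists; apply Hg].
      simpl pred. rewrite sum_n_Reals. ring. }
    rewrite E.
    assert (Hex : ex_series (fun k => tau n * q ^ (S m + k))).
    { exact (ex_series_scal (K:=R_AbsRing) (V:=R_NormedModule) (tau n) _ (ex_intro _ _ (Hgeo m))). }
    eapply Rle_trans.
    - apply Series_Rabs.
      apply (ex_series_le (K:=R_AbsRing) (V:=R_CompleteNormedModule) _ (fun k => tau n * q ^ (S m + k))); [|exact Hex].
      intros k. unfold norm; simpl. unfold abs; simpl. rewrite Rabs_Rabsolu. apply Hc.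
    - rewrite -(is_series_unique _ _ (Hgeo m)). rewrite -Series_scal_l.
      apply Series_le; [|exact Hex]. intros k. split; [apply Rabs_pos|apply Hc]. }
  assert (Hexg : ex_series g).
  { apply (ex_series_le (K:=R_AbsRing) (V:=R_CompleteNormedModule) _ (fun n => tau n * (1 / (1 - q)))).
    - intros n.
      assert (Htau0 : 0 <= tau n).
      { eapply Rle_trans; [apply Rabs_pos|]. eapply Rle_trans; [apply (Hc n 0%nat)|]. simpl. lra. }
      specialize (Htail 0%nat n). rewrite sum_O in Htail. specialize (Hc n 0%nat).
      change (norm (g n)) with (Rabs (g n)).
      replace (g n) with (g n - c n 0%nat + c n 0%nat) by ring.
      eapply Rle_trans; [apply Rabs_triang|].
      replace (tau n * (1 / (1 - q))) with (tau n * (q ^ 1 / (1 - q)) + tau n * q ^ 0) by (simpl; field; lra).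
      lra.
    - apply ex_series_scal_r. exact Htau. }
  assert (Hsum : forall m, ex_series (fun n => sum_n (c n) m) /\
     sum_n (fun k => Series (fun n => c n k)) m = Series (fun n => sum_n (c n) m)).
  { induction m as [|m [IH1 IH2]].
    - split.
      + eapply ex_series_ext; [|apply (Hexk 0%nat)]. intros n. rewrite sum_O. reflexivity.
      + rewrite sum_O. apply Series_ext. intros n. rewrite sum_O. reflexivity.
    - split.
      + eapply ex_series_ext; [|apply (ex_series_plus _ _ IH1 (Hexk (S m)))].
        intros n. rewrite sum_Sn. reflexivity.
      + rewrite sum_Sn IH2. unfold plus; simpl. rewrite -Series_plus; [|exact IH1|apply Hexk].
        apply Series_ext. intros n. rewrite sum_Sn. reflexivity. }
  assert (Hlim : is_lim_seq (fun m => Series tau * (q ^ (S m) / (1 - q))) 0).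
  { replace (Finite 0) with (Rbar_mult (Series tau) (Rbar_mult 0 (/ (1 - q)))).
    - apply is_lim_seq_mult'; [apply is_lim_seq_const|].
      apply is_lim_seq_mult'; [|apply is_lim_seq_const].
      apply (is_lim_seq_incr_1 (fun m => q ^ m)). apply is_lim_seq_geom. rewrite Rabs_pos_eq; lra.
    - simpl. f_equal. ring. }
  change (is_lim_seq (sum_n (fun k => Series (fun n => c n k))) (Series g)).
  apply (is_lim_seq_ext (fun m => Series g + (sum_n (fun k => Series (fun n => c n k)) m - Series g))).
  { intros m. ring. }
  replace (Finite (Series g)) with (Finite (Series g + 0)) by (f_equal; ring).
  apply is_lim_seq_plus'; [apply is_lim_seq_const|].
  apply is_lim_seq_abs_0.
  apply (is_lim_seq_le_le (fun _ => 0) _ (fun m => Series tau * (q ^ (S m) / (1 - q)))); [|apply is_lim_seq_const|exact Hlim].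
  intros m. split; [apply Rabs_pos|].
  destruct (Hsum m) as [He ->].
  rewrite -Rabs_Ropp Ropp_minus_distr.
  rewrite -Series_minus; [|exact Hexg|exact He].
  rewrite -Series_scal_r.
  assert (Hext : ex_series (fun n => tau n * (q ^ (S m) / (1 - q)))) by (apply ex_series_scal_r; exact Htau).
  eapply Rle_trans.
  - apply Series_Rabs. apply (ex_series_le (K:=R_AbsRing) (V:=R_CompleteNormedModule) _ (fun n => tau n * (q ^ (S m) / (1 - q)))); [|exact Hext].
    intros n. change (Rabs (Rabs (g n - sum_n (c n) m)) <= tau n * (q ^ S m / (1 - q))).
    rewrite Rabs_Rabsolu. apply Htail.
  - apply Series_le; [|exact Hext]. intros n. split; [apply Rabs_pos|apply Htail].
Qed.

(** * Euler-Maclaurin remainders of the zeta function *)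

(** The power [u^(-s)] for real [u > 0]; at integers it is [nat_Cpow_opp]. *)
Definition cpow_opp (u : R) (s : C) : C := Cexp (- s * RtoC (ln u))%C.

Lemma Cexp_plus (a b : C) : Cexp (a + b)%C = (Cexp a * Cexp b)%C.
Proof.
  unfold Cexp, Cmult, Re, Im; simpl. rewrite exp_plus cos_plus sin_plus. f_equal; ring.
Qed.

Lemma Cmod_Cexp (a : C) : Cmod (Cexp a) = exp (Re a).
Proof.
  unfold Cexp, Cmod; simpl.
  replace (_ + _) with (Rsqr (exp (Re a)) * (Rsqr (sin (Im a)) + Rsqr (cos (Im a)))) by (unfold Rsqr; ring).
  rewrite sin2_cos2 Rmult_1_r. apply sqrt_Rsqr. left. apply exp_pos.
Qed.

Lemma cpow_opp_val (u : R) (s : C) :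
  cpow_opp u s = (exp (- Re s * ln u) * cos (Im s * ln u), - (exp (- Re s * ln u) * sin (Im s * ln u))).
Proof.
  unfold cpow_opp, Cexp.
  replace (Re (- s * RtoC (ln u))%C) with (- Re s * ln u) by (unfold Re, Cmult, Copp, RtoC; simpl; ring).
  replace (Im (- s * RtoC (ln u))%C) with (- (Im s * ln u)) by (unfold Im, Cmult, Copp, RtoC; simpl; ring).
  rewrite cos_neg sin_neg. f_equal. ring.
Qed.

Lemma cpow_opp_1 (s : C) : cpow_opp 1 s = 1%C.
Proof. rewrite cpow_opp_val ln_1 !Rmult_0_r exp_0 cos_0 sin_0. unfold RtoC. f_equal; ring. Qed.

Lemma Cmod_cpow_opp (u : R) (s : C) : Cmod (cpow_opp u s) = exp (- Re s * ln u).
Proof.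
  unfold cpow_opp. rewrite Cmod_Cexp. f_equal. unfold Re, Cmult, Copp, RtoC; simpl; ring.
Qed.

(** The coefficient of order [k] of the Taylor expansion of [s |-> u^(-s)] at [s0]; [tcoef1] and
   [tcoef2] are those of [(s - s0) u^(-s)] and [(s - s0)^2 u^(-s)]. *)
Definition tcoef (s0 : C) (k : nat) (u : R) : C :=
  (RtoC ((- ln u) ^ k / INR (Factorial.fact k)) * cpow_opp u s0)%C.
Definition tcoef1 (s0 : C) (k : nat) (u : R) : C :=
  match k with O => RtoC 0 | S j => tcoef s0 j u end.
Definition tcoef2 (s0 : C) (k : nat) (u : R) : C :=
  match k with O => RtoC 0 | S j => tcoef1 s0 j u end.

(** The expansion at [s0] of the derivative [- s u^(-s) / u] with respect to [u], where [s] is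
   written as [s0 + (s - s0)]. *)
Lemma tcoef_vderiv s0 k u : 0 < u ->
  vderiv (tcoef s0 k) u ((- s0 * tcoef s0 k u - tcoef1 s0 k u) * RtoC (/ u))%C.
Proof.
  intros Hu.
  set (x := Re s0). set (t := Im s0).
  assert (Hre : forall v, Re (tcoef s0 k v) = (- ln v) ^ k / INR (Factorial.fact k) * (exp (- x * ln v) * cos (t * ln v))).
  { intros v. unfold tcoef. rewrite cpow_opp_val. unfold Re at 1, Cmult, RtoC; simpl. fold x t. ring. }
  assert (Him : forall v, Im (tcoef s0 k v) = - ((- ln v) ^ k / INR (Factorial.fact k) * (exp (- x * ln v) * sin (t * ln v)))).
  { intros v. unfold tcoef. rewrite cpow_opp_val. unfold Im at 1, Cmult, RtoC; simpl. fold x t. ring. }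
  assert (Hs0 : s0 = (x, t)) by apply surjective_pairing.
  assert (Hf := INR_fact_neq_0 k).
  split; [apply (is_derive_ext (fun v => (- ln v) ^ k / INR (Factorial.fact k) * (exp (- x * ln v) * cos (t * ln v))));
    [intros v; symmetry; apply Hre|]
  |apply (is_derive_ext (fun v => - ((- ln v) ^ k / INR (Factorial.fact k) * (exp (- x * ln v) * sin (t * ln v)))));
    [intros v; symmetry; apply Him|]];
  rewrite Hs0; unfold tcoef1; destruct k as [|j]; (auto_derive; [tauto|]);
  unfold tcoef; rewrite cpow_opp_val; unfold Re, Im, Cmult, Cminus, Cplus, Copp, RtoC;
  [simpl; field; lra| |simpl; field; lra|];
  rewrite fact_simpl in Hf |- *; rewrite mult_INR in Hf |- *;
  (assert (INR (Factorial.fact j) <> 0) by apply INR_fact_neq_0);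
  rewrite S_INR in Hf |- *;
  (assert (INR j + 1 <> 0) by (pose proof (pos_INR j); lra));
  simpl fst; simpl snd; simpl Nat.pred; simpl pow;
  pose proof (S_INR j) as Hsj; simpl in Hsj; rewrite ?Hsj;
  field; repeat split; try assumption; lra.
Qed.

Lemma tcoef1_vderiv s0 k u : 0 < u ->
  vderiv (tcoef1 s0 k) u ((- s0 * tcoef1 s0 k u - tcoef2 s0 k u) * RtoC (/ u))%C.
Proof.
  intros Hu. destruct k as [|j]; [|apply tcoef_vderiv; exact Hu].
  unfold tcoef1, tcoef2.
  replace ((- s0 * 0 - 0) * RtoC (/ u))%C with (RtoC 0) by ring.
  split; apply (is_derive_const (K:=R_AbsRing) (V:=R_NormedModule)).
Qed.

Lemma vderiv_scal (c : C) (F : R -> C) (t : R) (l : C) :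
  vderiv F t l -> vderiv (fun x => c * F x)%C t (c * l)%C.
Proof.
  intros [H1 H2]. split.
  - apply (is_derive_minus (K:=R_AbsRing) (V:=R_NormedModule)
      (fun x => Re c * Re (F x)) (fun x => Im c * Im (F x))); apply is_derive_scal; assumption.
  - apply (is_derive_plus (K:=R_AbsRing) (V:=R_NormedModule)
      (fun x => Re c * Im (F x)) (fun x => Im c * Re (F x))); apply is_derive_scal; assumption.
Qed.

Lemma vderiv_var_mult (F : R -> C) (t : R) (l : C) :
  vderiv F t l -> vderiv (fun x => RtoC x * F x)%C t (F t + RtoC t * l)%C.
Proof.
  assert (Hg : forall (g : R -> R) (k : R), is_derive g t k -> is_derive (fun x => x * g x) t (g t + t * k)).
  { intros g k Hg. replace (g t + t * k) with (plus (mult 1 (g t)) (mult t k)) by (unfold plus, mult; simpl; ring).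
    apply (is_derive_mult (fun x => x) g); [exact (is_derive_id (K:=R_AbsRing) t)|exact Hg|]. intros; apply Rmult_comm. }
  intros [H1 H2]. split.
  - apply (is_derive_ext (fun x => x * Re (F x))).
    { intros x. unfold Re, Cmult, RtoC; simpl. ring. }
    replace (Re (F t + RtoC t * l)%C) with (Re (F t) + t * Re l) by (unfold Re, Cplus, Cmult, RtoC; simpl; ring).
    apply Hg, H1.
  - apply (is_derive_ext (fun x => x * Im (F x))).
    { intros x. unfold Im, Cmult, RtoC; simpl. ring. }
    replace (Im (F t + RtoC t * l)%C) with (Im (F t) + t * Im l) by (unfold Im, Cplus, Cmult, RtoC; simpl; ring).
    apply Hg, H2.
Qed.

(** Taylor coefficients at [s0] of [(1-s)(n+1)^(-s) - ((n+1)^(1-s) - n^(1-s))]: a value of the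
   derivative of [u |-> u^(1-s)] minus its increment, hence of the size of the second derivative.
   Order [0] is the value at [s0]. *)
Definition em_term (s0 : C) (k : nat) (n : R) : C :=
  (((1 - s0) * tcoef s0 k (n + 1) - tcoef1 s0 k (n + 1)%R)
    - (RtoC (n + 1) * tcoef s0 k (n + 1)%R - RtoC n * tcoef s0 k n))%C.

(** The mean value inequality, applied to the increment minus its linear approximation and then
   to the derivative, coefficient by coefficient in [s]. *)
Lemma em_term_bound (s0 : C) (k : nat) (n M : R) : 0 < n ->
  (forall u, n <= u <= n + 1 ->
     Cmod ((1 - s0) * (- s0 * tcoef s0 k u - tcoef1 s0 k u) - (- s0 * tcoef1 s0 k u - tcoef2 s0 k u))%C <= M * u) ->
  Cmod (em_term s0 k n) <= M.
Proof.
  intros Hn HM.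
  (* the derivative of [u^(1-s)], coefficientwise, and the derivative of that *)
  set (dPsi := fun u => ((1 - s0) * tcoef s0 k u - tcoef1 s0 k u)%C).
  set (ddPsi := fun u => (((1 - s0) * (- s0 * tcoef s0 k u - tcoef1 s0 k u) - (- s0 * tcoef1 s0 k u - tcoef2 s0 k u)) * RtoC (/ u))%C).
  assert (Hdd : forall u, n <= u <= n + 1 -> vderiv dPsi u (ddPsi u) /\ Cmod (ddPsi u) <= M).
  { intros u Hu. split.
    - replace (ddPsi u) with ((1 - s0) * ((- s0 * tcoef s0 k u - tcoef1 s0 k u) * RtoC (/ u)) - (- s0 * tcoef1 s0 k u - tcoef2 s0 k u) * RtoC (/ u))%C
        by (unfold ddPsi; ring).
      apply (vderiv_minus (fun x => (1 - s0) * tcoef s0 k x)%C (tcoef1 s0 k)).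
      + apply vderiv_scal. apply tcoef_vderiv. lra.
      + apply tcoef1_vderiv. lra.
    - unfold ddPsi. rewrite Cmod_mult Cmod_R Rabs_pos_eq; [|left; apply Rinv_0_lt_compat; lra].
      apply (Rmult_le_reg_r u); [lra|]. rewrite Rmult_assoc Rinv_l; [|lra]. rewrite Rmult_1_r. apply HM. exact Hu. }
  assert (Hd : forall u, n <= u <= n + 1 -> Cmod (dPsi (n + 1)%R - dPsi u)%C <= M).
  { intros u Hu. assert (HM0 : 0 <= M).
    { eapply Rle_trans; [apply Cmod_ge_0|apply (Hdd u Hu)]. }
    eapply Rle_trans; [apply (C_mvt dPsi ddPsi u (n + 1) M); [lra|intros t Ht; apply Hdd; lra]|]. nra. }
  pose proof (C_mvt (fun u => dPsi (n + 1)%R * RtoC u - RtoC u * tcoef s0 k u)%C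
     (fun u => dPsi (n + 1)%R - dPsi u)%C n (n + 1) M ltac:(lra)) as H.
  replace (M * (n + 1 - n)) with M in H by ring.
  eapply Rle_trans; [|apply H].
  - right. f_equal. unfold em_term, dPsi. rewrite !RtoC_plus. ring.
  - intros u Hu. split; [|apply Hd; exact Hu].
    apply vderiv_minus.
    + assert (Hx : vderiv (fun x => dPsi (n + 1)%R * RtoC x)%C u (dPsi (n + 1)%R * 1)%C).
      2:{ rewrite Cmult_1_r in Hx. exact Hx. }
      apply (vderiv_scal (dPsi (n + 1)) RtoC u 1%C). split; simpl; [exact (is_derive_id (K:=R_AbsRing) u)|apply (is_derive_const (K:=R_AbsRing) (V:=R_NormedModule) 0 u)].
    + replace (dPsi u) with (tcoef s0 k u + RtoC u * ((- s0 * tcoef s0 k u - tcoef1 s0 k u) * RtoC (/ u)))%C.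
      * apply vderiv_var_mult. apply tcoef_vderiv. lra.
      * unfold dPsi. rewrite RtoC_inv; [|lra]. field. intros E. apply (f_equal fst) in E. simpl in E. lra.
Qed.

(** What [Re] and [Im] have in common, so that passing from complex to real series is done once. *)
Record coord (p : C -> R) : Prop := {
  coord_plus : forall x y, p (x + y)%C = p x + p y;
  coord_scal : forall (h : R) x, p (RtoC h * x)%C = h * p x;
  coord_le : forall x, Rabs (p x) <= Cmod x }.

Lemma coord_Re : coord Re.
Proof.
  split; [reflexivity| |apply re_le_Cmod].
  intros h x. unfold Re, Cmult, RtoC; simpl. ring.
Qed.

Lemma coord_Im : coord Im.
Proof.
  split; [reflexivity| |apply im_le_Cmod].
  intros h x. unfold Im, Cmult, RtoC; simpl. ring.
Qed.

Lemma coord_minus p : coord p -> forall x y, p (x - y)%C = p x - p y.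
Proof.
  intros Hp x y. replace (x - y)%C with (x + RtoC (- 1) * y)%C.
  - rewrite (coord_plus p Hp) (coord_scal p Hp). ring.
  - destruct x, y. unfold Cminus, Cplus, Copp, Cmult, RtoC; simpl. f_equal; ring.
Qed.

Lemma C_series_coord p (a : nat -> C) (l : C) : coord p ->
  @is_series C_AbsRing C_NormedModule a l -> is_series (fun n => p (a n)) (p l).
Proof.
  intros Hp H.
  apply (proj2 (filterlim_locally _ _)). intros eps.
  destruct (proj1 (C_series_eps a l) H eps (cond_pos eps)) as [N HN].
  exists N. intros n Hn. specialize (HN n Hn).
  assert (E : sum_n (fun n => p (a n)) n = p (@sum_n C_AbelianMonoid a n)).
  { clear HN Hn. induction n as [|n IH]; [rewrite C_sum_n_0 sum_O; reflexivity|].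
    rewrite C_sum_n_S sum_Sn IH (coord_plus p Hp). reflexivity. }
  change (Rabs (sum_n (fun n => p (a n)) n - p l) < eps).
  rewrite E -(coord_minus p Hp). eapply Rle_lt_trans; [apply (coord_le p Hp)|exact HN].
Qed.

Lemma C_series_of_R (r : nat -> R) (l : R) (c : C) :
  is_series r l -> @is_series C_AbsRing C_NormedModule (fun n => RtoC (r n) * c)%C (RtoC l * c)%C.
Proof.
  intros H. apply C_series_eps. intros eps Heps.
  assert (Hc := Cmod_ge_0 c).
  assert (He : 0 < eps / (Cmod c + 1)) by (apply Rdiv_lt_0_compat; lra).
  pose proof (proj1 (filterlim_locally _ _) H (mkposreal _ He)) as [N HN].
  exists N. intros n Hn. specialize (HN n Hn).
  change (Rabs (sum_n r n - l) < eps / (Cmod c + 1)) in HN.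
  assert (E : @sum_n C_AbelianMonoid (fun n => RtoC (r n) * c)%C n = (RtoC (sum_n r n) * c)%C).
  { clear HN Hn. induction n as [|n IH]; [rewrite C_sum_n_0 sum_O; reflexivity|].
    rewrite C_sum_n_S sum_Sn IH. change (plus (sum_n r n) (r (S n))) with (sum_n r n + r (S n)).
    generalize (sum_n r n). intros y. rewrite RtoC_plus. symmetry. apply Cmult_plus_distr_r. }
  rewrite E. replace (RtoC (sum_n r n) * c - RtoC l * c)%C with (RtoC (sum_n r n - l) * c)%C by (rewrite RtoC_minus; ring).
  rewrite Cmod_mult Cmod_R.
  apply (Rmult_lt_compat_r (Cmod c + 1)) in HN; [|lra].
  replace (eps / (Cmod c + 1) * (Cmod c + 1)) with eps in HN by (field; lra).
  pose proof (Rabs_pos (sum_n r n - l)). nra.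
Qed.

Lemma cpow_opp_shift (u D : R) (s0 : C) : cpow_opp u (s0 + RtoC D)%C = (RtoC (exp (- D * ln u)) * cpow_opp u s0)%C.
Proof.
  unfold cpow_opp. replace (- (s0 + RtoC D) * RtoC (ln u))%C with (RtoC (- D * ln u) + - s0 * RtoC (ln u))%C.
  - rewrite Cexp_plus. f_equal. unfold Cexp, RtoC, Re, Im; simpl. rewrite cos_0 sin_0. f_equal; ring.
  - rewrite RtoC_mult RtoC_opp. ring.
Qed.

Lemma tcoef_0 s u : tcoef s 0 u = cpow_opp u s.
Proof. unfold tcoef. simpl. replace (1 / 1) with 1 by field. ring. Qed.

Lemma tcoef_series (s0 : C) (D u : R) :
  @is_series C_AbsRing C_NormedModule (fun k => tcoef s0 k u * RtoC (D ^ k))%C (cpow_opp u (s0 + RtoC D)%C).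
Proof.
  rewrite cpow_opp_shift.
  apply (is_series_ext (fun k => RtoC ((- D * ln u) ^ k / INR (Factorial.fact k)) * cpow_opp u s0)%C).
  { intros k. unfold tcoef. replace (- D * ln u) with ((- ln u) * D) by ring.
    rewrite Rpow_mult_distr. unfold Rdiv. rewrite !RtoC_mult.
    change ((RtoC ((- ln u) ^ k) * RtoC (D ^ k) * RtoC (/ INR (Factorial.fact k)) * cpow_opp u s0)%C =
      (RtoC ((- ln u) ^ k) * RtoC (/ INR (Factorial.fact k)) * cpow_opp u s0 * RtoC (D ^ k))%C). ring. }
  apply C_series_of_R.
  apply (is_series_ext (fun k => / INR (Factorial.fact k) * (- D * ln u) ^ k)).
  { intros k. unfold Rdiv. apply Rmult_comm. }
  apply (proj1 (is_pseries_R _ _ _)); apply is_exp_Reals.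
Qed.

Lemma tcoef1_series (s0 : C) (D u : R) :
  @is_series C_AbsRing C_NormedModule (fun k => tcoef1 s0 k u * RtoC (D ^ k))%C (RtoC D * cpow_opp u (s0 + RtoC D))%C.
Proof.
  replace (RtoC D * cpow_opp u (s0 + RtoC D))%C with (tcoef1 s0 0 u * RtoC (D ^ 0) + RtoC D * cpow_opp u (s0 + RtoC D))%C
    by (simpl; ring).
  apply (C_series_decr (fun k => tcoef1 s0 k u * RtoC (D ^ k))%C).
  apply (C_series_lin _ _ _ _ _ _ (RtoC D) (RtoC 0) (tcoef_series s0 D u) (tcoef_series s0 D u)); [|ring].
  intros k. simpl. rewrite RtoC_mult. ring.
Qed.

Lemma em_term_series (s0 : C) (D n : R) :
  @is_series C_AbsRing C_NormedModule (fun k => em_term s0 k n * RtoC (D ^ k))%C (em_term (s0 + RtoC D)%C 0 n).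
Proof.
  pose proof (C_series_lin _ _ (fun k => ((1 - s0) * tcoef s0 k (n + 1) - tcoef1 s0 k (n + 1)%R) * RtoC (D ^ k))%C _ _
    ((1 - s0 - RtoC D) * cpow_opp (n + 1) (s0 + RtoC D))%C (1 - s0)%C (- (1))%C
    (tcoef_series s0 D (n + 1)) (tcoef1_series s0 D (n + 1)) ltac:(intros k; cbv beta; ring) ltac:(ring)) as H1.
  pose proof (C_series_lin _ _ (fun k => (RtoC (n + 1) * tcoef s0 k (n + 1)%R - RtoC n * tcoef s0 k n) * RtoC (D ^ k))%C _ _
    (RtoC (n + 1) * cpow_opp (n + 1) (s0 + RtoC D) - RtoC n * cpow_opp n (s0 + RtoC D))%C (RtoC (n + 1)) (- RtoC n)%C
    (tcoef_series s0 D (n + 1)) (tcoef_series s0 D n) ltac:(intros k; cbv beta; ring) ltac:(ring)) as H2.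
  apply (C_series_lin _ _ _ _ _ _ 1 (- (1))%C H1 H2).
  - intros k. unfold em_term. ring.
  - unfold em_term. rewrite !tcoef_0. unfold tcoef1. ring.
Qed.

Lemma pow_fact_le_exp (y : R) (k : nat) : 0 <= y -> y ^ k / INR (Factorial.fact k) <= exp y.
Proof.
  intros Hy.
  assert (H : is_series (fun k => / INR (Factorial.fact k) * y ^ k) (exp y)).
  { apply (proj1 (is_pseries_R _ _ _)); apply is_exp_Reals. }
  assert (Hp : forall n, 0 <= / INR (Factorial.fact n) * y ^ n).
  { intros n. apply Rmult_le_pos; [|apply pow_le; exact Hy].
    left. apply Rinv_0_lt_compat. apply INR_fact_lt_0. }
  assert (Hs : sum_n (fun k => / INR (Factorial.fact k) * y ^ k) k <= exp y).
  { apply (is_lim_seq_incr_compare (sum_n (fun k => / INR (Factorial.fact k) * y ^ k))); [exact H|].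
    intros n. rewrite sum_Sn. unfold plus; simpl. specialize (Hp (S n)). simpl in Hp. lra. }
  assert (H1 : forall k, / INR (Factorial.fact k) * y ^ k <= sum_n (fun k => / INR (Factorial.fact k) * y ^ k) k).
  { intros [|m]; [rewrite sum_O; lra|]. rewrite sum_Sn. unfold plus; simpl.
    assert (0 <= sum_n (fun k => / INR (Factorial.fact k) * y ^ k) m); [|simpl in *; lra].
    induction m as [|m IH]; [rewrite sum_O; apply Hp|]. rewrite sum_Sn. unfold plus; simpl.
    specialize (Hp (S m)). simpl in *. lra. }
  specialize (H1 k). unfold Rdiv. lra.
Qed.

Lemma ln_nonneg (u : R) : 1 <= u -> 0 <= ln u.
Proof. intros Hu. rewrite -ln_1. destruct Hu as [Hu|<-]; [left; apply ln_increasing; lra|lra]. Qed.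

Lemma ln_le_mono (x y : R) : 0 < x -> x <= y -> ln x <= ln y.
Proof. intros Hx [H| ->]; [left; apply ln_increasing; assumption|lra]. Qed.

Lemma exp_le_mono (x y : R) : x <= y -> exp x <= exp y.
Proof. intros [H| ->]; [left; apply exp_increasing; assumption|lra]. Qed.

(** From [y ^ k / k! <= exp y] at [y = r * ln u]: the coefficients decay like [r ^ (- k)] at the
   price of a factor [u ^ r]. *)
Lemma tcoef_bound (s0 : C) (r u : R) (k : nat) : 0 < r -> 1 <= u ->
  Cmod (tcoef s0 k u) <= exp ((r - Re s0) * ln u) / r ^ k.
Proof.
  intros Hr Hu. assert (Hl := ln_nonneg u Hu).
  unfold tcoef. rewrite Cmod_mult Cmod_R Cmod_cpow_opp.
  replace ((r - Re s0) * ln u) with (r * ln u + - Re s0 * ln u) by ring. rewrite exp_plus.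
  assert (Hrk : 0 < r ^ k) by (apply pow_lt; exact Hr).
  replace (exp (r * ln u) * exp (- Re s0 * ln u) / r ^ k) with (exp (r * ln u) / r ^ k * exp (- Re s0 * ln u)) by (field; lra).
  apply Rmult_le_compat_r; [left; apply exp_pos|].
  assert (Hf := INR_fact_lt_0 k).
  unfold Rdiv at 1. rewrite Rabs_mult -RPow_abs Rabs_Ropp (Rabs_pos_eq (ln u) Hl).
  rewrite (Rabs_pos_eq (/ _)); [|left; apply Rinv_0_lt_compat; exact Hf].
  apply (Rmult_le_reg_r (r ^ k)); [exact Hrk|].
  replace (exp (r * ln u) / r ^ k * r ^ k) with (exp (r * ln u)) by (field; lra).
  eapply Rle_trans; [|apply (pow_fact_le_exp (r * ln u) k); nra].
  rewrite Rpow_mult_distr. right. field. lra.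
Qed.

(** The power of [n] is summable because [r < Re s0], and the bound is geometric in [k]: these
   are the two decays that [double_series] requires. *)
Lemma em_term_coef_bound (s0 : C) (r n : R) (k : nat) : 0 < r -> r < Re s0 -> 1 <= n ->
  Cmod (em_term s0 k n) <=
   ((1 + Cmod s0) * (Cmod s0 + r) + Cmod s0 * r + r ^ 2) * exp ((r - Re s0 - 1) * ln n) / r ^ k.
Proof.
  intros Hr Hrs Hn.
  assert (Hs := Cmod_ge_0 s0).
  assert (Hrk : 0 < r ^ k) by (apply pow_lt; exact Hr).
  set (K := (1 + Cmod s0) * (Cmod s0 + r) + Cmod s0 * r + r ^ 2).
  assert (HK : 0 <= K) by (unfold K; nra).
  apply em_term_bound; [lra|]. intros u Hu.
  set (e := exp ((r - Re s0) * ln u) / r ^ k).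
  assert (HE := tcoef_bound s0 r u k Hr ltac:(lra)). fold e in HE.
  assert (He : 0 <= e) by (eapply Rle_trans; [apply Cmod_ge_0|exact HE]).
  assert (HEP : Cmod (tcoef1 s0 k u) <= r * e).
  { unfold tcoef1. destruct k as [|j]; [rewrite Cmod_0; nra|].
    eapply Rle_trans; [apply (tcoef_bound s0 r u j Hr); lra|].
    unfold e. simpl. right. field. split; [apply pow_nonzero|]; lra. }
  assert (HEPP : Cmod (tcoef2 s0 k u) <= r ^ 2 * e).
  { unfold tcoef2, tcoef1. destruct k as [|[|j]]; [rewrite Cmod_0; nra|rewrite Cmod_0; nra|].
    eapply Rle_trans; [apply (tcoef_bound s0 r u j Hr); lra|].
    unfold e. simpl. right. field. split; [apply pow_nonzero|]; lra. }
  assert (Hl1 : Cmod (1 - s0)%C <= 1 + Cmod s0).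
  { eapply Rle_trans; [apply Cmod_triangle|]. rewrite Cmod_opp Cmod_1. lra. }
  assert (T1 : Cmod (- s0 * tcoef s0 k u - tcoef1 s0 k u)%C <= (Cmod s0 + r) * e).
  { eapply Rle_trans; [apply Cmod_triangle|]. rewrite Cmod_opp Cmod_mult Cmod_opp. nra. }
  assert (T2 : Cmod (- s0 * tcoef1 s0 k u - tcoef2 s0 k u)%C <= (Cmod s0 * r + r ^ 2) * e).
  { eapply Rle_trans; [apply Cmod_triangle|]. rewrite Cmod_opp Cmod_mult Cmod_opp. nra. }
  apply Rle_trans with (K * e).
  - eapply Rle_trans; [apply Cmod_triangle|]. rewrite Cmod_opp Cmod_mult.
    assert (T3 : Cmod (1 - s0)%C * Cmod (- s0 * tcoef s0 k u - tcoef1 s0 k u)%C <= (1 + Cmod s0) * ((Cmod s0 + r) * e)).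
    { apply Rmult_le_compat; auto using Cmod_ge_0. }
    unfold K. nra.
  - assert (Heu : exp ((r - Re s0) * ln u) = exp ((r - Re s0 - 1) * ln u) * u).
    { rewrite -{3}(exp_ln u); [|lra]. rewrite -exp_plus. f_equal. ring. }
    unfold e. rewrite Heu.
    assert (Hmono : exp ((r - Re s0 - 1) * ln u) <= exp ((r - Re s0 - 1) * ln n)).
    { apply exp_le_mono. assert (ln n <= ln u) by (apply ln_le_mono; lra). nra. }
    unfold Rdiv. rewrite !Rmult_assoc. apply Rmult_le_compat_l; [exact HK|].
    rewrite (Rmult_comm (/ r ^ k) u) -!Rmult_assoc.
    apply Rmult_le_compat_r; [left; apply Rinv_0_lt_compat; exact Hrk|].
    apply Rmult_le_compat_r; [lra|exact Hmono].
Qed.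

Lemma em_term_decay (s : C) (n : R) : 0 < Re s -> 1 <= n ->
  Cmod (em_term s 0 n) <= Cmod (1 - s)%C * Cmod s * exp ((- Re s - 1) * ln n).
Proof.
  intros Hs Hn. apply em_term_bound; [lra|]. intros u Hu.
  rewrite tcoef_0. unfold tcoef1, tcoef2.
  replace ((1 - s) * (- s * cpow_opp u s - 0) - (- s * 0 - 0))%C with (- ((1 - s) * s * cpow_opp u s))%C by ring.
  rewrite Cmod_opp !Cmod_mult Cmod_cpow_opp (Rmult_assoc _ _ u).
  apply Rmult_le_compat_l; [apply Rmult_le_pos; apply Cmod_ge_0|].
  replace (exp (- Re s * ln u)) with (exp ((- Re s - 1) * ln u) * u).
  - apply Rmult_le_compat_r; [lra|]. apply exp_le_mono.
    assert (ln n <= ln u) by (apply ln_le_mono; lra). nra.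
  - rewrite -{2}(exp_ln u); [|lra]. rewrite -exp_plus. f_equal. ring.
Qed.

(** * Analyticity of the Euler-Maclaurin series along horizontal lines *)

Lemma INR_S_ge_1 n : 1 <= INR (S n).
Proof. rewrite S_INR. pose proof (pos_INR n). lra. Qed.

(** The mean value theorem for [u^(-d)]. The right-hand side telescopes when summed over [n], which
   replaces a comparison with an integral. *)
Lemma pow_telescope (d n : R) : 0 < d -> 1 <= n ->
  exp ((- d - 1) * ln n) <= exp ((d + 1) * ln 2) / d * (exp (- d * ln n) - exp (- d * ln (n + 1))).
Proof.
  intros Hd Hn.
  destruct (MVT_gen (fun u => exp (- d * ln u)) n (n + 1) (fun u => - d * exp ((- d - 1) * ln u))) as [c [Hc E]].
  - rewrite Rmin_left; [|lra]. rewrite Rmax_right; [|lra]. intros x Hx.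
    auto_derive; [lra|].
    replace ((- d - 1) * ln x) with (- d * ln x + - ln x) by ring. rewrite exp_plus exp_Ropp exp_ln; [|lra].
    field. lra.
  - rewrite Rmin_left; [|lra]. rewrite Rmax_right; [|lra]. intros x Hx.
    apply derivable_continuous_pt. exists (- d * exp ((- d - 1) * ln x)). apply is_derive_Reals.
    auto_derive; [lra|].
    replace ((- d - 1) * ln x) with (- d * ln x + - ln x) by ring. rewrite exp_plus exp_Ropp exp_ln; [|lra].
    field. lra.
  - rewrite Rmin_left in Hc; [|lra]. rewrite Rmax_right in Hc; [|lra].
    replace (exp (- d * ln n) - exp (- d * ln (n + 1))) with (d * exp ((- d - 1) * ln c)).
    2:{ replace (n + 1 - n) with 1 in E by ring. lra. }
    replace (exp ((d + 1) * ln 2) / d * (d * exp ((- d - 1) * ln c))) with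
      (exp ((d + 1) * ln 2) * exp ((- d - 1) * ln c)) by (field; lra).
    rewrite -exp_plus. apply exp_le_mono.
    assert (Hl : ln c <= ln 2 + ln n).
    { rewrite -ln_mult; [|lra|lra]. apply ln_le_mono; lra. }
    nra.
Qed.

Lemma is_lim_seq_pow_opp (d : R) (X : nat) : 0 < d ->
  is_lim_seq (fun n => exp (- d * ln (INR (S (X + n))))) 0.
Proof.
  intros Hd. apply is_lim_seq_spec. intros eps.
  destruct (nfloor_ex (exp (- ln eps / d))) as [N HN]; [left; apply exp_pos|].
  exists N. intros n Hn. rewrite Rminus_0_r Rabs_pos_eq; [|left; apply exp_pos].
  apply Rlt_le_trans with (exp (ln eps)); [apply exp_increasing|rewrite exp_ln; [lra|apply cond_pos]].
  assert (H1 : exp (- ln eps / d) < INR (S (X + n))).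
  { eapply Rlt_le_trans; [apply HN|]. rewrite -S_INR. apply le_INR. lia. }
  apply ln_increasing in H1; [|apply exp_pos]. rewrite ln_exp in H1.
  apply (Rmult_lt_compat_l d) in H1; [|exact Hd].
  replace (d * (- ln eps / d)) with (- ln eps) in H1 by (field; lra). lra.
Qed.

Lemma telescope_series (d : R) (X : nat) : 0 < d ->
  is_series (fun n => exp (- d * ln (INR (S (X + n)))) - exp (- d * ln (INR (S (X + n)) + 1)))
    (exp (- d * ln (INR (S X)))).
Proof.
  intros Hd.
  assert (E : forall n, sum_n (fun n => exp (- d * ln (INR (S (X + n)))) - exp (- d * ln (INR (S (X + n)) + 1))) n
     = exp (- d * ln (INR (S X))) - exp (- d * ln (INR (S (X + S n))))).
  { induction n as [|n IH].
    - rewrite sum_O. rewrite -S_INR. rewrite Nat.add_0_r Nat.add_1_r. reflexivity.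
    - rewrite sum_Sn IH.
      replace (INR (S (X + S n)) + 1) with (INR (S (X + S (S n)))) by (rewrite -S_INR; f_equal; lia).
      assert (Htel : forall a b c : R, (a - b) + (b - c) = a - c) by (intros; ring).
      apply Htel. }
  change (is_lim_seq (sum_n (fun n => exp (- d * ln (INR (S (X + n)))) - exp (- d * ln (INR (S (X + n)) + 1))))
    (exp (- d * ln (INR (S X))))).
  apply (is_lim_seq_ext (fun n => exp (- d * ln (INR (S X))) - exp (- d * ln (INR (S (X + S n)))))).
  { intros n. symmetry. apply E. }
  replace (Finite (exp (- d * ln (INR (S X))))) with (Finite (exp (- d * ln (INR (S X))) - 0)) by (f_equal; ring).
  apply is_lim_seq_minus'; [apply is_lim_seq_const|].
  apply (is_lim_seq_incr_1 (fun n => exp (- d * ln (INR (S (X + n)))))). apply is_lim_seq_pow_opp. exact Hd.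
Qed.

Lemma ex_series_pow (d : R) : 0 < d -> ex_series (fun n => exp ((- d - 1) * ln (INR (S n)))).
Proof.
  intros Hd.
  apply (ex_series_le (K:=R_AbsRing) (V:=R_CompleteNormedModule) _ (fun n => exp ((d + 1) * ln 2) / d *
     (exp (- d * ln (INR (S (0 + n)))) - exp (- d * ln (INR (S (0 + n)) + 1))))).
  - intros n. change (Rabs (exp ((- d - 1) * ln (INR (S n)))) <= exp ((d + 1) * ln 2) / d *
     (exp (- d * ln (INR (S (0 + n)))) - exp (- d * ln (INR (S (0 + n)) + 1)))).
    rewrite Rabs_pos_eq; [|left; apply exp_pos]. apply pow_telescope; [exact Hd|apply INR_S_ge_1].
  - apply (ex_series_scal (K:=R_AbsRing) (V:=R_NormedModule)). eexists. apply telescope_series. exact Hd.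
Qed.

(** Complex values are kept, so that multiplication by [s] can be expanded before taking
   coordinates. *)
Definition line_analytic (F : R -> C) (x0 : R) : Prop :=
  exists (a : nat -> C) (r : R), 0 < r /\ forall x, Rabs (x - x0) < r ->
    @is_series C_AbsRing C_NormedModule (fun n => a n * RtoC ((x - x0) ^ n))%C (F x).

Lemma line_analytic_lin (F G H : R -> C) (x0 : R) (k m : C) :
  line_analytic F x0 -> line_analytic G x0 -> (forall x, H x = (k * F x + m * G x)%C) -> line_analytic H x0.
Proof.
  intros (a & r & Hr & Ha) (b & q & Hq & Hb) HH.
  exists (fun n => k * a n + m * b n)%C, (Rmin r q). split; [apply Rmin_pos; assumption|].
  intros x Hx. apply (C_series_lin _ _ _ _ _ _ k m
    (Ha x ltac:(eapply Rlt_le_trans; [exact Hx|apply Rmin_l]))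
    (Hb x ltac:(eapply Rlt_le_trans; [exact Hx|apply Rmin_r]))); [|apply HH].
  intros n. ring.
Qed.

Lemma line_analytic_shift (F H : R -> C) (x0 : R) :
  line_analytic F x0 -> (forall x, H x = (RtoC (x - x0) * F x)%C) -> line_analytic H x0.
Proof.
  intros (a & r & Hr & Ha) HH.
  exists (fun n => match n with O => RtoC 0 | S m => a m end), r. split; [exact Hr|].
  intros x Hx. rewrite HH.
  replace (RtoC (x - x0) * F x)%C with (RtoC 0 * RtoC ((x - x0) ^ 0) + RtoC (x - x0) * F x)%C by (simpl; ring).
  apply (C_series_decr (fun n => match n with O => RtoC 0 | S m => a m end * RtoC ((x - x0) ^ n))%C).
  apply (C_series_lin _ _ _ _ _ _ (RtoC (x - x0)) 0 (Ha x Hx) (Ha x Hx)); [|ring].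
  intros n. simpl. rewrite RtoC_mult. ring.
Qed.

Lemma line_analytic_const (c : C) (x0 : R) : line_analytic (fun _ => c) x0.
Proof.
  exists (fun n => match n with O => c | _ => RtoC 0 end), 1. split; [lra|].
  intros x _. apply C_series_eps. intros eps Heps. exists 0%nat. intros n _.
  assert (E : @sum_n C_AbelianMonoid (fun n => match n with O => c | _ => RtoC 0 end * RtoC ((x - x0) ^ n))%C n = c).
  { induction n as [|n IH]; [rewrite C_sum_n_0; apply Cmult_1_r|].
    rewrite C_sum_n_S IH. change (c + RtoC 0 * RtoC ((x - x0) ^ (S n)) = c)%C. ring. }
  rewrite E. replace (c - c)%C with (RtoC 0) by ring. rewrite Cmod_0. exact Heps.
Qed.

Lemma line_analytic_of_C (f : C -> C) (x0 t : R) :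
  C_analytic_at f (x0, t) -> line_analytic (fun x => f (x, t)) x0.
Proof.
  intros (a & r & Hr & Ha). exists a, r. split; [exact Hr|]. intros x Hx.
  assert (E : ((x, t) - (x0, t))%C = RtoC (x - x0)).
  { unfold Cminus, Cplus, Copp, RtoC; simpl. f_equal; ring. }
  specialize (Ha (x, t)). rewrite E in Ha. rewrite Cmod_R in Ha. specialize (Ha Hx).
  apply (proj1 (C_pseries_eq _ _ _)) in Ha.
  eapply is_series_ext; [|exact Ha]. intros n. cbv beta. rewrite RtoC_pow. reflexivity.
Qed.

Lemma coord_analytic p (F : R -> C) (x0 : R) : coord p -> line_analytic F x0 -> R_analytic_at (fun x => p (F x)) x0.
Proof.
  intros Hp (a & r & Hr & Ha). exists (fun n => p (a n)), r. split; [exact Hr|].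
  intros x Hx. apply (is_series_ext (fun n => p (a n * RtoC ((x - x0) ^ n))%C)).
  - intros n. rewrite Cmult_comm (coord_scal p Hp). apply Rmult_comm.
  - apply C_series_coord; [exact Hp|]. apply Ha. exact Hx.
Qed.

(** The sum over [n] of the Taylor expansions in [s] is rearranged into one power series by
   [double_series]. *)
Lemma em_sum_analytic p (x0 t : R) : coord p -> 0 < x0 ->
  R_analytic_at (fun x => Series (fun n => p (em_term (x, t) 0 (INR (S n))))) x0.
Proof.
  intros Hp Hx0.
  set (r := x0 / 2).
  set (s0 := (x0, t) : C).
  set (K := (1 + Cmod s0) * (Cmod s0 + r) + Cmod s0 * r + r ^ 2).
  set (tau := fun n => K * exp ((r - x0 - 1) * ln (INR (S n)))).
  assert (Htau : ex_series tau).
  { apply (ex_series_scal (K:=R_AbsRing) (V:=R_NormedModule) K).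
    apply (ex_series_ext (fun n => exp ((- r - 1) * ln (INR (S n))))).
    - intros n. do 2 f_equal. unfold r. field.
    - apply ex_series_pow. unfold r. lra. }
  exists (fun k => Series (fun n => p (em_term s0 k (INR (S n))))), r. split; [unfold r; lra|].
  intros x Hx. set (D := x - x0) in *.
  assert (Es : ((x, t) : C) = (s0 + RtoC D)%C).
  { unfold s0, D, Cplus, RtoC; simpl. f_equal; ring. }
  set (q := Rabs D / r).
  assert (Hr : 0 < r) by (unfold r; lra).
  assert (Hq : 0 <= q < 1).
  { unfold q. pose proof (Rabs_pos D). split.
    - apply Rmult_le_pos; [lra|left; apply Rinv_0_lt_compat; exact Hr].
    - apply (Rmult_lt_reg_r r); [exact Hr|]. unfold Rdiv. rewrite Rmult_assoc Rinv_l; lra. }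
  pose proof (double_series (fun n k => p (em_term s0 k (INR (S n))) * D ^ k) (fun n => p (em_term (x, t) 0 (INR (S n)))) tau q Hq Htau) as H.
  assert (H' : is_series (fun k => Series (fun n => p (em_term s0 k (INR (S n))) * D ^ k)) (Series (fun n => p (em_term (x, t) 0 (INR (S n)))))).
  { apply H.
    - intros n k. rewrite Rabs_mult.
      eapply Rle_trans.
      + apply Rmult_le_compat_r; [apply Rabs_pos|]. eapply Rle_trans; [apply (coord_le p Hp)|].
        apply (em_term_coef_bound s0 r); [exact Hr|unfold s0, r; simpl; lra|apply INR_S_ge_1].
      + rewrite -RPow_abs. unfold tau, q. fold K. unfold Rdiv. rewrite Rpow_mult_distr pow_inv. simpl (Re s0). right. ring.
    - intros n. apply (is_series_ext (fun k => p (em_term s0 k (INR (S n)) * RtoC (D ^ k))%C)).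
      + intros k. rewrite Cmult_comm (coord_scal p Hp). apply Rmult_comm.
      + apply C_series_coord; [exact Hp|]. rewrite Es. apply em_term_series. }
  eapply is_series_ext; [|exact H']. intros k. cbv beta. apply Series_scal_r.
Qed.

Lemma R_analytic_minus f g x0 :
  R_analytic_at f x0 -> R_analytic_at g x0 -> R_analytic_at (fun x => f x - g x) x0.
Proof.
  intros (a & r & Hr & Ha) (b & q & Hq & Hb).
  exists (fun n => a n - b n), (Rmin r q). split; [apply Rmin_pos; assumption|].
  intros x Hx.
  apply (is_series_ext (fun n => a n * (x - x0) ^ n - b n * (x - x0) ^ n)).
  { intros n. symmetry. apply Rmult_minus_distr_r. }
  apply (is_series_minus (K:=R_AbsRing) (V:=R_NormedModule)).
  - apply Ha. eapply Rlt_le_trans; [exact Hx|apply Rmin_l].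
  - apply Hb. eapply Rlt_le_trans; [exact Hx|apply Rmin_r].
Qed.

(** * Approximation of zeta by partial sums *)

(** The increments of [n^(1-s)] telescope. *)
Lemma em_partial_sum (s : C) (X m : nat) :
  @sum_n C_AbelianMonoid (fun n => em_term s 0 (INR (S (X + n)))) m =
  ((1 - s) * @sum_n C_AbelianMonoid (fun n => cpow_opp (INR (S (S (X + n)))) s) m
    - RtoC (INR (S (S (X + m)))) * cpow_opp (INR (S (S (X + m)))) s + RtoC (INR (S X)) * cpow_opp (INR (S X)) s)%C.
Proof.
  assert (E : forall n, em_term s 0 (INR (S (X + n))) =
    ((1 - s) * cpow_opp (INR (S (S (X + n)))) s - RtoC (INR (S (S (X + n)))) * cpow_opp (INR (S (S (X + n)))) s
      + RtoC (INR (S (X + n))) * cpow_opp (INR (S (X + n))) s)%C).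
  { intros n. unfold em_term, tcoef1. rewrite -(S_INR (S (X + n))) !tcoef_0. ring. }
  induction m as [|m IH].
  - rewrite !C_sum_n_0 E Nat.add_0_r. reflexivity.
  - rewrite !C_sum_n_S E IH. replace (S (X + S m)) with (S (S (X + m))) by lia.
    generalize (RtoC (INR (S (S (X + m)))) * cpow_opp (INR (S (S (X + m)))) s)%C. intros y.
    generalize (@sum_n C_AbelianMonoid (fun n => cpow_opp (INR (S (S (X + n)))) s) m). intros z.
    change C in z. match goal with |- ?a = ?b => change (@eq C a b) end. ring.
Qed.

(** The limit of [em_partial_sum]: the boundary term [X^(1-s)] tends to [0] when [Re s > 1]. *)
Lemma zeta_em_right (zeta : C -> C) (s : C) : is_riemann_zeta zeta -> 1 < Re s ->
  @is_series C_AbsRing C_NormedModule (fun n => em_term s 0 (INR (S n))) ((1 - s) * zeta s + s)%C.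
Proof.
  intros [_ Hz] Hs. specialize (Hz s Hs).
  assert (Hsh : @is_series C_AbsRing C_NormedModule (fun n => cpow_opp (INR (S (S n))) s) (zeta s - 1)%C).
  { pose proof (is_series_incr_1 (K:=C_AbsRing) (V:=C_NormedModule) (fun n => nat_Cpow_opp (S n) s) (zeta s - 1)%C) as H.
    apply H. match goal with |- is_series _ ?l => replace l with (zeta s) end; [exact Hz|].
    change (zeta s = zeta s - 1 + cpow_opp 1 s)%C.
    rewrite cpow_opp_1. ring. }
  apply C_series_eps. intros eps Heps.
  assert (H1s := Cmod_ge_0 (1 - s)%C).
  assert (He : 0 < eps / 2 / (Cmod (1 - s)%C + 1)) by (apply Rdiv_lt_0_compat; lra).
  destruct (proj1 (C_series_eps _ _) Hsh _ He) as [N1 HN1].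
  pose proof (is_lim_seq_pow_opp (Re s - 1) 1 ltac:(lra)) as Hlim.
  apply is_lim_seq_spec in Hlim.
  assert (He2 : 0 < eps / 2) by lra.
  destruct (Hlim (mkposreal _ He2)) as [N2 HN2].
  exists (max N1 N2). intros m Hm.
  specialize (HN1 m ltac:(lia)). specialize (HN2 m ltac:(lia)).
  rewrite (em_partial_sum s 0 m).
  change (Nat.add 0 m) with m.
  change (fun n => cpow_opp (INR (S (S (0 + n)))) s) with (fun n => cpow_opp (INR (S (S n))) s).
  set (Z := @sum_n C_AbelianMonoid (fun n => cpow_opp (INR (S (S n))) s) m) in *. clearbody Z. change C in Z.
  replace ((1 - s) * Z - RtoC (INR (S (S m))) * cpow_opp (INR (S (S m))) s + RtoC (INR 1) * cpow_opp (INR 1) s - ((1 - s) * zeta s + s))%C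
    with ((1 - s) * (Z - (zeta s - 1)) + - (RtoC (INR (S (S m))) * cpow_opp (INR (S (S m))) s))%C.
  2:{ change (INR 1) with 1. rewrite cpow_opp_1. ring. }
  eapply Rle_lt_trans; [apply Cmod_triangle|].
  rewrite Cmod_opp !Cmod_mult Cmod_R Cmod_cpow_opp.
  assert (Hpos : 0 < INR (S (S m))) by (apply lt_0_INR; lia).
  rewrite (Rabs_pos_eq (INR _)); [|lra].
  replace (INR (S (S m)) * exp (- Re s * ln (INR (S (S m))))) with (exp (- (Re s - 1) * ln (INR (S (1 + m))))).
  2:{ change (S (1 + m)) with (S (S m)). rewrite -{2}(exp_ln (INR (S (S m))) Hpos). rewrite -exp_plus. f_equal. ring. }
  rewrite Rminus_0_r Rabs_pos_eq in HN2; [|left; apply exp_pos]. simpl pos in HN2.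
  assert (HA : Cmod (1 - s)%C * Cmod (Z - (zeta s - 1))%C < eps / 2); [|lra].
  apply (Rmult_lt_compat_l (Cmod (1 - s)%C + 1)) in HN1; [|lra].
  replace ((Cmod (1 - s)%C + 1) * (eps / 2 / (Cmod (1 - s)%C + 1))) with (eps / 2) in HN1 by (field; lra).
  pose proof (Cmod_ge_0 (Z - (zeta s - 1))%C). nra.
Qed.

(** On the horizontal line through [(x, t)], which avoids the pole as [t <> 0], both sides are
   real-analytic in the abscissa, and they agree where it exceeds [1]. *)
Lemma zeta_em (zeta : C -> C) (x t : R) : is_riemann_zeta zeta -> 0 < x -> t <> 0 ->
  @is_series C_AbsRing C_NormedModule (fun n => em_term (x, t) 0 (INR (S n)))
    ((1 - (x, t)) * zeta (x, t) + (x, t))%C.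
Proof.
  intros Hz Hx Ht.
  assert (Hex : forall y, 0 < y -> exists l, @is_series C_AbsRing C_NormedModule (fun n => em_term (y, t) 0 (INR (S n))) l).
  { intros y Hy. apply (C_ex_series_le _ (fun n => Cmod (1 - (y, t))%C * Cmod (y, t) * exp ((- y - 1) * ln (INR (S n))))).
    - intros n. apply em_term_decay; [exact Hy|apply INR_S_ge_1].
    - apply (ex_series_scal (K:=R_AbsRing) (V:=R_NormedModule)). apply ex_series_pow. exact Hy. }
  assert (Hne : forall y, (y, t) <> RtoC 1).
  { intros y E. apply (f_equal snd) in E. simpl in E. contradiction. }
  assert (Hp : forall p, coord p -> p ((1 - (x, t)) * zeta (x, t) + (x, t))%C - Series (fun n => p (em_term (x, t) 0 (INR (S n)))) = 0).
  { intros p Hp.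
    apply (R_identity_theorem (fun x => p ((1 - (x, t)) * zeta (x, t) + (x, t))%C - Series (fun n => p (em_term (x, t) 0 (INR (S n)))))); [| |exact Hx].
    - intros y Hy. apply R_analytic_minus; [|apply em_sum_analytic; assumption].
      apply (coord_analytic p (fun x => (1 - (x, t)) * zeta (x, t) + (x, t))%C); [exact Hp|].
      pose proof (line_analytic_of_C zeta y t (proj1 Hz _ (Hne y))) as Hzeta.
      pose proof (line_analytic_shift _ (fun x => RtoC (x - y) * zeta (x, t))%C y Hzeta ltac:(reflexivity)) as Hxz.
      pose proof (line_analytic_shift _ (fun x => RtoC (x - y) * 1)%C y (line_analytic_const 1 y) ltac:(reflexivity)) as Hx1.
      pose proof (line_analytic_lin _ _ (fun x => (1 - (y, t)) * zeta (x, t) + (- (1)) * (RtoC (x - y) * zeta (x, t)))%C y _ _ Hzeta Hxz ltac:(reflexivity)) as H1.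
      pose proof (line_analytic_lin _ _ (fun x => (y, t) * 1 + 1 * (RtoC (x - y) * 1))%C y _ _ (line_analytic_const 1 y) Hx1 ltac:(reflexivity)) as H2.
      apply (line_analytic_lin _ _ _ y 1 1 H1 H2). intros z.
      replace (z, t) with ((y, t) + RtoC (z - y))%C at 1 3.
      2:{ unfold Cplus, RtoC; simpl. f_equal; ring. }
      ring.
    - intros y Hy. rewrite (is_series_unique _ (p ((1 - (y, t)) * zeta (y, t) + (y, t))%C)); [ring|].
      apply (C_series_coord p _ _ Hp). apply zeta_em_right; assumption. }
  destruct (Hex x Hx) as [l Hl].
  replace ((1 - (x, t)) * zeta (x, t) + (x, t))%C with l; [exact Hl|].
  assert (Hc : forall p, coord p -> p l = p ((1 - (x, t)) * zeta (x, t) + (x, t))%C).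
  { intros p Cp. specialize (Hp p Cp).
    rewrite (is_series_unique _ _ (C_series_coord p _ _ Cp Hl)) in Hp. lra. }
  apply injective_projections; [apply (Hc Re coord_Re)|apply (Hc Im coord_Im)].
Qed.

(** The error is the tail of the series of [zeta_em], summed by [pow_telescope]. *)
Theorem zeta_approx (zeta : C -> C) (s : C) (X : nat) : is_riemann_zeta zeta -> 0 < Re s -> Im s <> 0 ->
  Cmod (zeta s - @sum_n C_AbelianMonoid (fun n => cpow_opp (INR (S n)) s) X
     - RtoC (INR (S X)) * cpow_opp (INR (S X)) s / (s - 1))%C
   <= Cmod s * (exp ((Re s + 1) * ln 2) / Re s) * exp (- Re s * ln (INR (S X))).
Proof.
  intros Hz Hx Ht. destruct s as [x t]. simpl Re in *. simpl Im in *.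
  set (s := (x, t) : C).
  pose proof (zeta_em zeta x t Hz Hx Ht) as H. fold s in H.
  assert (Hs1 : (1 - s)%C <> 0).
  { intros E. apply (f_equal snd) in E. unfold s in E. simpl in E. lra. }
  assert (Hcm : 0 < Cmod (1 - s)%C) by (apply Cmod_gt_0; exact Hs1).
  assert (Htail : @is_series C_AbsRing C_NormedModule (fun n => em_term s 0 (INR (S (X + n))))
     ((1 - s) * (zeta s - @sum_n C_AbelianMonoid (fun n => cpow_opp (INR (S n)) s) X) + RtoC (INR (S X)) * cpow_opp (INR (S X)) s)%C).
  { assert (Hgen : forall Y, @is_series C_AbsRing C_NormedModule (fun n => em_term s 0 (INR (S (Y + n))))
     ((1 - s) * (zeta s - @sum_n C_AbelianMonoid (fun n => cpow_opp (INR (S n)) s) Y) + RtoC (INR (S Y)) * cpow_opp (INR (S Y)) s)%C); [|apply Hgen].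
    induction Y as [|Y IH].
    - rewrite C_sum_n_0.
      match goal with |- is_series _ ?l => replace l with ((1 - s) * zeta s + s)%C end; [exact H|].
      change (INR 1) with 1. rewrite cpow_opp_1. ring.
    - apply (is_series_ext (fun n => em_term s 0 (INR (S (Y + S n))))).
      { intros n. do 3 f_equal. lia. }
      pose proof (is_series_incr_1 (K:=C_AbsRing) (V:=C_NormedModule) (fun n => em_term s 0 (INR (S (Y + n))))) as Hi.
      apply Hi. match goal with |- is_series _ ?l => replace l with ((1 - s) * (zeta s - @sum_n C_AbelianMonoid (fun n => cpow_opp (INR (S n)) s) Y) + RtoC (INR (S Y)) * cpow_opp (INR (S Y)) s)%C end; [exact IH|].
      rewrite C_sum_n_S Nat.add_0_r.
      generalize (@sum_n C_AbelianMonoid (fun n => cpow_opp (INR (S n)) s) Y). intros Z. change C in Z.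
      change ((1 - s) * (zeta s - Z) + RtoC (INR (S Y)) * cpow_opp (INR (S Y)) s =
        (1 - s) * (zeta s - (Z + cpow_opp (INR (S (S Y))) s)) + RtoC (INR (S (S Y))) * cpow_opp (INR (S (S Y))) s + em_term s 0 (INR (S Y)))%C.
      unfold em_term, tcoef1. rewrite -(S_INR (S Y)) !tcoef_0. ring. }
  pose proof (C_series_bound _ (fun n => Cmod (1 - s)%C * Cmod s * (exp ((x + 1) * ln 2) / x *
       (exp (- x * ln (INR (S (X + n)))) - exp (- x * ln (INR (S (X + n)) + 1))))) _
       (Cmod (1 - s)%C * Cmod s * (exp ((x + 1) * ln 2) / x * exp (- x * ln (INR (S X))))) Htail) as Hb.
  assert (Hfin : Cmod ((1 - s) * (zeta s - @sum_n C_AbelianMonoid (fun n => cpow_opp (INR (S n)) s) X) + RtoC (INR (S X)) * cpow_opp (INR (S X)) s)%C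
     <= Cmod (1 - s)%C * Cmod s * (exp ((x + 1) * ln 2) / x * exp (- x * ln (INR (S X))))).
  { apply Hb.
    - intros n. eapply Rle_trans; [apply em_term_decay; [exact Hx|apply INR_S_ge_1]|].
      apply Rmult_le_compat_l; [apply Rmult_le_pos; apply Cmod_ge_0|].
      apply pow_telescope; [exact Hx|apply INR_S_ge_1].
    - apply (is_series_scal (K:=R_AbsRing) (V:=R_NormedModule) (Cmod (1 - s)%C * Cmod s)).
      apply (is_series_scal (K:=R_AbsRing) (V:=R_NormedModule) (exp ((x + 1) * ln 2) / x)).
      apply telescope_series. exact Hx. }
  set (Z := @sum_n C_AbelianMonoid (fun n => cpow_opp (INR (S n)) s) X) in *. clearbody Z. change C in Z.
  replace (zeta s - Z - RtoC (INR (S X)) * cpow_opp (INR (S X)) s / (s - 1))%C with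
    (((1 - s) * (zeta s - Z) + RtoC (INR (S X)) * cpow_opp (INR (S X)) s) * / (1 - s))%C.
  2:{ assert (Hs2 : (s - 1)%C <> 0).
      { intros E. apply Hs1. replace (1 - s)%C with (- (s - 1))%C by ring. rewrite E. ring. }
      field. tauto. }
  rewrite Cmod_mult Cmod_inv; [|exact Hs1].
  apply (Rmult_le_reg_r (Cmod (1 - s)%C)); [exact Hcm|].
  rewrite Rmult_assoc Rinv_l; [|lra]. rewrite Rmult_1_r. eapply Rle_trans; [exact Hfin|]. right. ring.
Qed.

(** * Smoothing operators on vertical lines *)

Lemma sdiffE u F t : sdiff u F t = (F (t + u)%R - F (t - u)%R)%C.
Proof. reflexivity. Qed.

Lemma savgE u F t : savg u F t = (F (t + u)%R + F (t - u)%R)%C.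
Proof. reflexivity. Qed.

Lemma iter_op_ext (op : R -> (R -> C) -> R -> C) (u : R) : (op = sdiff \/ op = savg) ->
  forall n F G, (forall t, F t = G t) -> forall t, Nat.iter n (op u) F t = Nat.iter n (op u) G t.
Proof.
  intros Hop n F G H. induction n as [|n IH]; [exact H|].
  intros t. simpl. destruct Hop as [-> | ->]; rewrite ?sdiffE ?savgE !IH; reflexivity.
Qed.

Lemma iter_op_lin (op : R -> (R -> C) -> R -> C) (u : R) : (op = sdiff \/ op = savg) ->
  forall n (F G : R -> C) (a b : C) t,
  Nat.iter n (op u) (fun x => a * F x + b * G x)%C t
  = (a * Nat.iter n (op u) F t + b * Nat.iter n (op u) G t)%C.
Proof.
  intros Hop n F G a b. induction n as [|n IH]; [reflexivity|].
  intros t. simpl. destruct Hop as [-> | ->]; rewrite ?sdiffE ?savgE !IH; ring.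
Qed.

(** A factor [a] that is multiplied by constants of equal or opposite sign under the shifts by
   [u] and [- u] can be pulled out; in the second case it turns [op] into the other operator [op']. *)
Lemma iter_op_twist (op op' : R -> (R -> C) -> R -> C) (u : R) (a : R -> C) (c : C) :
  (forall F t, op u (fun x => a x * F x)%C t = (c * (a t * op' u F t))%C) ->
  (op = sdiff \/ op = savg) ->
  forall n F t, Nat.iter n (op u) (fun x => a x * F x)%C t = (c ^ n * (a t * Nat.iter n (op' u) F t))%C.
Proof.
  intros H Hop n. induction n as [|n IH]; intros F t; [simpl; ring|].
  simpl. transitivity (op u (fun x => a x * (c ^ n * Nat.iter n (op' u) F x))%C t).
  - pose proof (iter_op_ext op u Hop 1 (Nat.iter n (op u) (fun x => (a x * F x)%C))
       (fun x => a x * (c ^ n * Nat.iter n (op' u) F x))%C) as Hext.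
    simpl in Hext. apply Hext. intros x. rewrite IH. ring.
  - transitivity (op u (fun x => c ^ n * (a x * Nat.iter n (op' u) F x) + 0 * (a x * Nat.iter n (op' u) F x))%C t).
    + pose proof (iter_op_ext op u Hop 1 (fun x => a x * (c ^ n * Nat.iter n (op' u) F x))%C
       (fun x => c ^ n * (a x * Nat.iter n (op' u) F x) + 0 * (a x * Nat.iter n (op' u) F x))%C) as Hext.
      simpl in Hext. apply Hext. intros x. ring.
    + pose proof (iter_op_lin op u Hop 1 (fun x => a x * Nat.iter n (op' u) F x)%C (fun x => a x * Nat.iter n (op' u) F x)%C (c ^ n)%C 0 t) as Hl.
      simpl in Hl. rewrite Hl H. ring.
Qed.

Lemma iter_op_commute (u : R) : forall m n F t,
  Nat.iter m (savg u) (Nat.iter n (sdiff u) F) t = Nat.iter n (sdiff u) (Nat.iter m (savg u) F) t.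
Proof.
  assert (H1 : forall n F t, savg u (Nat.iter n (sdiff u) F) t = Nat.iter n (sdiff u) (savg u F) t).
  { induction n as [|n IH]; intros F t; [reflexivity|]. simpl.
    rewrite sdiffE -!IH !savgE !sdiffE.
    replace (t - u + u) with (t + u - u) by ring. ring. }
  induction m as [|m IH]; intros n F t; [reflexivity|].
  simpl. transitivity (savg u (Nat.iter n (sdiff u) (Nat.iter m (savg u) F)) t).
  - rewrite (savgE u (Nat.iter m (savg u) _)) savgE !IH. reflexivity.
  - apply H1.
Qed.

(** The wave [exp (- i t theta)]. *)
Definition wave (theta t : R) : C := (cos (t * theta), - sin (t * theta)).

Lemma Cmod_wave theta t : Cmod (wave theta t) = 1.
Proof.
  unfold wave, Cmod; simpl. rewrite -{3}sqrt_1. f_equal.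
  pose proof (sin2_cos2 (t * theta)) as H. unfold Rsqr in H. lra.
Qed.

Lemma wave_sdiff theta u F t :
  sdiff u (fun x => wave theta x * F x)%C t =
  (wave theta t * (RtoC (cos (u * theta)) * sdiff u F t - Ci * RtoC (sin (u * theta)) * savg u F t))%C.
Proof.
  unfold sdiff, savg, wave.
  replace ((t + u) * theta) with (t * theta + u * theta) by ring.
  replace ((t - u) * theta) with (t * theta - u * theta) by ring.
  rewrite cos_plus sin_plus cos_minus sin_minus.
  destruct (F (t + u)) as [a b]. destruct (F (t - u)) as [c d].
  unfold Cminus, Cplus, Copp, Cmult, RtoC, Ci; simpl. f_equal; ring.
Qed.

Lemma wave_savg theta u F t :
  savg u (fun x => wave theta x * F x)%C t =
  (wave theta t * (RtoC (cos (u * theta)) * savg u F t - Ci * RtoC (sin (u * theta)) * sdiff u F t))%C.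
Proof.
  unfold sdiff, savg, wave.
  replace ((t + u) * theta) with (t * theta + u * theta) by ring.
  replace ((t - u) * theta) with (t * theta - u * theta) by ring.
  rewrite cos_plus sin_plus cos_minus sin_minus.
  destruct (F (t + u)) as [a b]. destruct (F (t - u)) as [c d].
  unfold Cminus, Cplus, Copp, Cmult, RtoC, Ci; simpl. f_equal; ring.
Qed.

(** The [n] differences bring in the derivative of order [n]; the [m] averages damp the high
   frequencies. *)
Definition smooth (u : R) (m n : nat) (F : R -> C) (t : R) : C :=
  Nat.iter m (savg u) (Nat.iter n (sdiff u) F) t.

Lemma smooth_ext u m n F G : (forall t, F t = G t) -> forall t, smooth u m n F t = smooth u m n G t.
Proof.
  intros H. unfold smooth. apply iter_op_ext; [right; reflexivity|].
  apply iter_op_ext; [left; reflexivity|exact H].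
Qed.

Lemma smooth_lin u m n F G a b t :
  smooth u m n (fun x => a * F x + b * G x)%C t = (a * smooth u m n F t + b * smooth u m n G t)%C.
Proof.
  unfold smooth.
  rewrite (iter_op_ext savg u (or_intror eq_refl) m _ _ (iter_op_lin sdiff u (or_introl eq_refl) n F G a b)).
  apply iter_op_lin. right; reflexivity.
Qed.

(** Waves are eigenfunctions, so smoothing a Dirichlet polynomial only changes its coefficients. *)
Lemma smooth_wave u m n theta t :
  smooth u m n (wave theta) t =
  (RtoC (2 * cos (u * theta)) ^ m * ((- Ci * RtoC (2 * sin (u * theta))) ^ n * wave theta t))%C.
Proof.
  assert (Hd : forall k t, Nat.iter k (sdiff u) (wave theta) t = ((- Ci * RtoC (2 * sin (u * theta))) ^ k * wave theta t)%C).
  { induction k as [|k IH]; intros x; [simpl; ring|].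
    simpl. rewrite sdiffE !IH.
    pose proof (wave_sdiff theta u (fun _ => RtoC 1) x) as W. unfold sdiff, savg in W.
    replace (wave theta (x + u)) with (wave theta (x + u)%R * 1)%C by ring.
    replace (wave theta (x - u)) with (wave theta (x - u)%R * 1)%C by ring.
    transitivity ((- Ci * RtoC (2 * sin (u * theta))) ^ k * (wave theta (x + u)%R * 1 - wave theta (x - u)%R * 1))%C; [ring|].
    rewrite W RtoC_mult. ring. }
  unfold smooth. rewrite (iter_op_ext savg u (or_intror eq_refl) m _ _ (Hd n)).
  clear Hd.
  revert t. induction m as [|m IH]; intros t; [simpl; ring|].
  simpl. rewrite savgE !IH.
  pose proof (wave_savg theta u (fun _ => RtoC 1) t) as W. unfold sdiff, savg in W.
  set (c := ((- Ci * RtoC (2 * sin (u * theta))) ^ n)%C).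
  transitivity (RtoC (2 * cos (u * theta)) ^ m * c * (wave theta (t + u)%R * 1 + wave theta (t - u)%R * 1))%C; [ring|].
  rewrite W RtoC_mult. ring.
Qed.

(** At [u * theta = PI / 2] the shifts by [u] and [- u] multiply the wave by [- Ci] and [Ci],
   so the factor exchanges averages and differences. *)
Lemma smooth_twist u m n theta F t : u * theta = PI / 2 ->
  exists z, Cmod z = 1 /\
  smooth u m n (fun x => wave theta x * F x)%C t = (z * Nat.iter n (savg u) (Nat.iter m (sdiff u) F) t)%C.
Proof.
  intros Hu.
  assert (HS : forall F t, sdiff u (fun x => wave theta x * F x)%C t = (- Ci * (wave theta t * savg u F t))%C).
  { intros G x. rewrite wave_sdiff Hu cos_PI2 sin_PI2. ring. }
  assert (HA : forall F t, savg u (fun x => wave theta x * F x)%C t = (- Ci * (wave theta t * sdiff u F t))%C).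
  { intros G x. rewrite wave_savg Hu cos_PI2 sin_PI2. ring. }
  exists ((- Ci) ^ n * (- Ci) ^ m * wave theta t)%C. split.
  { rewrite !Cmod_mult !Cmod_pow Cmod_opp Cmod_Ci Cmod_wave !pow1. ring. }
  unfold smooth.
  rewrite (iter_op_ext savg u (or_intror eq_refl) m _ (fun x => (- Ci) ^ n * (wave theta x * Nat.iter n (savg u) F x) + 0 * (wave theta x * F x))%C).
  2:{ intros x. rewrite (iter_op_twist sdiff savg u (wave theta) (- Ci) HS (or_introl eq_refl) n F x). ring. }
  rewrite (iter_op_lin savg u (or_intror eq_refl)).
  rewrite (iter_op_twist savg sdiff u (wave theta) (- Ci) HA (or_intror eq_refl)).
  rewrite -iter_op_commute. ring.
Qed.

Lemma vderiv_mult F G t l k : vderiv F t l -> vderiv G t k ->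
  vderiv (fun x => F x * G x)%C t (l * G t + F t * k)%C.
Proof.
  assert (Hm : forall f g a b, is_derive f t a -> is_derive g t b -> is_derive (fun x => f x * g x) t (a * g t + f t * b)).
  { intros f g a b Hf Hg. apply (is_derive_mult f g); [exact Hf|exact Hg|]. intros; apply Rmult_comm. }
  intros [F1 F2] [G1 G2]. split.
  - replace (Re (l * G t + F t * k)%C) with
      (minus (Re l * Re (G t) + Re (F t) * Re k) (Im l * Im (G t) + Im (F t) * Im k))
      by (unfold Re, Im, Cplus, Cmult, minus, plus, opp; simpl; ring).
    apply (is_derive_minus (K:=R_AbsRing) (V:=R_NormedModule) (fun x => Re (F x) * Re (G x)) (fun x => Im (F x) * Im (G x)));
    apply Hm; assumption.
  - replace (Im (l * G t + F t * k)%C) with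
      (plus (Re l * Im (G t) + Re (F t) * Im k) (Im l * Re (G t) + Im (F t) * Re k))
      by (unfold Re, Im, Cplus, Cmult, minus, plus, opp; simpl; ring).
    apply (is_derive_plus (K:=R_AbsRing) (V:=R_NormedModule) (fun x => Re (F x) * Im (G x)) (fun x => Im (F x) * Re (G x)));
    apply Hm; assumption.
Qed.

(** The function [1 / (s - 1)] on the line [Re s = 1 + a], in terms of the ordinate [t]. *)
Definition pole (a t : R) : C := (/ (RtoC a + Ci * RtoC t))%C.

Lemma pole_vderiv a t : a <> 0 -> vderiv (pole a) t (- Ci * (pole a t * pole a t))%C.
Proof.
  intros Ha.
  assert (Hq : forall x, a * a + x * x <> 0).
  { intros x. assert (0 < a * a) by nra. nra. }
  assert (E : forall x, pole a x = (a / (a * a + x * x), - x / (a * a + x * x))).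
  { intros x. unfold pole, Cinv, Cplus, Cmult, Ci, RtoC; simpl. specialize (Hq x).
    f_equal; unfold Rdiv; (f_equal; [ring|f_equal; ring]). }
  specialize (Hq t). split.
  - apply (is_derive_ext (fun x => a / (a * a + x * x))). { intros x. rewrite E. reflexivity. }
    rewrite E. auto_derive; [exact Hq|]. unfold Re, Cmult, Copp, Ci; simpl. field. exact Hq.
  - apply (is_derive_ext (fun x => - x / (a * a + x * x))). { intros x. rewrite E. reflexivity. }
    rewrite E. auto_derive; [exact Hq|]. unfold Im, Cmult, Copp, Ci; simpl. field. exact Hq.
Qed.

(** The derivative of order [j] of [pole a]. *)
Definition pole_deriv (a : R) (j : nat) (t : R) : C :=
  ((- Ci) ^ j * RtoC (INR (Factorial.fact j)) * pole a t ^ (S j))%C.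

Lemma pole_deriv_vderiv a j t : a <> 0 -> vderiv (pole_deriv a j) t (pole_deriv a (S j) t).
Proof.
  intros Ha.
  assert (Hp : forall m, vderiv (fun x => pole a x ^ S m)%C t (RtoC (INR (S m)) * pole a t ^ m * (- Ci * (pole a t * pole a t)))%C).
  { induction m as [|m IH].
    - replace (RtoC (INR 1) * pole a t ^ 0 * (- Ci * (pole a t * pole a t)))%C with (- Ci * (pole a t * pole a t))%C by (simpl; ring).
      pose proof (pole_vderiv a t Ha) as [H1 H2].
      assert (E : forall x, (pole a x ^ 1)%C = pole a x) by (intros x; simpl; ring).
      split; [eapply is_derive_ext; [|exact H1]|eapply is_derive_ext; [|exact H2]]; intros x; rewrite E; reflexivity.
    - pose proof (vderiv_mult _ _ t _ _ (pole_vderiv a t Ha) IH) as H.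
      replace (RtoC (INR (S (S m))) * pole a t ^ S m * (- Ci * (pole a t * pole a t)))%C with
        (- Ci * (pole a t * pole a t) * pole a t ^ S m + pole a t * (RtoC (INR (S m)) * pole a t ^ m * (- Ci * (pole a t * pole a t))))%C.
      + exact H.
      + rewrite (S_INR (S m)) RtoC_plus. simpl Cpow. ring. }
  replace (pole_deriv a (S j) t) with ((- Ci) ^ j * RtoC (INR (Factorial.fact j)) * (RtoC (INR (S j)) * pole a t ^ j * (- Ci * (pole a t * pole a t))))%C.
  - apply vderiv_scal. apply Hp.
  - unfold pole_deriv. rewrite fact_simpl mult_INR RtoC_mult. simpl Cpow. ring.
Qed.

Lemma pole_deriv_bound a j t : 0 < t -> Cmod (pole_deriv a j t) <= INR (Factorial.fact j) / t ^ S j.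
Proof.
  intros Ht. unfold pole_deriv. rewrite !Cmod_mult !Cmod_pow Cmod_opp Cmod_Ci pow1 Rmult_1_l.
  rewrite Cmod_R Rabs_pos_eq; [|apply pos_INR].
  apply Rmult_le_compat_l; [apply pos_INR|].
  assert (Him : t <= Cmod (RtoC a + Ci * RtoC t)%C).
  { eapply Rle_trans; [|apply im_le_Cmod]. eapply Rle_trans; [|apply Rle_abs].
    right. unfold Im, Cplus, Cmult, Ci, RtoC; simpl. ring. }
  assert (Hnz : (RtoC a + Ci * RtoC t)%C <> 0).
  { apply Cmod_gt_0. lra. }
  unfold pole. rewrite Cmod_inv; [|exact Hnz].
  rewrite -(pow_inv t).
  change ((/ Cmod (RtoC a + Ci * RtoC t)%C) ^ S j <= (/ t) ^ S j). apply pow_incr. split.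
  - left. apply Rinv_0_lt_compat. lra.
  - apply Rinv_le_contravar; lra.
Qed.

(** * Smoothed Dirichlet polynomials *)

(** The eigenvalue of [smooth_wave] at [theta = ln n], times [n^(- sigma)], divided by
   [(- Ci) ^ l * 2 ^ (2 * J) * (2 * u) ^ l]. For small [u] it is close to [n^(- sigma) (ln n)^l], the modulus of the
   coefficient of the derivative of order [l]. *)
Definition smooth_coef (sigma u : R) (J l : nat) (theta : R) : R :=
  exp (- sigma * theta) * cos (u * theta) ^ (2 * J) * (sin (u * theta) / u) ^ l.

Definition smooth_poly (sigma u : R) (J l X : nat) (t : R) : C :=
  @sum_n C_AbelianMonoid (fun k => RtoC (smooth_coef sigma u J l (ln (INR (S k)))) * wave (ln (INR (S k))) t)%C X.

Lemma cpow_opp_wave (u sigma t : R) :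
  cpow_opp u (RtoC sigma + Ci * RtoC t)%C = (RtoC (exp (- sigma * ln u)) * wave (ln u) t)%C.
Proof.
  rewrite cpow_opp_val.
  replace (Re (RtoC sigma + Ci * RtoC t)%C) with sigma by (unfold Re, Cplus, Cmult, Ci, RtoC; simpl; ring).
  replace (Im (RtoC sigma + Ci * RtoC t)%C) with t by (unfold Im, Cplus, Cmult, Ci, RtoC; simpl; ring).
  unfold wave, Cmult, RtoC; simpl. f_equal; ring.
Qed.

Lemma smooth_sum (u : R) (m n : nat) (a : nat -> C) (th : nat -> R) (X : nat) (t : R) :
  smooth u m n (fun x => @sum_n C_AbelianMonoid (fun k => a k * wave (th k) x)%C X) t =
  @sum_n C_AbelianMonoid (fun k => a k * smooth u m n (wave (th k)) t)%C X.
Proof.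
  assert (H1 : forall (c : C) th, smooth u m n (fun x => c * wave th x)%C t = (c * smooth u m n (wave th) t)%C).
  { intros c th0. rewrite (smooth_ext u m n _ (fun x => c * wave th0 x + 0 * wave th0 x)%C).
    - rewrite smooth_lin. ring.
    - intros x. ring. }
  induction X as [|X IH].
  - rewrite C_sum_n_0 -H1. apply smooth_ext. intros x. rewrite C_sum_n_0. reflexivity.
  - rewrite C_sum_n_S -IH.
    rewrite (smooth_ext u m n _ (fun x => 1 * @sum_n C_AbelianMonoid (fun k => a k * wave (th k) x)%C X + a (S X) * wave (th (S X)) x)%C).
    + rewrite smooth_lin Cmult_1_l. reflexivity.
    + intros x. rewrite C_sum_n_S Cmult_1_l. reflexivity.
Qed.

Lemma C_sum_scal (c : C) (a : nat -> C) (X : nat) :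
  @sum_n C_AbelianMonoid (fun k => c * a k)%C X = (c * @sum_n C_AbelianMonoid a X)%C.
Proof.
  induction X as [|X IH]; [rewrite !C_sum_n_0; reflexivity|].
  rewrite !C_sum_n_S IH. symmetry. apply Cmult_plus_distr_l.
Qed.

(** The factor [Ci ^ l] makes these functions successive derivatives of one another, as
   [iter_sdiff_bound] requires. *)
Lemma zeta_vertical (zeta : C -> C) (sigma : R) (l : nat) : is_riemann_zeta zeta -> sigma < 1 ->
  forall t, vderiv (fun x => Ci ^ l * C_derive_n zeta l (RtoC sigma + Ci * RtoC x))%C t
    (Ci ^ (S l) * C_derive_n zeta (S l) (RtoC sigma + Ci * RtoC t))%C.
Proof.
  intros Hz Hs t.
  replace (Ci ^ (S l) * C_derive_n zeta (S l) (RtoC sigma + Ci * RtoC t))%C with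
    (Ci ^ l * (Ci * C_derive_n zeta (S l) (RtoC sigma + Ci * RtoC t)))%C by (simpl; ring).
  apply vderiv_scal. apply (C_diff_line (C_derive_n zeta l)).
  apply C_analytic_derive. apply (C_derive_n_analytic zeta (RtoC 1)); [apply (proj1 Hz)|].
  intros E. apply (f_equal fst) in E. simpl in E. lra.
Qed.

Lemma smooth_bound_zeta (zeta : C -> C) (sigma u : R) (J l : nat) (t V : R) :
  is_riemann_zeta zeta -> sigma < 1 -> 0 <= u ->
  (forall x, Rabs (x - t) <= INR (2 * J + l) * u ->
     Cmod (C_derive_n zeta l (RtoC sigma + Ci * RtoC x)%C) <= V) ->
  Cmod (smooth u (2 * J) l (fun x => zeta (RtoC sigma + Ci * RtoC x)%C) t) <= 2 ^ (2 * J) * ((2 * u) ^ l * V).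
Proof.
  intros Hz Hs Hu HV. unfold smooth.
  apply (iter_pm_bound savg u Hu (or_intror eq_refl)). intros x Hx.
  rewrite (iter_op_ext sdiff u (or_introl eq_refl) l _ (fun y => Ci ^ 0 * C_derive_n zeta 0 (RtoC sigma + Ci * RtoC y))%C).
  2:{ intros y. unfold C_derive_n. simpl. ring. }
  apply (iter_sdiff_bound u V Hu l (fun j y => Ci ^ j * C_derive_n zeta j (RtoC sigma + Ci * RtoC y))%C x).
  - intros j y _ _. apply zeta_vertical; assumption.
  - intros y Hy. rewrite Cmod_mult Cmod_pow Cmod_Ci pow1 Rmult_1_l. apply HV.
    replace (y - t) with ((y - x) + (x - t)) by ring.
    eapply Rle_trans; [apply Rabs_triang|]. rewrite plus_INR. lra.
Qed.

Lemma smooth_bound_gen (u : R) (m n : nat) (F : R -> C) (t M : R) : 0 <= u ->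
  (forall x, Rabs (x - t) <= INR (m + n) * u -> Cmod (F x) <= M) ->
  Cmod (smooth u m n F t) <= 2 ^ m * (2 ^ n * M).
Proof.
  intros Hu HM. unfold smooth.
  apply (iter_pm_bound savg u Hu (or_intror eq_refl)). intros x Hx.
  apply (iter_pm_bound sdiff u Hu (or_introl eq_refl)). intros y Hy. apply HM.
  replace (y - t) with ((y - x) + (x - t)) by ring.
  eapply Rle_trans; [apply Rabs_triang|]. rewrite plus_INR. lra.
Qed.

(** [smooth_twist] turns the [m] averages into differences of [1 / (s - 1)], whose derivatives of
   high order are tiny at large height. *)
Lemma smooth_bound_pole (u a theta : R) (m n : nat) (t : R) : 0 <= u -> u * theta = PI / 2 -> a <> 0 ->
  INR (m + n) * u < t ->
  Cmod (smooth u m n (fun x => wave theta x * pole a x)%C t) <=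
    2 ^ n * ((2 * u) ^ m * (INR (Factorial.fact m) / (t - INR (m + n) * u) ^ S m)).
Proof.
  intros Hu Hth Ha Ht.
  destruct (smooth_twist u m n theta (pole a) t Hth) as [z [Hz ->]].
  rewrite Cmod_mult Hz Rmult_1_l.
  apply (iter_pm_bound savg u Hu (or_intror eq_refl)). intros x Hx.
  rewrite (iter_op_ext sdiff u (or_introl eq_refl) m _ (pole_deriv a 0)).
  2:{ intros y. unfold pole_deriv. simpl. ring. }
  apply (iter_sdiff_bound u _ Hu m (pole_deriv a) x).
  - intros j y _ _. apply pole_deriv_vderiv. exact Ha.
  - intros y Hy.
    assert (Hyt : t - INR (m + n) * u <= y).
    { rewrite plus_INR. apply Rabs_le_between in Hx. apply Rabs_le_between in Hy. lra. }
    eapply Rle_trans; [apply pole_deriv_bound; lra|].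
    apply Rmult_le_compat_l; [apply pos_INR|]. apply Rinv_le_contravar; [apply pow_lt; lra|].
    apply pow_incr. lra.
Qed.

(** The smoothing operator is applied to [zeta_approx]: the differences turn zeta into its derivative
   of order [l], the pole term is treated by [smooth_bound_pole], and the error term trivially. The condition
   [u * ln N = PI / 2], where [N] is the length, is that of [smooth_twist] for the wave [N^(- i t)] of the pole term. *)
Theorem smooth_poly_bound (zeta : C -> C) (sigma u : R) (J l X : nat) (t V : R) :
  is_riemann_zeta zeta -> 1 / 2 <= sigma < 1 -> 0 < u ->
  u * ln (INR (S X)) = PI / 2 -> INR (2 * J + l) * u < t ->
  (forall x, Rabs (x - t) <= INR (2 * J + l) * u ->
     Cmod (C_derive_n zeta l (RtoC sigma + Ci * RtoC x)%C) <= V) ->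
  Cmod (smooth_poly sigma u J l X t) <= V + / u ^ l *
    (8 * (1 + t + INR (2 * J + l) * u) * exp (- sigma * ln (INR (S X)))
     + INR (S X) * exp (- sigma * ln (INR (S X))) *
        (u ^ (2 * J) * (INR (Factorial.fact (2 * J)) / (t - INR (2 * J + l) * u) ^ S (2 * J)))).
Proof.
  intros Hz Hs Hu HuX Ht HV.
  set (L := INR (2 * J + l) * u) in *.
  assert (HL : 0 <= L) by (apply Rmult_le_pos; [apply pos_INR|lra]).
  set (N := INR (S X)) in *.
  assert (HN : 1 <= N) by apply INR_S_ge_1.
  set (s := fun x : R => (RtoC sigma + Ci * RtoC x)%C).
  set (F := fun x => zeta (s x)).
  set (PS := fun x => @sum_n C_AbelianMonoid (fun k => RtoC (exp (- sigma * ln (INR (S k)))) * wave (ln (INR (S k))) x)%C X).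
  set (W := fun x => (wave (ln N) x * pole (sigma - 1) x)%C).
  set (cN := N * exp (- sigma * ln N)).
  set (Err := fun x => (F x - PS x - RtoC cN * W x)%C).
  assert (HErr : forall x, Rabs (x - t) <= L -> Cmod (Err x) <= 8 * (1 + t + L) * exp (- sigma * ln N)).
  { intros x Hx. apply Rabs_le_between in Hx.
    assert (E : Err x = (zeta (s x) - @sum_n C_AbelianMonoid (fun n => cpow_opp (INR (S n)) (s x)) X - RtoC N * cpow_opp N (s x) / (s x - 1))%C).
    { assert (E1 : PS x = @sum_n C_AbelianMonoid (fun n => cpow_opp (INR (S n)) (s x)) X).
      { apply sum_n_ext. intros k. unfold s. rewrite cpow_opp_wave. reflexivity. }
      assert (E2 : (RtoC cN * W x)%C = (RtoC N * cpow_opp N (s x) / (s x - 1))%C).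
      { unfold s at 1. rewrite cpow_opp_wave. unfold W, cN, pole, Cdiv.
        replace (s x - 1)%C with (RtoC (sigma - 1) + Ci * RtoC x)%C by (unfold s; rewrite RtoC_minus; ring).
        rewrite RtoC_mult. ring. }
      unfold Err, F. rewrite E1 E2. reflexivity. }
    rewrite E.
    assert (Hre : Re (s x) = sigma) by (unfold s, Re, Cplus, Cmult, Ci, RtoC; simpl; ring).
    assert (Him : Im (s x) = x) by (unfold s, Im, Cplus, Cmult, Ci, RtoC; simpl; ring).
    eapply Rle_trans; [apply zeta_approx; [exact Hz|rewrite Hre; lra|rewrite Him; lra]|].
    rewrite Hre. fold N. apply Rmult_le_compat_r; [left; apply exp_pos|].
    assert (H1 : Cmod (s x) <= 1 + t + L).
    { unfold s. eapply Rle_trans; [apply Cmod_triangle|]. rewrite Cmod_mult Cmod_Ci !Cmod_R !Rabs_pos_eq; lra. }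
    assert (H2 : exp ((sigma + 1) * ln 2) / sigma <= 8).
    { assert (exp ((sigma + 1) * ln 2) <= 4).
      { replace 4 with (exp (2 * ln 2)).
        - apply exp_le_mono. pose proof (ln_nonneg 2 ltac:(lra)). nra.
        - replace (2 * ln 2) with (ln 2 + ln 2) by ring. rewrite exp_plus exp_ln; lra. }
      apply (Rmult_le_reg_r sigma); [lra|]. unfold Rdiv. rewrite Rmult_assoc Rinv_l; lra. }
    assert (0 <= exp ((sigma + 1) * ln 2) / sigma).
    { apply Rmult_le_pos; [left; apply exp_pos|left; apply Rinv_0_lt_compat; lra]. }
    rewrite (Rmult_comm 8). apply Rmult_le_compat; auto using Cmod_ge_0. }
  assert (HD : smooth u (2 * J) l PS t = ((- Ci) ^ l * RtoC (2 ^ (2 * J) * (2 * u) ^ l) * smooth_poly sigma u J l X t)%C).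
  { unfold PS. rewrite smooth_sum. unfold smooth_poly. rewrite -C_sum_scal. apply sum_n_ext. intros k.
    rewrite smooth_wave. unfold smooth_coef. set (th := ln (INR (S k))).
    rewrite Cpow_mult_l.
    replace (RtoC (exp (- sigma * th) * cos (u * th) ^ (2 * J) * (sin (u * th) / u) ^ l)) with
      (RtoC (exp (- sigma * th)) * RtoC (cos (u * th) ^ (2 * J)) * RtoC ((sin (u * th) / u) ^ l))%C by (rewrite !RtoC_mult; reflexivity).
    replace (RtoC (2 * cos (u * th)) ^ (2 * J))%C with (RtoC (2 ^ (2 * J)) * RtoC (cos (u * th) ^ (2 * J)))%C
      by (rewrite -RtoC_pow -RtoC_mult Rpow_mult_distr; reflexivity).
    replace (RtoC (2 * sin (u * th)) ^ l)%C with (RtoC ((2 * u) ^ l) * RtoC ((sin (u * th) / u) ^ l))%C.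
    2:{ rewrite -RtoC_mult -Rpow_mult_distr RtoC_pow. f_equal. f_equal. field. lra. }
    rewrite RtoC_mult. match goal with |- ?a = ?b => change (@eq C a b) end. ring. }
  assert (HF : smooth u (2 * J) l F t = (smooth u (2 * J) l PS t + RtoC cN * smooth u (2 * J) l W t + smooth u (2 * J) l Err t)%C).
  { rewrite (smooth_ext u (2 * J) l F (fun x => 1 * (1 * PS x + RtoC cN * W x) + 1 * Err x)%C).
    - rewrite smooth_lin (smooth_lin u (2 * J) l PS W). ring.
    - intros x. unfold Err. ring. }
  pose proof (smooth_bound_zeta zeta sigma u J l t V Hz (proj2 Hs) ltac:(lra) HV) as BF. fold F in BF.
  change (fun x => zeta (RtoC sigma + Ci * RtoC x)%C) with F in BF.
  pose proof (smooth_bound_gen u (2 * J) l Err t _ ltac:(lra) HErr) as BE.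
  pose proof (smooth_bound_pole u (sigma - 1) (ln N) (2 * J) l t ltac:(lra) HuX ltac:(lra) Ht) as BW. fold W L in BW.
  change (fun x => (wave (ln N) x * pole (sigma - 1) x)%C) with W in BW.
  set (Q := INR (Factorial.fact (2 * J)) / (t - L) ^ S (2 * J)) in *.
  set (E0 := 8 * (1 + t + L) * exp (- sigma * ln N)) in *.
  assert (HcN : 0 <= cN) by (unfold cN; apply Rmult_le_pos; [lra|left; apply exp_pos]).
  assert (Hmain : Cmod (smooth u (2 * J) l PS t) <= 2 ^ (2 * J) * ((2 * u) ^ l * V) + cN * (2 ^ l * ((2 * u) ^ (2 * J) * Q)) + 2 ^ (2 * J) * (2 ^ l * E0)).
  { replace (smooth u (2 * J) l PS t) with (smooth u (2 * J) l F t + (- (RtoC cN * smooth u (2 * J) l W t) + - smooth u (2 * J) l Err t))%C by (rewrite HF; ring).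
    eapply Rle_trans; [apply Cmod_triangle|].
    assert (HH := Cmod_triangle (- (RtoC cN * smooth u (2 * J) l W t)) (- smooth u (2 * J) l Err t)).
    rewrite !Cmod_opp Cmod_mult Cmod_R (Rabs_pos_eq cN HcN) in HH.
    apply (Rmult_le_compat_l cN) in BW; [|exact HcN]. lra. }
  rewrite HD !Cmod_mult Cmod_pow Cmod_opp Cmod_Ci pow1 Rmult_1_l Cmod_R in Hmain.
  assert (H2J : 0 < 2 ^ (2 * J)) by (apply pow_lt; lra).
  assert (H2l : 0 < 2 ^ l) by (apply pow_lt; lra).
  assert (Hul : 0 < u ^ l) by (apply pow_lt; lra).
  rewrite !Rpow_mult_distr in Hmain.
  rewrite Rabs_pos_eq in Hmain.
  2:{ left. repeat apply Rmult_lt_0_compat; assumption. }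
  apply (Rmult_le_reg_l (2 ^ (2 * J) * (2 ^ l * u ^ l))); [repeat apply Rmult_lt_0_compat; assumption|].
  eapply Rle_trans; [exact Hmain|]. fold cN. right. field. lra.
Qed.

(** * Choice of the smoothing parameters *)

Definition large (P : R -> Prop) : Prop := exists y0, forall y, y0 <= y -> P y.

Lemma large_and P Q : large P -> large Q -> large (fun y => P y /\ Q y).
Proof.
  intros [a Ha] [b Hb]. exists (Rmax a b). intros y Hy. split.
  - apply Ha. eapply Rle_trans; [apply Rmax_l|exact Hy].
  - apply Hb. eapply Rle_trans; [apply Rmax_r|exact Hy].
Qed.

Lemma large_imp (P Q : R -> Prop) : (forall y, P y -> Q y) -> large P -> large Q.
Proof. intros H [a Ha]. exists a. intros y Hy. apply H, Ha, Hy. Qed.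

Lemma large_ge (a : R) : large (fun y => a <= y).
Proof. exists a. auto. Qed.

Lemma large_pow_exp (C a : R) (l : nat) : 0 < a -> large (fun y => C * y ^ l <= exp (a * y)).
Proof.
  intros Ha.
  set (K := INR (Factorial.fact (S l)) / a ^ (S l)).
  assert (HK : 0 < K).
  { apply Rdiv_lt_0_compat; [apply INR_fact_lt_0|apply pow_lt; exact Ha]. }
  exists (Rmax 0 (C * K)). intros y Hy.
  assert (Hy0 : 0 <= y) by (eapply Rle_trans; [apply Rmax_l|exact Hy]).
  assert (Hy1 : C * K <= y) by (eapply Rle_trans; [apply Rmax_r|exact Hy]).
  pose proof (pow_fact_le_exp (a * y) (S l) ltac:(nra)) as H.
  assert (Hyl : 0 <= y ^ l) by (apply pow_le; exact Hy0).
  apply Rle_trans with (y ^ (S l) / K).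
  - apply (Rmult_le_reg_r K); [exact HK|]. unfold Rdiv. rewrite (Rmult_assoc _ (/ K)) Rinv_l; [|lra].
    simpl. nra.
  - eapply Rle_trans; [|exact H]. right. unfold K. rewrite Rpow_mult_distr.
    assert (INR (Factorial.fact (S l)) <> 0) by apply INR_fact_neq_0.
    assert (a ^ S l <> 0) by (apply pow_nonzero; lra).
    field. tauto.
Qed.

Lemma exp_pow x n : exp x ^ n = exp (INR n * x).
Proof.
  induction n as [|n IH]; [simpl; rewrite Rmult_0_l exp_0; reflexivity|].
  rewrite S_INR /= IH -exp_plus. f_equal. ring.
Qed.

Lemma cos_le_gauss v : 0 <= v <= PI / 2 -> cos v <= exp (- (v ^ 2 / 4)).
Proof.
  intros Hv.
  apply Rle_trans with (1 - v ^ 2 / 4).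
  - destruct (cos_bound v 0 ltac:(lra) ltac:(lra)) as [_ H].
    unfold cos_approx, cos_term in H. simpl in H.
    assert (v <= 2) by (pose proof PI_4; lra).
    assert (Hc : cos v <= 1 - v ^ 2 / 2 + v ^ 2 * v ^ 2 / 24).
    { eapply Rle_trans; [exact H|]. right. simpl. field. }
    assert (v ^ 2 <= 4) by (simpl; nra).
    assert (0 <= v ^ 2) by apply pow2_ge_0. nra.
  - pose proof (exp_ineq1_le (- (v ^ 2 / 4))). lra.
Qed.

Lemma cos_ge_gauss v : 0 <= v <= 1 -> exp (- v ^ 2) <= cos v.
Proof.
  intros Hv.
  apply Rle_trans with (1 - v ^ 2 / 2).
  - assert (H : exp (- v ^ 2) * (1 + v ^ 2) <= 1).
    { rewrite exp_Ropp. apply (Rmult_le_reg_l (exp (v ^ 2))); [apply exp_pos|].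
      rewrite -Rmult_assoc Rinv_r; [|apply Rgt_not_eq, exp_pos]. rewrite Rmult_1_l Rmult_1_r. apply exp_ineq1_le. }
    assert (Hv2 : 0 <= v ^ 2 <= 1) by (simpl; nra).
    apply (Rmult_le_reg_r (1 + v ^ 2)); [lra|]. nra.
  - destruct (cos_bound v 0) as [H _]; [pose proof PI2_1; lra|pose proof PI2_1; lra|].
    unfold cos_approx, cos_term in H. simpl in H. simpl. lra.
Qed.

Lemma sin_ge_half v : 0 <= v <= 1 -> v / 2 <= sin v.
Proof.
  intros Hv.
  destruct (sin_bound v 0) as [H _]; [lra|pose proof PI2_1; lra|].
  unfold sin_approx, sin_term in H. simpl in H. nra.
Qed.

Lemma harmonic_le X : sum_n (fun k => / INR (S k)) X <= 1 + ln (INR (S X)).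
Proof.
  induction X as [|X IH].
  - rewrite sum_O. simpl. rewrite ln_1. lra.
  - rewrite sum_Sn. unfold plus; simpl AbelianMonoid.plus.
    assert (H : / INR (S (S X)) <= ln (INR (S (S X))) - ln (INR (S X))); [|change (sum_n (fun k => / INR (S k)) X + / INR (S (S X)) <= 1 + ln (INR (S (S X)))); lra].
    pose proof (INR_S_ge_1 X) as H1. pose proof (INR_S_ge_1 (S X)) as H2.
    (* ln z <= z - 1 at z = (X+1)/(X+2) *)
    assert (H3 : ln (INR (S X) / INR (S (S X))) <= INR (S X) / INR (S (S X)) - 1).
    { set (z := INR (S X) / INR (S (S X))). assert (Hz : 0 < z) by (unfold z; apply Rdiv_lt_0_compat; lra).
      pose proof (exp_ineq1_le (ln z)). rewrite exp_ln in H; [|exact Hz]. lra. }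
    unfold Rdiv in H3 at 1. rewrite ln_mult in H3; [|lra|apply Rinv_0_lt_compat; lra].
    rewrite ln_Rinv in H3; [|lra].
    replace (INR (S X) / INR (S (S X)) - 1) with (- / INR (S (S X))) in H3; [lra|].
    rewrite (S_INR (S X)) in H2 |- *. field. lra.
Qed.

(** With [T = exp y]: the length [N = S X] is between [T ^ 3] and [T ^ 4], so that the error
   [t N^(-1/2)] of [zeta_approx] is negligible for [t <= T]; the number [2 * J] of averages is a fixed multiple of
   [ln T]. *)
Record smoothing (A y u : R) (J X : nat) : Prop := {
  sp_y : 1 <= y;
  sp_A : 1 <= A;
  sp_X1 : 3 * y <= ln (INR (S X));
  sp_X2 : ln (INR (S X)) <= 4 * y;
  sp_u : u * ln (INR (S X)) = PI / 2;
  sp_J1 : A * y <= INR J;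
  sp_J2 : INR J <= A * y + 1 }.

Lemma smoothing_exists A y : 1 <= A -> 1 <= y -> exists u J X, smoothing A y u J X.
Proof.
  intros HA Hy.
  destruct (nfloor_ex (exp (3 * y))) as [X HX]; [left; apply exp_pos|].
  destruct (nfloor_ex (A * y)) as [J HJ]; [nra|].
  assert (H1 : 3 * y <= ln (INR (S X))).
  { rewrite -{1}(ln_exp (3 * y)). apply ln_le_mono; [apply exp_pos|]. rewrite S_INR. lra. }
  exists (PI / 2 / ln (INR (S X))), (S J), X.
  split; try assumption; try (rewrite S_INR; lra).
  - rewrite -(ln_exp (4 * y)). apply ln_le_mono; [pose proof (INR_S_ge_1 X); lra|].
    rewrite S_INR. replace (4 * y) with (3 * y + y) by ring. rewrite exp_plus.
    assert (2 <= exp y). { pose proof (exp_ineq1_le y). lra. }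
    assert (1 <= exp (3 * y)). { pose proof (exp_ineq1_le (3 * y)). lra. }
    nra.
  - field. lra.
Qed.

Section Smoothing.
Variables (A y u : R) (J X : nat).
Hypothesis HP : smoothing A y u J X.

Lemma smoothing_step_bounds : 0 < u /\ u * y <= 1 /\ 1 / 4 <= u * y * (4 / 3).
Proof.
  destruct HP as [Hy HA H1 H2 Hu _ _]. pose proof PI_4. pose proof PI2_3_2.
  assert (0 < u).
  { apply (Rmult_lt_reg_r (ln (INR (S X)))); [lra|]. rewrite Rmult_0_l Hu. lra. }
  split; [assumption|]. split; nra.
Qed.

(** [cos_ge_gauss] for each average: the loss is small as long as [theta] is not much larger than
   [sqrt y], the range of the logarithms that the resonator uses. *)
Lemma smooth_coef_lower (sigma theta : R) (l : nat) : 1 / 2 <= theta <= y ->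
  (1 / 4) ^ l * exp (- sigma * theta) * exp (- (4 * A * theta ^ 2 / y)) <= smooth_coef sigma u J l theta.
Proof.
  intros Hth. destruct smoothing_step_bounds as [Hu [Huy _]].
  destruct HP as [Hy HA H1 H2 HuN HJ1 HJ2].
  assert (Hv : 0 <= u * theta <= 1) by nra.
  unfold smooth_coef.
  assert (Hsin : (1 / 4) ^ l <= (sin (u * theta) / u) ^ l).
  { apply pow_incr. split; [lra|]. apply (Rmult_le_reg_r u); [exact Hu|].
    unfold Rdiv at 2. rewrite Rmult_assoc Rinv_l; [|lra]. pose proof (sin_ge_half _ Hv). nra. }
  assert (Hcos : exp (- (4 * A * theta ^ 2 / y)) <= cos (u * theta) ^ (2 * J)).
  { apply Rle_trans with (exp (- (u * theta) ^ 2) ^ (2 * J)).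
    - rewrite exp_pow. apply exp_le_mono.
      rewrite mult_INR. change (INR 2) with 2.
      assert (Hu2 : (u * theta) ^ 2 * y <= theta ^ 2 / y).
      { apply (Rmult_le_reg_r y); [lra|]. unfold Rdiv. rewrite Rmult_assoc (Rmult_assoc (theta ^ 2)) Rinv_l; [|lra].
        replace ((u * theta) ^ 2 * (y * y)) with (theta ^ 2 * ((u * y) * (u * y))) by ring.
        apply Rmult_le_compat_l; [apply pow2_ge_0|].
        assert (0 <= u * y) by nra. nra. }
      assert (HJ : INR J <= 2 * A * y) by nra.
      assert (0 <= (u * theta) ^ 2) by apply pow2_ge_0.
      replace (4 * A * theta ^ 2 / y) with (4 * A * (theta ^ 2 / y)) by (field; lra).
      nra.
    - apply pow_incr. split; [left; apply exp_pos|apply cos_ge_gauss; exact Hv]. }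
  set (e := exp (- sigma * theta)). set (g := exp (- (4 * A * theta ^ 2 / y))) in *.
  assert (0 <= e) by (left; apply exp_pos). assert (0 <= g) by (left; apply exp_pos).
  assert (0 <= (1 / 4) ^ l) by (apply pow_le; lra).
  replace ((1 / 4) ^ l * e * g) with (e * (g * (1 / 4) ^ l)) by ring.
  rewrite (Rmult_assoc e). apply Rmult_le_compat_l; [assumption|].
  apply Rmult_le_compat; assumption.
Qed.

(** Every frequency satisfies [u * theta <= PI / 2], so the cosine and the sine are nonnegative.
   The resonance inequality rests on this positivity. *)
Lemma smooth_coef_nonneg (sigma theta : R) (l : nat) : 0 <= theta <= ln (INR (S X)) -> 0 <= smooth_coef sigma u J l theta.
Proof.
  intros Hth. destruct smoothing_step_bounds as [Hu _].
  destruct HP as [Hy HA H1 H2 HuN HJ1 HJ2].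
  assert (Hv : 0 <= u * theta <= PI / 2) by nra.
  pose proof PI_RGT_0.
  unfold smooth_coef. apply Rmult_le_pos; [apply Rmult_le_pos|].
  - left; apply exp_pos.
  - apply pow_le. apply cos_ge_0; lra.
  - apply pow_le. apply Rmult_le_pos; [apply sin_ge_0; lra|left; apply Rinv_0_lt_compat; exact Hu].
Qed.

(** The Gaussian decay of [cos] improves [n^(- sigma)] to [1 / n] at the price of [exp (8 * y / A)], a small
   power of [T] when [A] is large; with [1 / n] the sum of the coefficients is under control. *)
Lemma smooth_coef_upper (sigma theta : R) (l : nat) : 1 / 2 <= sigma -> 0 <= theta <= ln (INR (S X)) ->
  smooth_coef sigma u J l theta <= (4 * y) ^ l * exp (8 * y / A) * exp (- theta).
Proof.
  intros Hs Hth. destruct smoothing_step_bounds as [Hu [_ Huy]].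
  destruct HP as [Hy HA H1 H2 HuN HJ1 HJ2].
  assert (Hv : 0 <= u * theta <= PI / 2) by nra.
  pose proof PI_RGT_0.
  unfold smooth_coef.
  assert (Hsin : (sin (u * theta) / u) ^ l <= (4 * y) ^ l).
  { apply pow_incr. split.
    - apply Rmult_le_pos; [apply sin_ge_0; lra|left; apply Rinv_0_lt_compat; exact Hu].
    - apply (Rmult_le_reg_r u); [exact Hu|]. unfold Rdiv. rewrite Rmult_assoc Rinv_l; [|lra].
      destruct (Rle_lt_or_eq_dec 0 (u * theta) (proj1 Hv)) as [H0|H0].
      + pose proof (sin_lt_x _ H0). nra.
      + rewrite -H0 sin_0. nra. }
  assert (Hcos : cos (u * theta) ^ (2 * J) * exp (- sigma * theta) <= exp (8 * y / A) * exp (- theta)).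
  { apply Rle_trans with (exp (- ((u * theta) ^ 2 / 4)) ^ (2 * J) * exp (- sigma * theta)).
    - apply Rmult_le_compat_r; [left; apply exp_pos|]. apply pow_incr.
      split; [apply cos_ge_0; lra|apply cos_le_gauss; exact Hv].
    - rewrite exp_pow -!exp_plus. apply exp_le_mono. rewrite mult_INR. change (INR 2) with 2.
      set (w := u * theta) in *.
      assert (Hw : theta ^ 2 / (64 * y) <= w ^ 2 * y).
      { assert (Hu1 : 3 / 16 <= u * y) by lra.
        apply (Rmult_le_reg_r (64 * y)); [lra|]. unfold Rdiv. rewrite Rmult_assoc Rinv_l; [|lra].
        replace (w ^ 2 * y * (64 * y)) with (theta ^ 2 * (64 * ((u * y) * (u * y)))) by (unfold w; ring).
        rewrite Rmult_1_r. rewrite -{1}(Rmult_1_r (theta ^ 2)). apply Rmult_le_compat_l; [apply pow2_ge_0|]. nra. }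
      assert (Hw2 : A * (w ^ 2 * y) <= w ^ 2 * INR J).
      { assert (0 <= w ^ 2) by apply pow2_ge_0. nra. }
      (* the difference is a square times [2 * y / A] *)
      assert (Hsq : theta / 2 - A * theta ^ 2 / (128 * y) <= 8 * y / A).
      { assert (0 <= (theta / (16 * y) * A - 2) ^ 2 * (2 * y / A)).
        { apply Rmult_le_pos; [apply pow2_ge_0|]. apply Rmult_le_pos; [lra|left; apply Rinv_0_lt_compat; lra]. }
        replace ((theta / (16 * y) * A - 2) ^ 2 * (2 * y / A)) with (A * theta ^ 2 / (128 * y) - theta / 2 + 8 * y / A) in H0 by (field; lra).
        lra. }
      assert (Hsum : A * theta ^ 2 / (128 * y) <= w ^ 2 * INR J / 2).
      { replace (A * theta ^ 2 / (128 * y)) with (A * (theta ^ 2 / (64 * y)) / 2) by (field; lra).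
        assert (A * (theta ^ 2 / (64 * y)) <= A * (w ^ 2 * y)) by (apply Rmult_le_compat_l; lra). lra. }
      nra. }
  replace (exp (- sigma * theta) * cos (u * theta) ^ (2 * J) * (sin (u * theta) / u) ^ l) with
    ((sin (u * theta) / u) ^ l * (cos (u * theta) ^ (2 * J) * exp (- sigma * theta))) by ring.
  rewrite (Rmult_assoc ((4 * y) ^ l)).
  apply Rmult_le_compat; [apply pow_le|apply Rmult_le_pos; [apply pow_le; apply cos_ge_0; lra|left; apply exp_pos]|assumption|assumption].
  apply Rmult_le_pos; [apply sin_ge_0; lra|left; apply Rinv_0_lt_compat; exact Hu].
Qed.
End Smoothing.

Lemma sum_n_le_R (a b : nat -> R) X : (forall k, (k <= X)%nat -> a k <= b k) -> sum_n a X <= sum_n b X.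
Proof.
  induction X as [|X IH]; intros H.
  - rewrite !sum_O. apply H. lia.
  - rewrite !sum_Sn. apply Rplus_le_compat; [apply IH; intros; apply H; lia|apply H; lia].
Qed.

Lemma ln_INR_bounds k X : (k <= X)%nat -> 0 <= ln (INR (S k)) <= ln (INR (S X)).
Proof.
  intros H. split; [apply ln_nonneg, INR_S_ge_1|].
  apply ln_le_mono; [pose proof (INR_S_ge_1 k); lra|apply le_INR; lia].
Qed.

Lemma smooth_coef_sum A y u J X sigma l : smoothing A y u J X -> 1 / 2 <= sigma ->
  sum_n (fun k => smooth_coef sigma u J l (ln (INR (S k)))) X <= (4 * y) ^ l * exp (8 * y / A) * (1 + 4 * y).
Proof.
  intros HP Hs.
  apply Rle_trans with (sum_n (fun k => (4 * y) ^ l * exp (8 * y / A) * / INR (S k)) X).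
  - apply sum_n_le_R. intros k Hk.
    replace (/ INR (S k)) with (exp (- ln (INR (S k)))).
    + apply (smooth_coef_upper A y u J X HP); [exact Hs|apply ln_INR_bounds; exact Hk].
    + rewrite exp_Ropp exp_ln; [reflexivity|pose proof (INR_S_ge_1 k); lra].
  - destruct HP as [Hy _ _ H2 _ _ _].
    pose proof (sum_n_mult_l (K:=R_AbsRing) ((4 * y) ^ l * exp (8 * y / A)) (fun k => / INR (S k)) X) as E.
    change (sum_n (fun k => (4 * y) ^ l * exp (8 * y / A) * / INR (S k)) X = (4 * y) ^ l * exp (8 * y / A) * sum_n (fun k => / INR (S k)) X) in E.
    rewrite E. apply Rmult_le_compat_l.
    + apply Rmult_le_pos; [apply pow_le; lra|left; apply exp_pos].
    + pose proof (harmonic_le X). lra.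
Qed.

Lemma fact_le_pow n : INR (Factorial.fact n) <= INR n ^ n.
Proof.
  induction n as [|n IH]; [simpl; lra|].
  rewrite fact_simpl mult_INR. change (INR (S n) ^ S n) with (INR (S n) * INR (S n) ^ n).
  apply Rmult_le_compat_l; [apply pos_INR|]. eapply Rle_trans; [exact IH|].
  apply pow_incr. split; [apply pos_INR|]. rewrite S_INR. lra.
Qed.

(** The constant [A] is chosen large in terms of [eps]. The differences of order [2 * J], where [J]
   is about [A * y], bring the pole term below [exp (- 4 * y)], which beats [N^(1 - sigma) <= exp (2 * y)]. All
   the shifts together move [t] by a bounded amount, so ordinates from [T ^ beta1] to [T / 2] only involve
   values of the derivative between [T ^ beta] and [T]. *)
Theorem smooth_poly_le_max (zeta : C -> C) (l : nat) (beta beta1 eps : R) :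
  is_riemann_zeta zeta -> 0 <= beta < beta1 -> 0 < eps ->
  exists A, 1 <= A /\ large (fun y => exists u J X, smoothing A y u J X /\
   forall sigma, 1 / 2 <= sigma < 1 ->
    sum_n (fun k => smooth_coef sigma u J l (ln (INR (S k)))) X <= exp (eps * y) /\
    forall V, (forall x, exp (beta * y) <= x <= exp y ->
        Cmod (C_derive_n zeta l (RtoC sigma + Ci * RtoC x)%C) <= V) ->
     forall t, exp (beta1 * y) <= t <= exp y / 2 -> Cmod (smooth_poly sigma u J l X t) <= V + 1).
Proof.
  intros Hz Hb Heps.
  set (A := 1 + 16 / eps).
  assert (HA : 1 <= A).
  { unfold A. assert (0 < 16 / eps) by (apply Rdiv_lt_0_compat; lra). lra. }
  exists A. split; [exact HA|].
  set (CR := 2 * A + 2 + INR l).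
  assert (HCR : 4 <= CR) by (unfold CR; pose proof (pos_INR l); lra).
  assert (HAe : forall y, 0 <= y -> 8 * y / A <= eps / 2 * y).
  { intros y Hy. apply (Rmult_le_reg_r A); [lra|]. unfold Rdiv at 1. rewrite Rmult_assoc Rinv_l; [|lra].
    rewrite Rmult_1_r. unfold A. replace (eps / 2 * y * (1 + 16 / eps)) with (eps / 2 * y + 8 * y) by (field; lra). nra. }
  pose proof (large_and _ _ (large_ge 1) (large_and _ _ (large_ge (1 / (beta1 - beta)))
   (large_and _ _ (large_pow_exp (5 * 4 ^ l) (eps / 2) (S l) ltac:(lra))
   (large_and _ _ (large_pow_exp (2 * CR * exp 2) beta1 0 ltac:(lra))
   (large_and _ _ (large_pow_exp (2 * CR) 1 0 ltac:(lra))
   (large_and _ _ (large_pow_exp (32 * 6 ^ l) (1 / 2) l ltac:(lra))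
      (large_pow_exp (2 * 6 ^ l) 2 l ltac:(lra)))))))) as HL.
  revert HL. apply large_imp. intros y (Hy & Hy1 & G1 & G2 & G3 & G4 & G5).
  destruct (smoothing_exists A y HA Hy) as (u & J & X & HP).
  exists u, J, X. split; [exact HP|]. intros sigma Hs. split.
  { eapply Rle_trans; [apply (smooth_coef_sum A y); [exact HP|lra]|].
    replace (eps * y) with (eps / 2 * y + eps / 2 * y) by field. rewrite exp_plus.
    replace ((4 * y) ^ l * exp (8 * y / A) * (1 + 4 * y)) with (exp (8 * y / A) * ((4 * y) ^ l * (1 + 4 * y))) by ring.
    assert (H4 : 0 <= 4 ^ l) by (apply pow_le; lra).
    assert (Hyl : 0 <= y ^ l) by (apply pow_le; lra).
    apply Rmult_le_compat; [left; apply exp_pos|apply Rmult_le_pos; [apply pow_le|]; lra|apply exp_le_mono; apply HAe; lra|].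
    eapply Rle_trans; [|exact G1]. rewrite Rpow_mult_distr. simpl.
    assert (0 <= 4 ^ l * y ^ l) by (apply Rmult_le_pos; assumption). nra. }
  intros V HV t Ht.
  destruct (smoothing_step_bounds A y u J X HP) as (Hu & Huy & Huy2).
  destruct HP as [_ _ HX1 HX2 HuX HJ1 HJ2].
  set (L := INR (2 * J + l) * u).
  assert (Hu1 : u <= 1) by nra.
  assert (HL : 0 <= L <= CR).
  { unfold L, CR. rewrite plus_INR mult_INR. change (INR 2) with 2.
    pose proof (pos_INR J). pose proof (pos_INR l). split; [apply Rmult_le_pos; lra|].
    assert (INR J * u <= A + 1) by nra. nra. }
  assert (HJu : INR (2 * J) * u <= CR).
  { unfold CR. rewrite mult_INR. change (INR 2) with 2. pose proof (pos_INR J). pose proof (pos_INR l).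
    assert (INR J * u <= A + 1) by nra. lra. }
  simpl in G2, G3. rewrite Rmult_1_l in G3.
  assert (Hexp2 : 1 <= exp 2) by (pose proof (exp_ineq1_le 2); lra).
  assert (Hbb : 2 * exp (beta * y) <= exp (beta1 * y)).
  { replace (beta1 * y) with (beta * y + (beta1 - beta) * y) by ring. rewrite exp_plus.
    assert (1 <= (beta1 - beta) * y).
    { apply (Rmult_le_compat_l (beta1 - beta)) in Hy1; [|lra].
      replace ((beta1 - beta) * (1 / (beta1 - beta))) with 1 in Hy1 by (field; lra). exact Hy1. }
    pose proof (exp_ineq1_le ((beta1 - beta) * y)). pose proof (exp_pos (beta * y)). nra. }
  assert (HtL : CR * exp 2 <= t - L) by nra.
  assert (HtL1 : 4 <= t - L) by nra.
  eapply Rle_trans; [apply (smooth_poly_bound zeta sigma u J l X t V Hz Hs Hu HuX)|].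
  { fold L. lra. }
  { fold L. intros x Hx. apply Rabs_le_between in Hx. apply HV.
    assert (CR <= CR * exp 2) by nra. split; lra. }
  fold L. apply Rplus_le_compat_l.
  assert (Hiu : / u ^ l <= 6 ^ l * y ^ l).
  { rewrite -Rpow_mult_distr -pow_inv. apply pow_incr. split; [left; apply Rinv_0_lt_compat; exact Hu|].
    apply (Rmult_le_reg_r u); [exact Hu|]. rewrite Rinv_l; lra. }
  assert (Hiu0 : 0 < / u ^ l) by (apply Rinv_0_lt_compat, pow_lt, Hu).
  assert (Hey : 1 <= exp y) by (pose proof (exp_ineq1_le y); lra).
  assert (T1 : 8 * (1 + t + L) * exp (- sigma * ln (INR (S X))) <= 16 * exp (- (1 / 2 * y))).
  { apply Rle_trans with (16 * exp y * exp (- (3 / 2 * y))).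
    - apply Rmult_le_compat; [nra|left; apply exp_pos|lra|]. apply exp_le_mono. nra.
    - right. rewrite Rmult_assoc -exp_plus. do 2 f_equal. field. }
  assert (T2 : INR (S X) * exp (- sigma * ln (INR (S X))) <= exp (2 * y)).
  { pose proof (INR_S_ge_1 X). rewrite -{1}(exp_ln (INR (S X))); [|lra]. rewrite -exp_plus. apply exp_le_mono.
    pose proof (ln_nonneg _ H). nra. }
  assert (T3 : u ^ (2 * J) * (INR (Factorial.fact (2 * J)) / (t - L) ^ S (2 * J)) <= exp (- (4 * y))).
  { assert (Hp : 0 < (t - L) ^ (2 * J)) by (apply pow_lt; lra).
    apply Rle_trans with ((INR (2 * J) * u / (t - L)) ^ (2 * J)).
    - unfold Rdiv at 2. rewrite !Rpow_mult_distr pow_inv.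
      replace ((t - L) ^ S (2 * J)) with ((t - L) * (t - L) ^ (2 * J)) by reflexivity.
      unfold Rdiv. rewrite Rinv_mult.
      assert (Hi : 0 < / (t - L) <= 1).
      { split; [apply Rinv_0_lt_compat; lra|]. rewrite -Rinv_1. apply Rinv_le_contravar; lra. }
      assert (Hi2 : 0 < / (t - L) ^ (2 * J)) by (apply Rinv_0_lt_compat; exact Hp).
      assert (Hup : 0 < u ^ (2 * J)) by (apply pow_lt; exact Hu).
      pose proof (fact_le_pow (2 * J)) as Hf. pose proof (INR_fact_lt_0 (2 * J)) as Hf0.
      replace (u ^ (2 * J) * (INR (Factorial.fact (2 * J)) * (/ (t - L) * / (t - L) ^ (2 * J))))
        with (INR (Factorial.fact (2 * J)) * / (t - L) * (u ^ (2 * J) * / (t - L) ^ (2 * J))) by ring.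
      rewrite (Rmult_assoc (INR (2 * J) ^ (2 * J))).
      apply Rmult_le_compat_r; [apply Rmult_le_pos; lra|]. nra.
    - apply Rle_trans with (exp (- (2)) ^ (2 * J)).
      + apply pow_incr. split.
        * apply Rmult_le_pos; [apply Rmult_le_pos; [apply pos_INR|lra]|left; apply Rinv_0_lt_compat; lra].
        * apply (Rmult_le_reg_r (t - L)); [lra|]. unfold Rdiv. rewrite Rmult_assoc Rinv_l; [|lra]. rewrite Rmult_1_r.
          apply Rle_trans with (exp (- (2)) * (CR * exp 2)).
          { rewrite (Rmult_comm CR) -Rmult_assoc -exp_plus. replace (- (2) + 2) with 0 by ring. rewrite exp_0. lra. }
          apply Rmult_le_compat_l; [left; apply exp_pos|exact HtL].
      + rewrite exp_pow. apply exp_le_mono. rewrite mult_INR. change (INR 2) with 2. nra. }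
  assert (F1 : / u ^ l * (8 * (1 + t + L) * exp (- sigma * ln (INR (S X)))) <= 1 / 2).
  { apply Rle_trans with (6 ^ l * y ^ l * (16 * exp (- (1 / 2 * y)))).
    - apply Rmult_le_compat; [lra| |exact Hiu|exact T1].
      apply Rmult_le_pos; [lra|left; apply exp_pos].
    - apply Rle_trans with (/ 2 * (exp (1 / 2 * y) * exp (- (1 / 2 * y)))).
      + pose proof (exp_pos (- (1 / 2 * y))). nra.
      + rewrite -exp_plus. replace (1 / 2 * y + - (1 / 2 * y)) with 0 by ring. rewrite exp_0. lra. }
  assert (F2 : / u ^ l * (INR (S X) * exp (- sigma * ln (INR (S X))) * (u ^ (2 * J) * (INR (Factorial.fact (2 * J)) / (t - L) ^ S (2 * J)))) <= 1 / 2).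
  { apply Rle_trans with (6 ^ l * y ^ l * (exp (2 * y) * exp (- (4 * y)))).
    - apply Rmult_le_compat; [lra| |exact Hiu|].
      + apply Rmult_le_pos; [apply Rmult_le_pos; [apply pos_INR|left; apply exp_pos]|].
        apply Rmult_le_pos; [apply pow_le; lra|]. apply Rmult_le_pos; [apply pos_INR|].
        left; apply Rinv_0_lt_compat, pow_lt; lra.
      + apply Rmult_le_compat; [| |exact T2|exact T3].
        * apply Rmult_le_pos; [apply pos_INR|left; apply exp_pos].
        * apply Rmult_le_pos; [apply pow_le; lra|]. apply Rmult_le_pos; [apply pos_INR|].
          left; apply Rinv_0_lt_compat, pow_lt; lra.
    - rewrite -exp_plus. replace (2 * y + - (4 * y)) with (- (2 * y)) by ring.
      apply Rle_trans with (/ 2 * (exp (2 * y) * exp (- (2 * y)))).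
      + pose proof (exp_pos (- (2 * y))). nra.
      + rewrite -exp_plus. replace (2 * y + - (2 * y)) with 0 by ring. rewrite exp_0. lra. }
  rewrite Rmult_plus_distr_l. lra.
Qed.

Module Resonator.
Import HB.structures.
Import mathcomp.boot.ssreflect ssrfun ssrbool eqtype ssrnat seq div fintype finfun bigop prime binomial.
Import zify_ssreflect.
Open Scope R_scope.
Set Implicit Arguments.
Unset Strict Implicit.

(** * Finite real sums *)

HB.instance Definition _ := Monoid.isComLaw.Build R R0 Rplus
  (fun x y z => esym (Rplus_assoc x y z)) Rplus_comm Rplus_0_l.
HB.instance Definition _ := Monoid.isComLaw.Build R R1 Rmult
  (fun x y z => esym (Rmult_assoc x y z)) Rmult_comm Rmult_1_l.
HB.instance Definition _ := Monoid.isMulLaw.Build R R0 Rmult Rmult_0_l Rmult_0_r.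
HB.instance Definition _ := Monoid.isAddLaw.Build R Rmult Rplus
  (fun x y z => Rmult_plus_distr_r x y z) (fun x y z => Rmult_plus_distr_l x y z).

Notation "\rsum_ ( i <- r | P ) F" := (\big[Rplus/R0]_(i <- r | P%B) F%R)
  (at level 41, F at level 41, i, r at level 50) : R_scope.
Notation "\rsum_ ( i <- r ) F" := (\big[Rplus/R0]_(i <- r) F%R)
  (at level 41, F at level 41, i, r at level 50) : R_scope.
Notation "\rsum_ ( i | P ) F" := (\big[Rplus/R0]_(i | P%B) F%R)
  (at level 41, F at level 41, i at level 50) : R_scope.
Notation "\rsum_ ( i : t ) F" := (\big[Rplus/R0]_(i : t) F%R)
  (at level 41, F at level 41, i at level 50) : R_scope.
Notation "\rsum_ ( i : t | P ) F" := (\big[Rplus/R0]_(i : t | P%B) F%R)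
  (at level 41, F at level 41, i at level 50) : R_scope.
Notation "\rsum_ i F" := (\big[Rplus/R0]_i F%R)
  (at level 41, F at level 41, i at level 0, right associativity) : R_scope.
Notation "\rprod_ i F" := (\big[Rmult/R1]_i F%R)
  (at level 41, F at level 41, i at level 0, right associativity) : R_scope.

Section Sums.
Variable I : finType.
Implicit Types (F G : I -> R) (P : pred I).

Lemma rsum_ge0 P F : (forall i, P i -> 0 <= F i) -> 0 <= \rsum_(i | P i) F i.
Proof. by move=> H; apply: (big_ind (fun x => 0 <= x)) => //; [lra|move=> x y; lra]. Qed.

Lemma rsum_le P F G : (forall i, P i -> F i <= G i) -> \rsum_(i | P i) F i <= \rsum_(i | P i) G i.
Proof. move=> H; apply: (big_ind2 (fun x y => x <= y)) => //; [lra|move=> *; lra]. Qed.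

Lemma rsum_le_pred P F : (forall i, 0 <= F i) -> \rsum_(i | P i) F i <= \rsum_i F i.
Proof. move=> H; rewrite big_mkcond; apply: rsum_le => i _; case: (P i); [lra|exact: H]. Qed.

Lemma rsum_term P F i : P i -> (forall j, P j -> 0 <= F j) -> F i <= \rsum_(j | P j) F j.
Proof.
move=> Pi H; rewrite (bigD1 i) //=.
suff: 0 <= \rsum_(j | P j && (j != i)) F j by lra.
by apply: rsum_ge0 => j /andP[Pj _]; apply: H.
Qed.

Lemma rsum_const_card P (c : R) : \rsum_(i | P i) c = INR #|P| * c.
Proof.
rewrite big_const; elim: #|P| => [|n IH] /=; first by lra.
rewrite IH; change (c + INR n * c = INR n.+1 * c); rewrite S_INR; lra.
Qed.

Lemma rsum_distrl P F c : (\rsum_(i | P i) F i) * c = \rsum_(i | P i) (F i * c).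
Proof. exact: big_distrl. Qed.

Lemma rsum_distrr P F c : c * (\rsum_(i | P i) F i) = \rsum_(i | P i) (c * F i).
Proof. exact: big_distrr. Qed.

Lemma rsum_plus P F G : \rsum_(i | P i) (F i + G i) = \rsum_(i | P i) F i + \rsum_(i | P i) G i.
Proof. exact: big_split. Qed.

Lemma Rabs_rsum P F : Rabs (\rsum_(i | P i) F i) <= \rsum_(i | P i) Rabs (F i).
Proof.
apply: (big_ind2 (fun x y => Rabs x <= y)) => //.
- by rewrite Rabs_R0; lra.
- move=> x1 x2 y1 y2 H1 H2; apply: (Rle_trans _ _ _ (Rabs_triang _ _)); lra.
- by move=> i _; lra.
Qed.

Lemma rsum_CS P F G :
  (\rsum_(i | P i) (F i * G i)) ^ 2 <= (\rsum_(i | P i) (F i ^ 2)) * (\rsum_(i | P i) (G i ^ 2)).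
Proof.
set a := \rsum_(i | P i) (F i ^ 2); set b := \rsum_(i | P i) (G i ^ 2).
set c := \rsum_(i | P i) (F i * G i).
have Hq x : 0 <= a * x ^ 2 + 2 * c * x + b.
  have -> : a * x ^ 2 + 2 * c * x + b = \rsum_(i | P i) ((F i * x + G i) ^ 2).
    rewrite /a /b /c rsum_distrl Rmult_assoc rsum_distrl rsum_distrr -!rsum_plus.
    by apply: eq_bigr => i _; ring.
  by apply: rsum_ge0 => i _; apply: pow2_ge_0.
have Ha : 0 <= a by apply: rsum_ge0 => i _; apply: pow2_ge_0.
case: (Rle_lt_or_eq_dec 0 a Ha) => [Ha0|Ha0].
- move: (Hq (- c / a)).
  have -> : a * (- c / a) ^ 2 + 2 * c * (- c / a) + b = (a * b - c ^ 2) / a by field; lra.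
  move=> H; have : 0 <= (a * b - c ^ 2) / a * a by apply: Rmult_le_pos.
  have -> : (a * b - c ^ 2) / a * a = a * b - c ^ 2 by field; lra.
  lra.
- rewrite -Ha0 in Hq *.
  have Hb : 0 <= b by apply: rsum_ge0 => i _; apply: pow2_ge_0.
  case: (Req_dec c 0) => [-> |Hc]; first by lra.
  move: (Hq (- (b + 1) / (2 * c))).
  have -> : 2 * c * (- (b + 1) / (2 * c)) = - (b + 1) by field.
  lra.
Qed.

Lemma sqrt_rsum_le P F : (forall i, P i -> 0 <= F i) -> sqrt (\rsum_(i | P i) (F i ^ 2)) <= \rsum_(i | P i) F i.
Proof.
move=> H.
have: 0 <= \rsum_(i | P i) F i /\ \rsum_(i | P i) (F i ^ 2) <= (\rsum_(i | P i) F i) ^ 2.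
  apply: (big_ind2 (fun x y => 0 <= y /\ x <= y ^ 2)).
  - by split; simpl; lra.
  - by move=> x1 x2 y1 y2 [? ?] [? ?]; split; nra.
  - by move=> i Pi; split; [exact: H|lra].
case=> H0 H1; rewrite -(sqrt_pow2 _ H0); exact: sqrt_le_1_alt.
Qed.
End Sums.

(** * The resonance inequality *)

Definition reqb (x y : R) : bool := if Req_EM_T x y then true else false.

Lemma reqbP x y : reflect (x = y) (reqb x y).
Proof. by rewrite /reqb; case: Req_EM_T => H; constructor. Qed.

Definition floorN (x : R) : nat := Z.to_nat (Int_part x).

Lemma floorNP x : 0 <= x -> INR (floorN x) <= x < INR (floorN x) + 1.
Proof.
move=> Hx; case: (base_Int_part x) => H1 H2.
have Hz : (0 <= Int_part x)%Z.
  have : (-1 < Int_part x)%Z by apply: lt_IZR; lra.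
  by lia.
by rewrite /floorN INR_IZR_INZ Z2Nat.id //; lra.
Qed.

(** Multiplied by [2 * sin (al / 2)] the sum telescopes over a whole number of turns; this factor
   is nonzero because [D / N] is not an integer. *)
Lemma cos_sum_zero (N D : nat) (al be : R) : (0 < D < N)%N -> INR N * al = 2 * INR D * PI ->
  \rsum_(p : 'I_N) cos (INR p * al + be) = 0.
Proof.
move=> HD Hal.
have HN : 0 < INR N by apply: lt_0_INR; lia.
have HDN : INR D < INR N by apply: lt_INR; lia.
have HD0 : 0 < INR D by apply: lt_0_INR; lia.
have Eal : al / 2 = PI * (INR D / INR N).
  have -> : al = INR N * al / INR N by field; lra.
  by rewrite Hal; field; lra.
have Hs : 0 < sin (al / 2).
  have Hq : 0 < INR D / INR N < 1.
    split; first by apply: Rdiv_lt_0_compat.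
    apply: (Rmult_lt_reg_r (INR N)) => //; rewrite /Rdiv Rmult_assoc Rinv_l; lra.
  have HP := PI_RGT_0.
  by apply: sin_gt_0; rewrite Eal; nra.
have Tel : forall M : nat, 2 * sin (al / 2) * (\rsum_(p : 'I_M) cos (INR p * al + be))
   = sin (INR M * al - al / 2 + be) - sin (- (al / 2) + be).
  elim=> [|M IH]; first by rewrite big_ord0 /= Rmult_0_l Rmult_0_r Rminus_0_l; lra.
  rewrite big_ord_recr /= Rmult_plus_distr_l IH; change (match M with 0%N => 1 | S _ => INR M + 1 end) with (INR M.+1).
  rewrite S_INR.
  have -> : (INR M + 1) * al - al / 2 + be = (INR M * al + be) + al / 2 by field.
  have -> : INR M * al - al / 2 + be = (INR M * al + be) - al / 2 by field.
  rewrite (sin_plus (INR M * al + be)) (sin_minus (INR M * al + be)); ring.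
move: (Tel N); rewrite Hal.
have -> : 2 * INR D * PI - al / 2 + be = (- (al / 2) + be) + 2 * INR D * PI by ring.
rewrite sin_period Rminus_diag => H.
by case: (Rmult_integral _ _ H) => // H0; lra.
Qed.

Section FourierPositivity.
Variables (n : nat).

Lemma fejer_square (y : R) :
  \rsum_(p : 'I_n) (\rsum_(q : 'I_n) cos ((INR p - INR q) * y)) =
   (\rsum_(p : 'I_n) cos (INR p * y)) ^ 2 + (\rsum_(p : 'I_n) sin (INR p * y)) ^ 2.
Proof.
rewrite /= !Rmult_1_r !rsum_distrl -rsum_plus; apply: eq_bigr => p _.
rewrite !rsum_distrr -rsum_plus; apply: eq_bigr => q _.
by rewrite Rmult_minus_distr_r cos_minus.
Qed.

Lemma fejer_ge0 (y : R) : 0 <= \rsum_(p : 'I_n) (\rsum_(q : 'I_n) cos ((INR p - INR q) * y)).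
Proof. rewrite fejer_square; apply: Rplus_le_le_0_compat; exact: pow2_ge_0. Qed.

(** The angles [INR p * y] are at most [PI / 3], so each cosine is at least [1 / 2]. *)
Lemma fejer_lower (y : R) : INR n * Rabs y <= PI / 3 ->
  INR n ^ 2 / 4 <= \rsum_(p : 'I_n) (\rsum_(q : 'I_n) cos ((INR p - INR q) * y)).
Proof.
move=> Hy; rewrite fejer_square.
have Hc : INR n / 2 <= \rsum_(p : 'I_n) cos (INR p * y).
  have -> : INR n / 2 = \rsum_(p : 'I_n) (1 / 2) by rewrite rsum_const_card card_ord; field.
  apply: rsum_le => p _; rewrite -cos_PI3.
  have Hp : Rabs (INR p * y) <= PI / 3.
    rewrite Rabs_mult (Rabs_pos_eq (INR p)); last exact: pos_INR.
    apply: Rle_trans Hy; apply: Rmult_le_compat_r; first exact: Rabs_pos.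
    by apply: le_INR; have := ltn_ord p; lia.
  have HP := PI_RGT_0.
  have Habs : cos (INR p * y) = cos (Rabs (INR p * y)).
    by rewrite /Rabs; case: Rcase_abs => // _; rewrite cos_neg.
  by rewrite Habs; apply: cos_decr_1; have := Rabs_pos (INR p * y); lra.
have Hn := pos_INR n.
have := pow2_ge_0 (\rsum_(p : 'I_n) sin (INR p * y)).
nra.
Qed.

End FourierPositivity.

Lemma pow_incr_inv_sq (x y : R) : 0 <= x -> 0 <= y -> x ^ 2 <= y ^ 2 -> x <= y.
Proof. move=> Hx Hy H; nra. Qed.

(** The trigonometric polynomial [DR] has nonnegative coefficients, is at most [W] for ordinates
   between [a] and [b], and at most [S] everywhere. The resonator [f] has its mass at distinct
   frequencies [lam s]. Averaging [DR] times the square of the resonator against a Fejer kernel of length [b]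
   keeps all the terms nonnegative, so that those with [lam p.2 = lam p.1 + theta k] can be singled out.
   The average is a finite sum over pairs of points of a grid of step [b / n]. To have an exact
   quadrature formula, the frequencies are rounded to cells of width [eta = PI / (3 * b)], a precision that the
   Fejer kernel does not notice. *)
Section Resonance.
Variables (I K : finType) (M : pred I) (f lam : I -> R) (theta d : K -> R) (a b W S : R).
Hypothesis f_ge0 : forall s, 0 <= f s.
Hypothesis f_supp : forall s, ~~ M s -> f s = 0.
Hypothesis lam_inj : injective lam.
Hypothesis d_ge0 : forall k, 0 <= d k.
Hypothesis Hab : 0 < a <= b.
Let DR (t : R) : R := \rsum_k (d k * cos (t * theta k)).
Hypothesis DR_le : forall t, a <= t <= b -> Rabs (DR t) <= W.
Hypothesis d_sum : \rsum_k d k <= S.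

Let eta : R := PI / (3 * b).
Let lam0 : R := \rsum_s Rabs (lam s).
Let cellnat (s : I) : nat := floorN ((lam s + lam0) / eta).
Let mc : nat := (\max_s cellnat s).+1.
Let cell (s : I) : 'I_mc := inord (cellnat s).

Let eta_gt0 : 0 < eta.
Proof. by apply: Rdiv_lt_0_compat; [exact: PI_RGT_0|lra]. Qed.

Let cell_spec s : 0 <= lam s + lam0 - eta * INR (cell s) < eta.
Proof.
have -> : nat_of_ord (cell s) = cellnat s.
  by rewrite /cell inordK // /mc ltnS; exact: (leq_bigmax (F := cellnat)).
have H0 : 0 <= (lam s + lam0) / eta.
  apply: Rmult_le_pos; last by left; apply: Rinv_0_lt_compat.
  have : Rabs (lam s) <= lam0 by rewrite /lam0; apply: (@rsum_term _ _ (fun s => Rabs (lam s)) s) => // j _; exact: Rabs_pos.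
  have := Rle_abs (- lam s); rewrite Rabs_Ropp; lra.
case: (floorNP H0); rewrite -/(cellnat s) => H1 H2.
have E : eta * ((lam s + lam0) / eta) = lam s + lam0 by field; lra.
split.
- have := Rmult_le_compat_l eta _ _ (Rlt_le _ _ eta_gt0) H1; rewrite E; lra.
- have := Rmult_lt_compat_l eta _ _ eta_gt0 H2; rewrite E; lra.
Qed.

(** The [l2] mass of a cell stands for the resonator at the rounded frequency. *)
Let r (c : 'I_mc) : R := sqrt (\rsum_(s | cell s == c) (f s ^ 2)).

Let r_ge0 c : 0 <= r c. Proof. exact: sqrt_pos. Qed.

Let r_sq c : r c ^ 2 = \rsum_(s | cell s == c) (f s ^ 2).
Proof. by apply: pow2_sqrt; apply: rsum_ge0 => s _; exact: pow2_ge_0. Qed.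

Let r_sq_sum : \rsum_c (r c ^ 2) = \rsum_s (f s ^ 2).
Proof.
rewrite (partition_big cell predT) //=; apply: eq_bigr => c _; rewrite -r_sq //.
Qed.

Let r_sum : (\rsum_c r c) ^ 2 <= INR #|M| * \rsum_s (f s ^ 2).
Proof.
have H1 : \rsum_c r c <= \rsum_s f s.
  rewrite (partition_big cell predT) //=; apply: rsum_le => c _.
  exact: sqrt_rsum_le.
have H0 : 0 <= \rsum_c r c by apply: rsum_ge0.
have H2 : (\rsum_s f s) ^ 2 <= INR #|M| * \rsum_s (f s ^ 2).
  have := @rsum_CS I M (fun=> 1) f.
  rewrite (_ : \rsum_(i | M i) (1 ^ 2) = INR #|M|); last first.
    by rewrite rsum_const_card /= !Rmult_1_r.
  under eq_bigr => s _ do rewrite Rmult_1_l.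
  have -> : \rsum_(i | M i) f i = \rsum_i f i.
    by rewrite [in LHS]big_mkcond; apply: eq_bigr => s _; case: ifP => // /negbT /f_supp ->.
  move=> H; apply: (Rle_trans _ _ _ H); apply: Rmult_le_compat_l; first exact: pos_INR.
  by apply: rsum_le_pred => s; exact: pow2_ge_0.
nra.
Qed.

Let x (c c' : 'I_mc) : R := (INR c - INR c') * eta.
Let Q (t : R) : R := \rsum_c (\rsum_c' (r c * r c' * cos (t * x c c'))).

Let Q_square t : Q t = (\rsum_c (r c * cos (t * (INR c * eta)))) ^ 2 + (\rsum_c (r c * sin (t * (INR c * eta)))) ^ 2.
Proof.
rewrite /Q /= !Rmult_1_r !rsum_distrl -rsum_plus; apply: eq_bigr => c _.
rewrite !rsum_distrr -rsum_plus; apply: eq_bigr => c' _.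
rewrite /x (_ : t * ((INR c - INR c') * eta) = t * (INR c * eta) - t * (INR c' * eta)); last by ring.
by rewrite cos_minus; ring.
Qed.

Let Q_ge0 t : 0 <= Q t.
Proof. by rewrite Q_square; apply: Rplus_le_le_0_compat; exact: pow2_ge_0. Qed.

Let Q_le t : Q t <= INR #|M| * \rsum_s (f s ^ 2).
Proof.
apply: Rle_trans r_sum; rewrite /Q /= Rmult_1_r rsum_distrl; apply: rsum_le => c _.
rewrite rsum_distrr; apply: rsum_le => c' _.
have := COS_bound (t * x c c'); have := Rmult_le_pos _ _ (r_ge0 c) (r_ge0 c'); nra.
Qed.

(** The sample points run over the period [6 * b] of [Q], whose frequencies are multiples of [eta],
   and are more numerous than its frequencies: only the diagonal survives. *)
Let Q_period (n : nat) (u0 : R) : (mc <= n)%N ->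
  \rsum_(p : 'I_(6 * n)) Q ((INR p - u0) * (b / INR n)) = INR (6 * n) * \rsum_s (f s ^ 2).
Proof.
move=> Hmn.
have Hn : 0 < INR n by apply: lt_0_INR; rewrite /mc in Hmn; lia.
have E6 : INR (6 * n) = 6 * INR n by rewrite -multE mult_INR; congr (_ * _); simpl; ring.
rewrite /Q exchange_big /= -r_sq_sum rsum_distrr; apply: eq_bigr => c _.
rewrite exchange_big /= (bigD1 c) //= [X in _ + X]big1 ?Rplus_0_r.
  under eq_bigr => p _ do rewrite /x Rminus_diag Rmult_0_l Rmult_0_r cos_0 Rmult_1_r.
  by rewrite rsum_const_card card_ord /= Rmult_1_r.
move=> c' Hc'; rewrite -rsum_distrr.
suff -> : \rsum_(p : 'I_(6 * n)) cos ((INR p - u0) * (b / INR n) * x c c') = 0 by rewrite Rmult_0_r.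
have Hxx e : b / INR n * (e * eta) = e * PI / (3 * INR n) by rewrite /eta; field; lra.
have Hc := ltn_ord c; have Hc1 := ltn_ord c'.
case: (ltngtP c c') => Hcc; last by case/negP: Hc'; apply/eqP/val_inj.
- have E p : cos ((INR p - u0) * (b / INR n) * x c c') =
     cos (INR p * (INR (c' - c) * PI / (3 * INR n)) + - u0 * (INR (c' - c) * PI / (3 * INR n))).
    rewrite -minusE minus_INR; last by lia.
    rewrite -cos_neg Rmult_assoc /x Hxx; congr cos; field; lra.
  under eq_bigr => p _ do rewrite E.
  apply: (@cos_sum_zero _ (c' - c)); first by lia.
  rewrite E6; field; lra.
- have E p : cos ((INR p - u0) * (b / INR n) * x c c') =
     cos (INR p * (INR (c - c') * PI / (3 * INR n)) + - u0 * (INR (c - c') * PI / (3 * INR n))).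
    rewrite -minusE minus_INR; last by lia.
    rewrite Rmult_assoc /x Hxx; congr cos; field; lra.
  under eq_bigr => p _ do rewrite E.
  apply: (@cos_sum_zero _ (c - c')); first by lia.
  rewrite E6; field; lra.
Qed.

Let Q_sample (n : nat) : (mc <= n)%N ->
  \rsum_(q : 'I_n) (\rsum_(p : 'I_n) Q ((INR p - INR q) * (b / INR n))) <= 6 * INR n ^ 2 * \rsum_s (f s ^ 2).
Proof.
move=> Hmn.
have E6 : INR (6 * n) = 6 * INR n by rewrite -multE mult_INR; congr (_ * _); simpl; ring.
have Hle : (n <= 6 * n)%N by lia.
apply: (Rle_trans _ (\rsum_(q : 'I_n) (INR (6 * n) * \rsum_s (f s ^ 2)))).
  apply: rsum_le => q _; rewrite -(Q_period (INR q) Hmn).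
  rewrite (big_ord_widen_cond (6 * n) predT (fun p => Q ((INR p - INR q) * (b / INR n))) Hle).
  exact: (@rsum_le_pred _ _ (fun p : 'I_(6 * n) => Q ((INR p - INR q) * (b / INR n)))).
by rewrite rsum_const_card card_ord E6 /=; right; ring.
Qed.

(** The addition formula also produces sines, which cancel by the symmetry between [c] and [c']. *)
Let DRQ_expand t : DR t * Q t =
  \rsum_k (\rsum_c (\rsum_c' (d k * (r c * r c') * cos (t * (theta k + x c c'))))).
Proof.
rewrite /DR rsum_distrl; apply: eq_bigr => k _.
have Hsin : \rsum_c (\rsum_c' (r c * r c' * sin (t * x c c'))) = 0.
  set z := LHS; suff: z = - z by lra.
  rewrite {1}/z exchange_big /=.
  rewrite -[RHS]Rmult_1_l -Ropp_mult_distr_r Ropp_mult_distr_l /z rsum_distrr; apply: eq_bigr => c _.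
  rewrite rsum_distrr; apply: eq_bigr => c' _.
  rewrite (_ : t * x c' c = - (t * x c c')); last by rewrite /x; ring.
  by rewrite sin_neg; ring.
have -> : d k * cos (t * theta k) * Q t =
  d k * (cos (t * theta k) * Q t + (- sin (t * theta k)) * \rsum_c (\rsum_c' (r c * r c' * sin (t * x c c')))).
  by rewrite Hsin; ring.
rewrite /Q [cos _ * _]rsum_distrr [- sin _ * _]rsum_distrr -rsum_plus rsum_distrr; apply: eq_bigr => c _.
rewrite [cos _ * _]rsum_distrr [- sin _ * _]rsum_distrr -rsum_plus rsum_distrr; apply: eq_bigr => c' _.
by rewrite (Rmult_plus_distr_l t) cos_plus; ring.
Qed.

Let rel k (p : I * I) : bool := reqb (lam p.2) (lam p.1 + theta k).
Let incell k c c' (p : I * I) : bool := rel k p && ((cell p.1 == c) && (cell p.2 == c')).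

(** Given [k], an index has at most one partner at distance [theta k], because [lam] is injective;
   Cauchy-Schwarz then applies. *)
Let cell_pair k c c' :
  \rsum_(p | incell k c c' p) (f p.1 * f p.2) <= r c * r c'.
Proof.
pose P := incell k c c'; rewrite -/P.
have H (q : I * I -> I) c0 : (forall p, P p -> cell (q p) == c0) ->
    (forall p p', P p -> P p' -> q p = q p' -> p = p') -> \rsum_(p | P p) (f (q p) ^ 2) <= r c0 ^ 2.
  move=> Hq Hinj; rewrite r_sq (partition_big q (fun s => cell s == c0)) //=.
  apply: rsum_le => s _.
  case: (pickP (fun p => P p && (q p == s))) => [p0 Hp0|H0]; last by rewrite big_pred0 //; exact: pow2_ge_0.
  have [HP0 /eqP Hs0] := andP Hp0.
  rewrite (big_pred1 p0); first by rewrite Hs0; lra.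
  move=> p; apply/idP/eqP => [/andP[HPp /eqP Hs]|-> //].
  by apply: Hinj => //; rewrite Hs Hs0.
have H1 := H fst c ltac:(by move=> p /andP[_ /andP[]]) _.
have H2 := H snd c' ltac:(by move=> p /andP[_ /andP[]]) _.
have {}H1 : \rsum_(p | P p) (f p.1 ^ 2) <= r c ^ 2.
  apply: H1 => -[s t] [s' t'] /andP[/reqbP /= E _] /andP[/reqbP /= E' _] /= Ess.
  by congr pair => //; apply: lam_inj; rewrite E E' Ess.
have {}H2 : \rsum_(p | P p) (f p.2 ^ 2) <= r c' ^ 2.
  apply: H2 => -[s t] [s' t'] /andP[/reqbP /= E _] /andP[/reqbP /= E' _] /= Ett.
  by congr pair => //; apply: lam_inj; move: E E'; rewrite Ett; lra.
have := @rsum_CS (I * I)%type P (fun p => f p.1) (fun p => f p.2).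
have H0 : 0 <= \rsum_(p | P p) (f p.1 * f p.2) by apply: rsum_ge0 => p _; exact: Rmult_le_pos.
have G1 : 0 <= \rsum_(p | P p) (f p.1 ^ 2) by apply: rsum_ge0 => p _; exact: pow2_ge_0.
have G2 : 0 <= \rsum_(p | P p) (f p.2 ^ 2) by apply: rsum_ge0 => p _; exact: pow2_ge_0.
have Hc := r_ge0 c; have Hc' := r_ge0 c'.
move=> HCS; apply: pow_incr_inv_sq => //; first exact: Rmult_le_pos.
apply: (Rle_trans _ _ _ HCS); rewrite Rpow_mult_distr; exact: Rmult_le_compat.
Qed.

(** For cells that contain a pair at distance [theta k], the frequency [theta k + x c c'] is within
   [eta] of [0], where [fejer_lower] applies since [b * eta = PI / 3]. All other terms are nonnegative by
   [fejer_ge0]. *)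
Let fejer_sum_lower (n : nat) : (0 < n)%N ->
  INR n ^ 2 / 4 * (\rsum_k (d k * \rsum_(p | rel k p) (f p.1 * f p.2))) <=
  \rsum_(q : 'I_n) (\rsum_(p : 'I_n) (DR ((INR p - INR q) * (b / INR n)) * Q ((INR p - INR q) * (b / INR n)))).
Proof.
move=> Hn0.
have Hn : 0 < INR n by apply: lt_0_INR; lia.
pose G y := \rsum_(q : 'I_n) (\rsum_(p : 'I_n) cos ((INR p - INR q) * y)).
have EG y : G y = \rsum_(p : 'I_n) (\rsum_(q : 'I_n) cos ((INR p - INR q) * y)) by rewrite /G exchange_big.
apply: (Rle_trans _ (\rsum_k (\rsum_c (\rsum_c' (d k * (r c * r c') * G (b / INR n * (theta k + x c c'))))))); last first.
  right; under [RHS]eq_bigr => q _ do under eq_bigr => p _ do rewrite DRQ_expand.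
  under [RHS]eq_bigr => q _ do rewrite exchange_big /=.
  rewrite [RHS]exchange_big /=; apply: eq_bigr => k _.
  under [RHS]eq_bigr => q _ do rewrite exchange_big /=.
  rewrite [RHS]exchange_big /=; apply: eq_bigr => c _.
  under [RHS]eq_bigr => q _ do rewrite exchange_big /=.
  rewrite [RHS]exchange_big /=; apply: eq_bigr => c' _.
  rewrite /G rsum_distrr; apply: eq_bigr => q _.
  by rewrite rsum_distrr; apply: eq_bigr => p _; rewrite (Rmult_assoc (_ - _)).
rewrite rsum_distrr; apply: rsum_le => k _.
have -> : INR n ^ 2 / 4 * (d k * \rsum_(p | rel k p) (f p.1 * f p.2)) =
   \rsum_c (\rsum_c' (d k * (INR n ^ 2 / 4 * \rsum_(p | incell k c c' p) (f p.1 * f p.2)))).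
  rewrite (partition_big (fun p : I * I => cell p.1) predT) //.
  rewrite rsum_distrr rsum_distrr; apply: eq_bigr => c _.
  rewrite (partition_big (fun p : I * I => cell p.2) predT) //.
  rewrite rsum_distrr rsum_distrr; apply: eq_bigr => c' _.
  rewrite (eq_bigl (incell k c c')); last by move=> p; rewrite /incell andbA.
  have Hr u v w : u * (v * w) = v * (u * w) by ring.
  exact: Hr.
apply: rsum_le => c _; apply: rsum_le => c' _; rewrite (Rmult_assoc (d k)).
apply: Rmult_le_compat_l => //.
case: (pickP (incell k c c')) => [p0 /andP[/reqbP H0 /andP[/eqP Hc /eqP Hc']]|H0]; last first.
  rewrite big_pred0 // Rmult_0_r EG; apply: Rmult_le_pos; first exact: Rmult_le_pos.
  exact: fejer_ge0.
rewrite Rmult_comm; apply: Rmult_le_compat; last first.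
- rewrite EG; apply: fejer_lower.
  have Habs : Rabs (theta k + x c c') <= eta.
    have := cell_spec p0.1; have := cell_spec p0.2; rewrite Hc Hc' H0 /x => S1 S2.
    apply: Rabs_le; lra.
  rewrite Rabs_mult Rabs_pos_eq; last by left; apply: Rdiv_lt_0_compat; lra.
  rewrite -Rmult_assoc (_ : INR n * (b / INR n) = b); last by field; lra.
  have -> : PI / 3 = b * eta by rewrite /eta; field; lra.
  by apply: Rmult_le_compat_l; lra.
- exact: cell_pair.
- by have := pow2_ge_0 (INR n); lra.
- by apply: rsum_ge0 => p _; apply: Rmult_le_pos.
Qed.

Let DR_abs t : Rabs (DR t) <= S.
Proof.
apply: Rle_trans d_sum; apply: (Rle_trans _ _ _ (Rabs_rsum _ _)); apply: rsum_le => k _.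
rewrite Rabs_mult Rabs_pos_eq //; have := COS_bound (t * theta k) => Hc.
have : Rabs (cos (t * theta k)) <= 1 by apply: Rabs_le; lra.
by have := d_ge0 k; nra.
Qed.

Let DR_even t : DR (- t) = DR t.
Proof. by apply: eq_bigr => k _; rewrite (_ : - t * theta k = - (t * theta k)) ?cos_neg //; ring. Qed.

Let near_card (n Kn : nat) (q : 'I_n) : (#|[pred p : 'I_n | (p < q + Kn) && (q < p + Kn)]| <= 2 * Kn)%N.
Proof.
case: Kn => [|Kn].
  by rewrite eq_card0 // => p; rewrite !inE; lia.
have -> : (2 * Kn.+1 = (Kn + Kn.+1).+1)%N by lia.
rewrite -[X in (_ <= X)%N]card_ord.
apply: (@leq_card_in _ _ (fun p : 'I_n => inord (p + Kn.+1 - q) : 'I_(Kn + Kn.+1).+1)).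
move=> p p' /=; rewrite !inE => /andP[H1 H2] /andP[H3 H4] H.
apply/val_inj => /=.
have := congr1 (@nat_of_ord _) H; rewrite !inordK; lia.
Qed.

(** In the sampled sum, ordinates that are at least [a] in absolute value contribute at most [W * Q]; the others
   are few, about [a * n / b] for each [q], and the trivial bound [S * Q] suffices there. *)
Theorem resonance :
  \rsum_k (d k * \rsum_(p | reqb (lam p.2) (lam p.1 + theta k)) (f p.1 * f p.2))
  <= (24 * W + 16 * (a / b) * S * INR #|M|) * \rsum_s (f s ^ 2).
Proof.
(* a grid finer than the cells, and with [a * n / b >= 1] *)
pose n := maxn mc (floorN (b / a)).+1.
have Hmn : (mc <= n)%N by rewrite leq_maxl.
have Hn0 : (0 < n)%N by apply: leq_trans Hmn; rewrite /mc.
have Hn : 0 < INR n by apply: lt_0_INR; lia.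
have Hban : b / a <= INR n.
  have Hba : 0 <= b / a by left; apply: Rdiv_lt_0_compat; lra.
  case: (floorNP Hba) => _ H; left; apply: (Rlt_le_trans _ _ _ H); rewrite -S_INR.
  by apply: le_INR; have := leq_maxr mc (floorN (b / a)).+1; rewrite -/n; lia.
pose F2 := \rsum_s (f s ^ 2).
have HF2 : 0 <= F2 by apply: rsum_ge0 => s _; exact: pow2_ge_0.
have HW : 0 <= W by apply: Rle_trans (Rabs_pos _) (DR_le (t := a) _); lra.
have HS : 0 <= S by apply: Rle_trans d_sum; apply: rsum_ge0.
pose B := INR #|M| * F2.
have HB : 0 <= B by apply: Rmult_le_pos => //; exact: pos_INR.
pose Kn := (floorN (a * INR n / b)).+1.
have Han : 1 <= a * INR n / b.
  apply: (Rmult_le_reg_r (b / a)); first by apply: Rdiv_lt_0_compat; lra.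
  by rewrite Rmult_1_l; apply: (Rle_trans _ _ _ Hban); right; field; lra.
have HKn : a * INR n / b < INR Kn <= 2 * (a * INR n / b).
  by rewrite /Kn S_INR; case: (@floorNP (a * INR n / b)); lra.
have Hpt (q p : 'I_n) : DR ((INR p - INR q) * (b / INR n)) * Q ((INR p - INR q) * (b / INR n)) <=
   W * Q ((INR p - INR q) * (b / INR n)) + (if (p < q + Kn)%N && (q < p + Kn)%N then S * B else 0).
  set t := (INR p - INR q) * (b / INR n).
  have HQ := Q_ge0 t.
  have Hif : 0 <= (if (p < q + Kn)%N && (q < p + Kn)%N then S * B else 0).
    by case: ifP => _; [exact: Rmult_le_pos|lra].
  case: (Rle_lt_dec a (Rabs t)) => Ht.
    have : Rabs (DR t) <= W.
      have -> : DR t = DR (Rabs t) by rewrite /Rabs; case: Rcase_abs => // _; rewrite DR_even.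
      apply: DR_le; split => //.
      have Hpq : Rabs (INR p - INR q) <= INR n.
        have := ltn_ord p; have := ltn_ord q => /ltP /lt_INR Hq /ltP /lt_INR Hp.
        have := pos_INR p; have := pos_INR q => ? ?; apply: Rabs_le; lra.
      rewrite /t Rabs_mult (Rabs_pos_eq (b / INR n)); last by left; apply: Rdiv_lt_0_compat; lra.
      have -> : b = INR n * (b / INR n) by field; lra.
      rewrite {1}(_ : INR n * (b / INR n) / INR n = b / INR n); last by field; lra.
      by apply: Rmult_le_compat_r => //; left; apply: Rdiv_lt_0_compat; lra.
    have := Rle_abs (DR t) => H1 H2.
    have : DR t * Q t <= W * Q t by apply: Rmult_le_compat_r => //; lra.
    by lra.
  have Hpq : Rabs (INR p - INR q) < INR Kn.
    apply: Rle_lt_trans (proj1 HKn); left.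
    move: Ht; rewrite /t Rabs_mult (Rabs_pos_eq (b / INR n)); last by left; apply: Rdiv_lt_0_compat; lra.
    move=> Ht; apply: (Rmult_lt_reg_r (b / INR n)); first by apply: Rdiv_lt_0_compat; lra.
    apply: (Rlt_le_trans _ _ _ Ht); right; field; lra.
  have [H1 H2] := Rabs_def2 _ _ Hpq.
  have -> : (p < q + Kn)%N && (q < p + Kn)%N.
    by apply/andP; split; apply/ltP; apply: INR_lt; rewrite -plusE plus_INR; lra.
  have : DR t * Q t <= S * B.
    apply: (Rle_trans _ (S * Q t)).
      by apply: Rmult_le_compat_r => //; apply: Rle_trans (Rle_abs _) (DR_abs t).
    by apply: Rmult_le_compat_l => //; exact: Q_le.
  have : 0 <= W * Q t by exact: Rmult_le_pos.
  by lra.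
have Hup : \rsum_(q : 'I_n) (\rsum_(p : 'I_n) (DR ((INR p - INR q) * (b / INR n)) * Q ((INR p - INR q) * (b / INR n))))
   <= W * (6 * INR n ^ 2 * F2) + INR n * (INR (2 * Kn) * (S * B)).
  apply: (Rle_trans _ (\rsum_(q : 'I_n) (W * (\rsum_(p : 'I_n) Q ((INR p - INR q) * (b / INR n))) + INR (2 * Kn) * (S * B)))).
    apply: rsum_le => q _.
    apply: (Rle_trans _ _ _ (rsum_le (fun p _ => Hpt q p))).
    rewrite rsum_plus -rsum_distrr; apply: Rplus_le_compat_l.
    rewrite -big_mkcond rsum_const_card; apply: Rmult_le_compat_r; first exact: Rmult_le_pos.
    by apply: le_INR; apply/leP; exact: near_card.
  rewrite rsum_plus -rsum_distrr rsum_const_card card_ord; apply: Rplus_le_compat_r.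
  by apply: Rmult_le_compat_l => //; exact: Q_sample.
have Hlow := fejer_sum_lower Hn0.
set Num := (X in X <= _); rewrite -/Num in Hlow.
apply: (Rmult_le_reg_l (INR n ^ 2 / 4)); first by have := pow_lt _ 2 Hn; lra.
apply: (Rle_trans _ _ _ (Rle_trans _ _ _ Hlow Hup)).
rewrite -/F2 (_ : INR (2 * Kn) = 2 * INR Kn); last by rewrite -multE mult_INR.
have : INR n * (2 * INR Kn * (S * B)) <= INR n * (2 * (2 * (a * INR n / b)) * (S * B)).
  apply: Rmult_le_compat_l; first by lra.
  by apply: Rmult_le_compat_r; [exact: Rmult_le_pos|lra].
move=> H; apply: (Rle_trans _ _ _ (Rplus_le_compat_l _ _ _ H)); rewrite /B; right; field; lra.
Qed.
End Resonance.

(** * The resonator: a truncated product measure on exponent vectors *)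

Section Expectation.
Variables (P J : finType) (G : P -> J -> R).

(** The coordinates of a product measure are independent. *)
Lemma coord_sum (h : J -> R) (p0 : P) :
  \rsum_(g : {ffun P -> J}) ((\rprod_p G p (g p)) * h (g p0)) =
  (\rsum_j (G p0 j * h j)) * \big[Rmult/R1]_(p | p != p0) (\rsum_j G p j).
Proof.
pose G' p j := if p == p0 then G p j * h j else G p j.
have -> : (\rsum_j (G p0 j * h j)) * \big[Rmult/R1]_(p | p != p0) (\rsum_j G p j) = \rprod_p (\rsum_j G' p j).
  rewrite [RHS](bigD1 p0) //=; congr Rmult.
    by apply: eq_bigr => j _; rewrite /G' eqxx.
  by apply: eq_bigr => p /negbTE Hp; apply: eq_bigr => j _; rewrite /G' Hp.
rewrite bigA_distr_bigA; apply: eq_bigr => g _.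
rewrite (bigD1 p0) //= [RHS](bigD1 p0) //= {1}/G' eqxx.
have -> : \big[Rmult/R1]_(i | i != p0) G' i (g i) = \big[Rmult/R1]_(i | i != p0) G i (g i).
  by apply: eq_bigr => p /negbTE Hp; rewrite /G' Hp.
ring.
Qed.
End Expectation.

Lemma rprod_ge0 (I : finType) (Q : pred I) (F : I -> R) : (forall i, Q i -> 0 <= F i) -> 0 <= \big[Rmult/R1]_(i | Q i) F i.
Proof. by move=> H; apply: (big_ind (fun x => 0 <= x)) => //; [lra|exact: Rmult_le_pos]. Qed.

Lemma rprod_gt0 (I : finType) (Q : pred I) (F : I -> R) : (forall i, Q i -> 0 < F i) -> 0 < \big[Rmult/R1]_(i | Q i) F i.
Proof. by move=> H; apply: (big_ind (fun x => 0 < x)) => //; [lra|exact: Rmult_lt_0_compat]. Qed.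

Lemma exp_rsum (I : finType) (F : I -> R) : exp (\rsum_i F i) = \rprod_i exp (F i).
Proof. by apply: (big_morph exp); [exact: exp_plus|exact: exp_0]. Qed.

Lemma sum_ord3 (F : 'I_3 -> R) : \rsum_j F j = F ord0 + F (lift ord0 ord0) + F (lift ord0 (lift ord0 ord0)).
Proof. by rewrite !big_ord_recl big_ord0; lra. Qed.

Section Resonator.
Variables (P : finType) (pr : P -> nat) (x c : P -> R) (sigma Theta Lam : R).
Hypothesis pr_inj : injective pr.
Hypothesis pr_prime : forall p, prime (pr p).
Hypothesis x_ge0 : forall p, 0 <= x p.
Hypothesis c_ge0 : forall p, 0 <= c p.
Hypothesis Theta_gt0 : 0 < Theta.
Hypothesis Lam_gt0 : 0 < Lam.

Let lp (p : P) : R := ln (INR (pr p)).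
Let e (p : P) : R := exp (- sigma * lp p).

Let lp_ge0 p : 0 <= lp p.
Proof.
have H := prime_gt1 (pr_prime p).
have H1 : 1 < INR (pr p) by apply: (lt_INR 1); apply/ltP.
by rewrite /lp -ln_1; left; apply: ln_increasing; lra.
Qed.

(** The resonator is centred at exponent [1]: the exponents [0] and [2] are deviations of weight [x p]
   and price [c p]. For a given size of the support, deviations in both directions gain a factor [sqrt 2]
   in the exponent over the exponents [0] and [1] alone. *)
Definition weight (p : P) (j : 'I_3) : R := if nat_of_ord j == 1%N then 1 else x p.
Definition price (p : P) (j : 'I_3) : R := if nat_of_ord j == 1%N then 0 else c p.
Definition cost (s : {ffun P -> 'I_3}) : R := \rsum_p price p (s p).
Definition affordable (s : {ffun P -> 'I_3}) : bool := if Rle_dec (cost s) Theta then true else false.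
Definition rlog (s : {ffun P -> 'I_3}) : R := \rsum_p (INR (s p) * lp p).
Definition rcoef (s : {ffun P -> 'I_3}) : R := if affordable s then \rprod_p weight p (s p) else 0.

Lemma affordableP s : reflect (cost s <= Theta) (affordable s).
Proof. by rewrite /affordable; case: Rle_dec => H; constructor. Qed.

Let weight_ge0 p j : 0 <= weight p j.
Proof. by rewrite /weight; case: ifP => _; [lra|]. Qed.

Let price_ge0 p j : 0 <= price p j.
Proof. by rewrite /price; case: ifP => _; [lra|]. Qed.

Lemma rcoef_ge0 s : 0 <= rcoef s.
Proof. by rewrite /rcoef; case: ifP => _; [apply: rprod_ge0 => p _|lra]. Qed.

Lemma rcoef_supp s : ~~ affordable s -> rcoef s = 0.
Proof. by rewrite /rcoef => /negbTE ->. Qed.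

Definition nval (s : P -> nat) : nat := (\prod_p pr p ^ s p)%N.

Let pr_gt0 p : (0 < pr p)%N. Proof. exact: prime_gt0. Qed.

Lemma ln_nval (s : P -> nat) : ln (INR (nval s)) = \rsum_p (INR (s p) * lp p).
Proof.
have H : INR (nval s) = exp (\rsum_p (INR (s p) * lp p)).
  rewrite exp_rsum /nval; apply: (big_rec2 (fun (a : nat) b => INR a = b)) => [|p a b _ IH]; first by [].
  rewrite -multE mult_INR IH; congr (_ * _).
  have Hp : 0 < INR (pr p) by apply: lt_0_INR; apply/ltP.
  elim: (s p) => [|k IHk]; first by rewrite /= Rmult_0_l exp_0.
  rewrite expnS -multE mult_INR IHk S_INR Rmult_plus_distr_r Rmult_1_l exp_plus.
  by rewrite {2}/lp exp_ln // Rmult_comm.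
by rewrite H ln_exp.
Qed.

Let nval_gt0 s : (0 < nval s)%N.
Proof. by apply: prodn_gt0 => p; rewrite expn_gt0 pr_gt0. Qed.

(** Unique factorization. *)
Lemma rlog_inj : injective rlog.
Proof.
move=> s s' H.
have E : nval (fun p => s p) = nval (fun p => s' p).
  apply: INR_eq; apply: ln_inv; [by apply: lt_0_INR; apply/ltP; exact: nval_gt0|by apply: lt_0_INR; apply/ltP; exact: nval_gt0|].
  by rewrite !ln_nval.
apply/ffunP => p0; apply: val_inj => /=.
have Hlog (u : P -> nat) : logn (pr p0) (nval u) = u p0.
  rewrite /nval.
  have -> : logn (pr p0) (\prod_p pr p ^ u p) = (\sum_p logn (pr p0) (pr p ^ u p))%N.
    suff [_ ->] : (0 < \prod_p pr p ^ u p)%N /\ logn (pr p0) (\prod_p pr p ^ u p) = (\sum_p logn (pr p0) (pr p ^ u p))%N by [].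
    apply: (big_rec2 (fun a b => (0 < a)%N /\ logn (pr p0) a = b)) => [|p a b _ [Ha Hb]]; first by rewrite logn1.
    have Hpp : (0 < pr p ^ u p)%N by rewrite expn_gt0 pr_gt0.
    by split; [rewrite muln_gt0 Hpp|rewrite lognM // Hb].
  rewrite (bigD1 p0) //= lognX logn_prime // eqxx muln1 big1 ?addn0 // => p Hp.
  rewrite lognX logn_prime //; case: (pr p0 =P pr p) => [E'|_]; last by rewrite muln0.
  by rewrite (pr_inj E') eqxx in Hp.
by rewrite -(Hlog (fun p => s p)) E Hlog.
Qed.

Lemma rcoef_sq_sum : \rsum_s (rcoef s ^ 2) <= \rprod_p (1 + 2 * x p ^ 2).
Proof.
have -> : \rprod_p (1 + 2 * x p ^ 2) = \rprod_p (\rsum_(j : 'I_3) (weight p j ^ 2)).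
  by apply: eq_bigr => p _; rewrite sum_ord3 /weight /=; ring.
rewrite bigA_distr_bigA; apply: rsum_le => s _.
rewrite /rcoef; case: ifP => _.
  right; elim/big_rec2: _ => [|p a b _ <-]; first by ring.
  exact: Rpow_mult_distr.
rewrite /= Rmult_0_l; apply: rprod_ge0 => p _.
by apply: Rmult_le_pos; [|rewrite Rmult_1_r].
Qed.

(** Rankin's trick: an affordable vector satisfies [1 <= exp (Theta - cost s)]. *)
Lemma card_affordable : INR #|affordable| <= exp Theta * \rprod_p (1 + 2 * exp (- c p)).
Proof.
have -> : \rprod_p (1 + 2 * exp (- c p)) = \rprod_p (\rsum_(j : 'I_3) exp (- price p j)).
  by apply: eq_bigr => p _; rewrite sum_ord3 /price /= Ropp_0 exp_0; ring.
rewrite bigA_distr_bigA rsum_distrr -[INR _]Rmult_1_r -rsum_const_card.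
apply: (Rle_trans _ (\rsum_(s | affordable s) (exp Theta * \rprod_p exp (- price p (s p))))).
  apply: rsum_le => s /affordableP Hs; rewrite -exp_rsum -exp_plus -exp_0.
  have -> : \rsum_p - price p (s p) = - cost s.
    by rewrite /cost (big_morph Ropp Ropp_plus_distr Ropp_0).
  case: (Req_dec 0 (Theta + - cost s)) => [<-|Hne]; first by lra.
  by left; apply: exp_increasing; lra.
apply: rsum_le_pred => s; apply: Rmult_le_pos; first by left; exact: exp_pos.
by apply: rprod_ge0 => p _; left; exact: exp_pos.
Qed.

Let JJ : finType := ('I_3 * 'I_3)%type.
(** Pairs [(m, n)] of exponents of one prime with [m <= n], weighted by the resonator and by the
   factor [p^(- sigma (n - m))] of a Dirichlet coefficient. *)
Definition pairw (p : P) (j : JJ) : R :=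
  if (j.1 <= j.2)%N then weight p j.1 * weight p j.2 * exp (- sigma * (INR (j.2 - j.1) * lp p)) else 0.
(** An upper bound for the price of either exponent of the pair. *)
Let pair_price (p : P) (j : JJ) : R := if (nat_of_ord j.1 == 1%N) && (nat_of_ord j.2 == 1%N) then 0 else c p.
(** Closed forms: [pair_mass p] is the sum of [pairw p], and [pair_shift p] that of [pairw p] times the
   difference of the exponents. *)
Definition pair_mass (p : P) : R := 1 + 2 * x p ^ 2 + 2 * x p * e p + x p ^ 2 * e p ^ 2.
Definition pair_shift (p : P) : R := 2 * x p * e p + 2 * x p ^ 2 * e p ^ 2.

Let e_gt0 p : 0 < e p. Proof. exact: exp_pos. Qed.

Let pairw_ge0 p j : 0 <= pairw p j.
Proof.
rewrite /pairw; case: ifP => _; last by lra.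
by apply: Rmult_le_pos; [exact: Rmult_le_pos|left; exact: exp_pos].
Qed.

Lemma sum_ord3_pair (F : JJ -> R) : \rsum_j F j = \rsum_(a : 'I_3) (\rsum_(b : 'I_3) F (a, b)).
Proof. by rewrite pair_bigA; apply: eq_bigr => -[]. Qed.

Let exp_lp1 p : exp (- sigma * (1 * lp p)) = e p. Proof. by rewrite Rmult_1_l. Qed.
Let exp_lp2 p : exp (- sigma * ((1 + 1) * lp p)) = e p ^ 2.
Proof. by rewrite /= Rmult_1_r -exp_plus; congr exp; ring. Qed.
Let exp_lp0 p : exp (- sigma * (0 * lp p)) = 1.
Proof. by rewrite Rmult_0_l Rmult_0_r exp_0. Qed.

Lemma pairw_sum p : \rsum_j pairw p j = pair_mass p.
Proof. by rewrite sum_ord3_pair !sum_ord3 /pairw /weight /= exp_lp1 exp_lp2 exp_lp0 /pair_mass /=; ring. Qed.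

Lemma pairw_sum_cost p : \rsum_j (pairw p j * pair_price p j) = (pair_mass p - 1) * c p.
Proof. by rewrite sum_ord3_pair !sum_ord3 /pairw /weight /pair_price /= exp_lp1 exp_lp2 exp_lp0 /pair_mass /=; ring. Qed.

Lemma pairw_sum_log p : \rsum_j (pairw p j * (INR (j.2 - j.1) * lp p)) = pair_shift p * lp p.
Proof. by rewrite sum_ord3_pair !sum_ord3 /pairw /weight /= exp_lp1 exp_lp2 exp_lp0 /pair_shift /=; ring. Qed.

Lemma pairw_sum_diag p : \rsum_j (pairw p j * (if j.1 == j.2 then 1 else 0)) = 1 + 2 * x p ^ 2.
Proof. by rewrite sum_ord3_pair !sum_ord3 /pairw /weight /= exp_lp0 /=; ring. Qed.

Lemma pair_mass_ge1 p : 1 <= pair_mass p.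
Proof.
rewrite /pair_mass; have := pow2_ge_0 (x p); have := pow2_ge_0 (e p).
by have := x_ge0 p; have := e_gt0 p => H1 H2 H3 H4; nra.
Qed.

Let G := {ffun P -> JJ}.
Let s1 (g : G) : {ffun P -> 'I_3} := [ffun p => (g p).1].
Let s2 (g : G) : {ffun P -> 'I_3} := [ffun p => (g p).2].
Let kg (g : G) : nat := nval (fun p => (g p).2 - (g p).1)%N.
Let tot (g : G) : R := \rsum_p pair_price p (g p).
Let lnk (g : G) : R := \rsum_p (INR ((g p).2 - (g p).1) * lp p).
Let W (g : G) : R := \rprod_p pairw p (g p).
Let diag (g : G) : R := \rprod_p (if (g p).1 == (g p).2 then 1 else 0).

Let W_ge0 g : 0 <= W g. Proof. by apply: rprod_ge0 => p _. Qed.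
Let pair_price_ge0 p j : 0 <= pair_price p j. Proof. by rewrite /pair_price; case: ifP => _; [lra|]. Qed.

Let Aprod : R := \rprod_p pair_mass p.

Let coord_le (h : P -> JJ -> R) : (forall p j, 0 <= h p j) ->
  \rsum_g (W g * \rsum_p h p (g p)) <= Aprod * \rsum_p (\rsum_j (pairw p j * h p j)).
Proof.
move=> Hh; under eq_bigr => g _ do rewrite rsum_distrr.
rewrite exchange_big /= rsum_distrr; apply: rsum_le => p0 _.
rewrite /W coord_sum; under [X in _ * X <= _]eq_bigr => p _ do rewrite pairw_sum.
rewrite Rmult_comm; apply: Rmult_le_compat_r.
  by apply: rsum_ge0 => j _; apply: Rmult_le_pos.
set z := (X in X <= _).
have -> : Aprod = pair_mass p0 * z by rewrite /Aprod (bigD1 p0).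
have Hz : 0 <= z by apply: rprod_ge0 => p _; have := pair_mass_ge1 p; lra.
rewrite -[X in X <= _]Rmult_1_l; apply: Rmult_le_compat_r => //; exact: pair_mass_ge1.
Qed.

Let W_sum : \rsum_g W g = Aprod.
Proof. by rewrite /W -bigA_distr_bigA; apply: eq_bigr => p _; exact: pairw_sum. Qed.

Let W_diag : \rsum_g (W g * diag g) = \rprod_p (1 + 2 * x p ^ 2).
Proof.
rewrite /W /diag; under eq_bigr => g _ do rewrite -big_split /=.
rewrite -(bigA_distr_bigA (fun p (j : JJ) => pairw p j * (if j.1 == j.2 then 1 else 0))).
by apply: eq_bigr => p _; exact: pairw_sum_diag.
Qed.

Let lnk_ge0 g : 0 <= lnk g.
Proof. by apply: rsum_ge0 => p _; apply: Rmult_le_pos; [exact: pos_INR|]. Qed.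

Let tot_ge0 g : 0 <= tot g.
Proof. exact: rsum_ge0. Qed.

Let diag_ge0 g : 0 <= diag g.
Proof. by apply: rprod_ge0 => p _; case: ifP => _; lra. Qed.

(** Markov's inequality, for the price and for the logarithm of the quotient of the two integers: pairs that are
   too expensive or too far apart carry only a part of the mass. Diagonal pairs are removed as well, because
   the smoothed coefficient at [1] may vanish. *)
Let good_mass : Aprod * (1 - (\rsum_p (c p * (pair_mass p - 1))) / Theta - (\rsum_p (lp p * pair_shift p)) / Lam)
   - \rprod_p (1 + 2 * x p ^ 2) <= \rsum_g (W g * (1 - tot g / Theta - lnk g / Lam - diag g)).
Proof.
have -> : \rsum_g (W g * (1 - tot g / Theta - lnk g / Lam - diag g)) =
  Aprod - (\rsum_g (W g * tot g)) / Theta - (\rsum_g (W g * lnk g)) / Lam - \rprod_p (1 + 2 * x p ^ 2).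
  rewrite -W_sum -W_diag /Rminus /Rdiv !Ropp_mult_distr_l !(big_morph Ropp Ropp_plus_distr Ropp_0) !rsum_distrl -!rsum_plus.
  by apply: eq_bigr => g _; ring.
have H1 : (\rsum_g (W g * tot g)) <= Aprod * \rsum_p (c p * (pair_mass p - 1)).
  apply: (Rle_trans _ _ _ (coord_le pair_price_ge0)).
  by right; congr Rmult; apply: eq_bigr => p _; rewrite pairw_sum_cost Rmult_comm.
have H2 : (\rsum_g (W g * lnk g)) <= Aprod * \rsum_p (lp p * pair_shift p).
  have Hl p (j : JJ) : 0 <= INR (j.2 - j.1) * lp p by apply: Rmult_le_pos; [exact: pos_INR|].
  apply: (Rle_trans _ _ _ (coord_le Hl)).
  by right; congr Rmult; apply: eq_bigr => p _; rewrite pairw_sum_log Rmult_comm.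
have G1 : (\rsum_g (W g * tot g)) / Theta <= Aprod * (\rsum_p (c p * (pair_mass p - 1))) / Theta.
  by apply: Rmult_le_compat_r => //; left; apply: Rinv_0_lt_compat.
have G2 : (\rsum_g (W g * lnk g)) / Lam <= Aprod * (\rsum_p (lp p * pair_shift p)) / Lam.
  by apply: Rmult_le_compat_r => //; left; apply: Rinv_0_lt_compat.
lra.
Qed.

Section Numerator.
Variables (X : nat) (d : 'I_X.+1 -> R) (D0 : R).
Hypothesis D0_ge0 : 0 <= D0.
Hypothesis d_ge0 : forall k, 0 <= d k.
Hypothesis Lam_X : Lam <= ln (INR X.+1).
Hypothesis d_lower : forall k : 'I_X.+1, (0 < k)%N -> ln (INR k.+1) <= Lam -> D0 * exp (- sigma * ln (INR k.+1)) <= d k.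

Let relk (k : 'I_X.+1) (p : {ffun P -> 'I_3} * {ffun P -> 'I_3}) : bool :=
  reqb (rlog p.2) (rlog p.1 + ln (INR k.+1)).

Let rterm_ge0 g : 0 <= \rsum_(k | relk k (s1 g, s2 g)) (d k * (rcoef (s1 g) * rcoef (s2 g))).
Proof. by apply: rsum_ge0 => k _; apply: Rmult_le_pos => //; apply: Rmult_le_pos; exact: rcoef_ge0. Qed.

(** If the left-hand side is positive, both vectors of [g] are affordable and their integers have a quotient [k]
   with [1 < k] and [ln k <= Lam]: the pair occurs in the resonance sum, with the coefficient [d] at [k]. *)
Let term_lower g : D0 * (W g * (1 - tot g / Theta - lnk g / Lam - diag g)) <=
  \rsum_(k | relk k (s1 g, s2 g)) (d k * (rcoef (s1 g) * rcoef (s2 g))).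
Proof.
have Hr := rterm_ge0 g.
have HW := W_ge0 g; have Ht := tot_ge0 g; have Hl := lnk_ge0 g; have Hd := diag_ge0 g.
have Ht' : 0 <= tot g / Theta by apply: Rmult_le_pos => //; left; apply: Rinv_0_lt_compat.
have Hl' : 0 <= lnk g / Lam by apply: Rmult_le_pos => //; left; apply: Rinv_0_lt_compat.
have Hneg : 1 - tot g / Theta - lnk g / Lam - diag g <= 0 ->
   D0 * (W g * (1 - tot g / Theta - lnk g / Lam - diag g)) <= 0.
  move=> H; have : W g * (1 - tot g / Theta - lnk g / Lam - diag g) <= 0 by nra.
  by move=> H'; nra.
case: (Rle_lt_dec (tot g) Theta) => Htot; last first.
  apply: Rle_trans Hr; apply: Hneg.
  suff : 1 < tot g / Theta by lra.
  by apply: (Rmult_lt_reg_r Theta) => //; rewrite /Rdiv Rmult_assoc Rinv_l; lra.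
case: (Rle_lt_dec (lnk g) Lam) => Hlnk; last first.
  apply: Rle_trans Hr; apply: Hneg.
  suff : 1 < lnk g / Lam by lra.
  by apply: (Rmult_lt_reg_r Lam) => //; rewrite /Rdiv Rmult_assoc Rinv_l; lra.
case: (boolP [forall p, ((g p).1 <= (g p).2)%N]) => [/forallP Hmono|]; last first.
  rewrite negb_forall => /existsP [p0 Hp0].
  have -> : W g = 0 by rewrite /W (bigD1 p0) //= /pairw (negbTE Hp0) Rmult_0_l.
  by rewrite Rmult_0_l Rmult_0_r.
case: (boolP [forall p, (g p).1 == (g p).2]) => [/forallP Hdiag|].
  apply: Rle_trans Hr; apply: Hneg.
  have -> : diag g = 1 by rewrite /diag big1 // => p _; rewrite Hdiag.
  by lra.
rewrite negb_forall => /existsP [p0 Hp0].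
have Hlk : ln (INR (kg g)) = lnk g by exact: ln_nval.
have Hk2 : (1 < kg g)%N.
  rewrite /kg /nval (bigD1 p0) //=; set z := (\prod_(_ | _) _)%N.
  have Hz : (0 < z)%N by apply: prodn_cond_gt0 => p _; rewrite expn_gt0 pr_gt0.
  have Hlt : (0 < (g p0).2 - (g p0).1)%N.
    by rewrite subn_gt0 ltn_neqAle Hmono andbT; exact: Hp0.
  have H1 : (1 < pr p0 ^ ((g p0).2 - (g p0).1))%N.
    by rewrite -{1}(exp1n ((g p0).2 - (g p0).1)) ltn_exp2r // prime_gt1.
  by apply: (leq_trans H1); rewrite leq_pmulr.
have HkX : ((kg g).-1 < X.+1)%N.
  rewrite ltnNge; apply/negP => Hge.
  have : INR X.+1 < INR (kg g) by apply: lt_INR; apply/ltP; lia.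
  move/(ln_increasing _ _ (lt_0_INR _ (Nat.lt_0_succ X))); rewrite Hlk; lra.
have Hkk : (kg g).-1.+1 = kg g by lia.
pose k0 : 'I_X.+1 := Ordinal HkX.
have Ek0 : INR k0.+1 = INR (kg g) by rewrite -[in RHS]Hkk.
have Hrel : relk k0 (s1 g, s2 g).
  apply/reqbP; rewrite Ek0 Hlk /rlog /lnk -rsum_plus; apply: eq_bigr => p _.
  rewrite !ffunE -Rmult_plus_distr_r -plus_INR; congr (INR _ * _).
  by have := Hmono p; rewrite plusE; lia.
have Hok1 : affordable (s1 g).
  apply/affordableP; apply: Rle_trans Htot; apply: rsum_le => p _; rewrite /price /pair_price ffunE.
  case: (nat_of_ord (g p).1 == _) => /=; last by lra.
  by case: ifP => _; [lra|].
have Hok2 : affordable (s2 g).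
  apply/affordableP; apply: Rle_trans Htot; apply: rsum_le => p _; rewrite /price /pair_price ffunE andbC.
  case: (nat_of_ord (g p).2 == _) => /=; last by lra.
  by case: ifP => _; [lra|].
have HWE : W g = exp (- sigma * ln (INR (kg g))) * (rcoef (s1 g) * rcoef (s2 g)).
  rewrite Hlk /rcoef Hok1 Hok2 /lnk rsum_distrr exp_rsum -!big_split; apply: eq_bigr => p _.
  by rewrite /pairw Hmono !ffunE /=; ring.
apply: (Rle_trans _ (d k0 * (rcoef (s1 g) * rcoef (s2 g)))); last first.
  apply: (@rsum_term _ _ (fun k => d k * (rcoef (s1 g) * rcoef (s2 g)))) => // k _.
  by apply: Rmult_le_pos => //; apply: Rmult_le_pos; exact: rcoef_ge0.
have Hff : 0 <= rcoef (s1 g) * rcoef (s2 g) by apply: Rmult_le_pos; exact: rcoef_ge0.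
have Hdk : D0 * exp (- sigma * ln (INR (kg g))) <= d k0.
  have := @d_lower k0; rewrite Ek0 Hlk; apply => //=; lia.
apply: (Rle_trans _ (D0 * W g)).
  by apply: Rmult_le_compat_l => //; nra.
by rewrite HWE -Rmult_assoc; apply: Rmult_le_compat_r.
Qed.

Lemma numerator_lower :
  D0 * (Aprod * (1 - (\rsum_p (c p * (pair_mass p - 1))) / Theta - (\rsum_p (lp p * pair_shift p)) / Lam)
   - \rprod_p (1 + 2 * x p ^ 2)) <=
  \rsum_k (d k * \rsum_(p | relk k p) (rcoef p.1 * rcoef p.2)).
Proof.
apply: (Rle_trans _ (\rsum_g (D0 * (W g * (1 - tot g / Theta - lnk g / Lam - diag g))))).
  by rewrite -rsum_distrr; apply: Rmult_le_compat_l => //; exact: good_mass.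
apply: (Rle_trans _ _ _ (rsum_le (fun g _ => term_lower g))); right.
under [RHS]eq_bigr => k _ do rewrite rsum_distrr big_mkcond /=.
rewrite [RHS]exchange_big /=.
rewrite [RHS](reindex (fun g : G => (s1 g, s2 g))) /=.
  by apply: eq_bigr => g _; rewrite big_mkcond.
exists (fun p : {ffun P -> 'I_3} * {ffun P -> 'I_3} => [ffun q => (p.1 q, p.2 q)]).
- by move=> g _; apply/ffunP => p; rewrite !ffunE; case: (g p).
- by case=> [u v] _; congr pair; apply/ffunP => p; rewrite !ffunE.
Qed.
End Numerator.
End Resonator.

(** * Resonance for the derivatives of zeta *)

Lemma sum_n_big (f : nat -> R) (X : nat) : sum_n f X = \rsum_(k : 'I_X.+1) f k.
Proof.
elim: X => [|X IH]; first by rewrite sum_O big_ord_recr big_ord0 /= Rplus_0_l.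
by rewrite sum_Sn big_ord_recr /= IH.
Qed.

Lemma Re_smooth_poly sigma u J l X t :
  Re (smooth_poly sigma u J l X t) =
  \rsum_(k : 'I_X.+1) (smooth_coef sigma u J l (ln (INR k.+1)) * cos (t * ln (INR k.+1))).
Proof.
rewrite -(sum_n_big (fun k => smooth_coef sigma u J l (ln (INR k.+1)) * cos (t * ln (INR k.+1)))) /smooth_poly.
elim: X => [|X IH].
  by rewrite C_sum_n_0 sum_O; rewrite /wave /Re /Cmult /RtoC /=; ring.
rewrite C_sum_n_S sum_Sn -IH; rewrite {1}/Re /=.
by rewrite /plus /=; congr (_ + _); rewrite Rmult_0_l Rminus_0_r.
Qed.

(** [resonance] for the smoothed polynomial, whose left-hand side is bounded below by
   [numerator_lower]. The factor [exp (- (4 * A * Lam ^ 2 / y))] is the loss in [smooth_coef_lower] for logarithms up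
   to [Lam]. The condition [beta1 + eps + kappa <= 1] keeps the contribution
   [T^(beta1 - 1) T^eps T^kappa] of the small ordinates bounded. *)
Theorem zeta_resonance (zeta : C -> C) (l : nat) (beta beta1 eps kappa : R) :
  is_riemann_zeta zeta -> 0 <= beta < beta1 -> beta1 < 1 -> 0 < eps -> beta1 + eps + kappa <= 1 ->
  exists A, 1 <= A /\ large (fun y => forall (sigma : R) (P : finType) (pr : P -> nat) (x c : P -> R) (Theta Lam V : R),
   1 / 2 <= sigma < 1 -> injective pr -> (forall p, prime (pr p)) -> (forall p, 0 <= x p) -> (forall p, 0 <= c p) ->
   0 < Theta -> 0 < Lam <= y ->
   exp Theta * (\rprod_p (1 + 2 * exp (- c p))) <= exp (kappa * y) ->
   (forall t, exp (beta * y) <= t <= exp y -> Cmod (C_derive_n zeta l (RtoC sigma + Ci * RtoC t)%C) <= V) ->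
   (1 / 4) ^ l * exp (- (4 * A * Lam ^ 2 / y)) *
     ((\rprod_p (pair_mass pr x sigma p / (1 + 2 * x p ^ 2))) *
        (1 - (\rsum_p (c p * (pair_mass pr x sigma p - 1))) / Theta - (\rsum_p (ln (INR (pr p)) * pair_shift pr x sigma p)) / Lam) - 1)
   <= 24 * V + 56).
Proof.
move=> Hz Hb Hb1 He Hk.
have [A [HA HL]] := smooth_poly_le_max zeta l beta beta1 eps Hz Hb He.
exists A; split => //.
have Hy2 := large_pow_exp 2 (1 - beta1) 0 ltac:(lra).
apply: large_imp (large_and _ _ HL Hy2) => y [[u [J [X [HP Hkey]]]] Hy].
move=> sigma P pr x c Theta Lam V Hs pr_inj pr_prime x_ge0 c_ge0 HT HLam Hcard HV.
have [Hsum HD] := Hkey sigma Hs; have {}HD := HD V HV.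
have Hy1 := sp_y _ _ _ _ _ HP; have HX := sp_X1 _ _ _ _ _ HP.
set a := exp (beta1 * y) in HD; set b := exp y / 2 in HD.
have Ha : 0 < a by exact: exp_pos.
have Hab : a <= b.
  rewrite /a /b; have -> : exp y = exp (beta1 * y) * exp ((1 - beta1) * y) by rewrite -exp_plus; congr exp; ring.
  by rewrite /= Rmult_1_r in Hy; have := exp_pos (beta1 * y); nra.
pose d (k : 'I_X.+1) := smooth_coef sigma u J l (ln (INR k.+1)).
have Hth (k : 'I_X.+1) : 0 <= ln (INR k.+1) <= ln (INR X.+1).
  by apply: ln_INR_bounds; have := ltn_ord k; lia.
have d_ge0 k : 0 <= d k by exact: (smooth_coef_nonneg _ _ _ _ _ HP).
have DR_le t : a <= t <= b -> Rabs (\rsum_k (d k * cos (t * ln (INR (nat_of_ord k).+1)))) <= V + 1.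
  by move=> Ht; rewrite /d -Re_smooth_poly; apply: Rle_trans (re_le_Cmod _) (HD t Ht).
have d_sum : \rsum_k d k <= exp (eps * y) by rewrite /d -(sum_n_big (fun k => smooth_coef sigma u J l (ln (INR k.+1)))).
pose M := affordable c Theta.
have HV1 : 0 <= V + 1 by apply: Rle_trans (Rabs_pos _) (DR_le a _); lra.
have Hres := @resonance _ _ M (rcoef x c Theta) (rlog pr) (fun k : 'I_X.+1 => ln (INR k.+1)) d a b (V + 1) (exp (eps * y))
  (rcoef_ge0 c Theta x_ge0) (@rcoef_supp _ x c Theta) (rlog_inj pr_inj pr_prime) d_ge0 (conj Ha Hab) DR_le d_sum.
have HM : INR #|M| <= exp (kappa * y) by apply: Rle_trans Hcard; exact: card_affordable.
have Hab2 : a / b * exp (eps * y) * INR #|M| <= 2.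
  apply: (Rle_trans _ (a / b * exp (eps * y) * exp (kappa * y))).
    apply: Rmult_le_compat_l => //; apply: Rmult_le_pos; last by left; exact: exp_pos.
    by left; apply: Rdiv_lt_0_compat; lra.
  have -> : a / b = 2 * exp (beta1 * y - y).
    by rewrite /a /b /Rminus exp_plus exp_Ropp; field; have := exp_pos y; lra.
  rewrite Rmult_assoc Rmult_assoc -!exp_plus -[X in _ <= X]Rmult_1_r -exp_0.
  by apply: Rmult_le_compat_l; [lra|apply: exp_le_mono; nra].
pose D0 := (1 / 4) ^ l * exp (- (4 * A * Lam ^ 2 / y)).
have HD0 : 0 <= D0 by apply: Rmult_le_pos; [apply: pow_le; lra|left; exact: exp_pos].
have d_lower (k : 'I_X.+1) : (0 < k)%N -> ln (INR k.+1) <= Lam -> D0 * exp (- sigma * ln (INR k.+1)) <= d k.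
  move=> Hk0 HkL.
  have Hln2 : 1 / 2 <= ln (INR k.+1).
    apply: (Rle_trans _ (ln 2)); first by have := ln_lt_2; lra.
    by apply: ln_le_mono; [lra|apply: (le_INR 2); lia].
  have Hlow := smooth_coef_lower _ _ _ _ _ HP sigma (ln (INR k.+1)) l (conj Hln2 (Rle_trans _ _ _ HkL (proj2 HLam))).
  apply: Rle_trans Hlow; rewrite /D0 Rmult_assoc (Rmult_comm (exp _)) -Rmult_assoc.
  apply: Rmult_le_compat_l; first by apply: Rmult_le_pos; [apply: pow_le; lra|left; exact: exp_pos].
  apply: exp_le_mono; apply: Ropp_le_contravar; rewrite /Rdiv.
  apply: Rmult_le_compat_r; first by left; apply: Rinv_0_lt_compat; lra.
  apply: Rmult_le_compat_l; first by lra.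
  by apply: pow_incr; lra.
have HLX : Lam <= ln (INR X.+1) by lra.
have Hnum := numerator_lower pr_prime x_ge0 c_ge0 HT (proj1 HLam) HD0 d_ge0 HLX d_lower.
have Hsq := rcoef_sq_sum c Theta x_ge0.
set F2 := \rsum_s (rcoef x c Theta s ^ 2) in Hres Hsq.
set Pi2 := \rprod_p (1 + 2 * x p ^ 2) in Hnum Hsq.
have HPi2 : 0 < Pi2 by apply: rprod_gt0 => p _; have := pow2_ge_0 (x p); lra.
have -> : \rprod_p (pair_mass pr x sigma p / (1 + 2 * x p ^ 2)) = (\rprod_p pair_mass pr x sigma p) / Pi2.
  apply: (Rmult_eq_reg_r Pi2); last by lra.
  rewrite /Rdiv Rmult_assoc Rinv_l; last by lra.
  rewrite Rmult_1_r /Pi2 -big_split; apply: eq_bigr => p _ /=; field.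
  by have := pow2_ge_0 (x p); rewrite /=; lra.
rewrite -/D0.
apply: (Rmult_le_reg_r Pi2) => //.
apply: (Rle_trans _ ((24 * V + 56) * F2)); last by apply: Rmult_le_compat_l => //; lra.
apply: (Rle_trans _ _ _ _ (Rle_trans _ _ _ (Rle_trans _ _ _ Hnum Hres) _)).
- by right; field; lra.
- apply: Rmult_le_compat_r; first by apply: rsum_ge0 => s _; exact: pow2_ge_0.
  have -> : 16 * (a / b) * exp (eps * y) * INR #|M| = 16 * (a / b * exp (eps * y) * INR #|M|) by ring.
  lra.
Qed.

(** * Estimates of Chebyshev and Mertens *)

Lemma INR_muln m n : INR (m * n)%N = INR m * INR n.
Proof. by rewrite -multE mult_INR. Qed.
Lemma INR_addn m n : INR (m + n)%N = INR m + INR n.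
Proof. by rewrite -plusE plus_INR. Qed.
Lemma INR_leq m n : (m <= n)%N -> INR m <= INR n.
Proof. by move/leP; exact: le_INR. Qed.
Lemma INR_gt0 n : (0 < n)%N -> 0 < INR n.
Proof. by move/ltP; exact: lt_0_INR. Qed.

Lemma INR_prod (I : finType) (P : pred I) (F : I -> nat) :
  INR (\prod_(i | P i) F i) = \big[Rmult/R1]_(i | P i) INR (F i).
Proof. by apply: (big_morph INR) => [m n|]; [exact: INR_muln|]. Qed.

Lemma ln_rprod (I : finType) (P : pred I) (F : I -> R) : (forall i, P i -> 0 < F i) ->
  ln (\big[Rmult/R1]_(i | P i) F i) = \rsum_(i | P i) ln (F i).
Proof.
move=> H.
suff [] : 0 < \big[Rmult/R1]_(i | P i) F i /\ ln (\big[Rmult/R1]_(i | P i) F i) = \rsum_(i | P i) ln (F i) by [].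
apply: (big_rec2 (fun a b => 0 < a /\ ln a = b)) => [|i a b Pi [Ha <-]].
  by split; [lra|exact: ln_1].
by have Fi := H i Pi; split; [exact: Rmult_lt_0_compat|rewrite ln_mult].
Qed.

Lemma INR_expn p k : INR (p ^ k) = INR p ^ k.
Proof. by elim: k => [|k IH] //=; rewrite expnS INR_muln IH. Qed.

Lemma ln_INR_expn p k : (0 < p)%N -> ln (INR (p ^ k)) = INR k * ln (INR p).
Proof. by move=> Hp; rewrite INR_expn ln_pow //; exact: INR_gt0. Qed.

Section Mertens.
(** A common range for all sums over primes, so that they can be compared term by term; their
   values are the same for all sufficiently large [N]. *)
Variable N : nat.

Lemma ln_logn k : (0 < k < N)%N -> ln (INR k) = \rsum_(p : 'I_N | prime p) (INR (logn p k) * ln (INR p)).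
Proof.
move=> Hk.
have E : k = (\prod_(p : 'I_N | prime p) p ^ logn p k)%N.
  have HN : N = N.-1.+1 by lia.
  have := @widen_partn N.-1 predT k ltac:(lia); rewrite partnT; last by lia.
  rewrite -HN big_mkord => {1}->; rewrite [in RHS]big_mkcond; apply: eq_bigr => p _.
  by case: ifP => // Hp; rewrite lognE Hp.
rewrite {1}E INR_prod ln_rprod.
  by apply: eq_bigr => p Hp; rewrite ln_INR_expn // prime_gt0.
by move=> p Hp; apply: INR_gt0; rewrite expn_gt0 prime_gt0.
Qed.

Lemma ln_fact n : (n < N)%N -> ln (INR n`!) = \rsum_(p : 'I_N | prime p) (INR (logn p n`!) * ln (INR p)).
Proof.
elim: n => [|n IH] Hn.
  by rewrite fact0 ln_1 big1 // => p _; rewrite logn1 Rmult_0_l.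
rewrite factS INR_muln ln_mult; [|exact: INR_gt0|exact: INR_gt0 (fact_gt0 n)].
rewrite IH; last by lia.
rewrite ln_logn; last by lia.
rewrite -rsum_plus; apply: eq_bigr => p _; rewrite lognM ?fact_gt0 // INR_addn; ring.
Qed.

Lemma ln_bin m : (2 * m < N)%N -> ln (INR 'C(2 * m, m)) = \rsum_(p : 'I_N | prime p) (INR (logn p 'C(2 * m, m)) * ln (INR p)).
Proof.
move=> Hm.
have Hb : (0 < 'C(2 * m, m))%N by rewrite bin_gt0; lia.
have E := @bin_fact (2 * m) m ltac:(lia).
have E2 : (2 * m - m = m)%N by lia.
rewrite E2 in E.
have H1 := ln_fact Hm; have H2 := @ln_fact m ltac:(lia).
have Hf := fact_gt0 m.
have : ln (INR (2 * m)`!) = ln (INR 'C(2 * m, m)) + 2 * ln (INR m`!).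
  rewrite -E !INR_muln !ln_mult; try exact: INR_gt0; last by apply: Rmult_lt_0_compat; exact: INR_gt0.
  by ring.
move=> H3.
have -> : ln (INR 'C(2 * m, m)) = ln (INR (2 * m)`!) + - (2) * ln (INR m`!) by lra.
rewrite H1 H2 rsum_distrr.
rewrite -rsum_plus; apply: eq_bigr => p _.
rewrite -E !lognM ?muln_gt0 ?Hf ?Hb // !INR_addn; ring.
Qed.

Definition chebyshev (n : nat) : R := \rsum_(p : 'I_N | prime p && (p <= n)%N) ln (INR p).

Let ln_prime_ge0 (p : nat) : prime p -> 0 <= ln (INR p).
Proof. by move=> Hp; apply: ln_nonneg; apply: (INR_leq (m := 1)); exact: prime_gt0. Qed.

Lemma prime_dvd_fact p n : prime p -> (p %| n`!)%N -> (p <= n)%N.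
Proof.
move=> Hp; elim: n => [|n IH]; first by rewrite fact0 dvdn1 => /eqP Hp1; rewrite Hp1 in Hp.
rewrite factS Euclid_dvdM // => /orP[H|/IH]; last by lia.
exact: dvdn_leq.
Qed.

(** The primes between [m] and [2 * m] divide the central binomial coefficient, which is at most [4 ^ m]. *)
Lemma chebyshev_double m : (2 * m < N)%N -> chebyshev (2 * m) <= chebyshev m + 2 * INR m * ln 2.
Proof.
move=> Hm.
have HC : ln (INR 'C(2 * m, m)) <= 2 * INR m * ln 2.
  have -> : 2 * INR m * ln 2 = ln (INR (2 ^ (2 * m))).
    by rewrite ln_INR_expn // INR_muln.
  apply: ln_le_mono; first by apply: INR_gt0; rewrite bin_gt0; lia.
  apply: INR_leq; rewrite (_ : 2 ^ (2 * m) = (1 + 1) ^ (2 * m))%N // expnDn.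
  have Hlt : (m < (2 * m).+1)%N by lia.
  rewrite (bigD1 (Ordinal Hlt)) //= !exp1n !muln1; exact: leq_addr.
apply: (Rle_trans _ (chebyshev m + ln (INR 'C(2 * m, m)))); last by lra.
rewrite ln_bin // /chebyshev.
rewrite (bigID (fun p : 'I_N => (p <= m)%N)) /=; apply: Rplus_le_compat.
  right; apply: eq_bigl => p; lia.
rewrite [X in _ <= X](bigID (fun p : 'I_N => (m < p <= 2 * m)%N)) /=.
apply: (Rle_trans _ (\rsum_(p : 'I_N | prime p && (m < p <= 2 * m)%N) (INR (logn p 'C(2 * m, m)) * ln (INR p)))); last first.
  rewrite -[X in X <= _]Rplus_0_r; apply: Rplus_le_compat_l; apply: rsum_ge0 => p /andP[Hp _].
  by apply: Rmult_le_pos; [exact: pos_INR|exact: ln_prime_ge0].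
have -> : \rsum_(i : 'I_N | prime i && (i <= 2 * m)%N && ~~ (i <= m)%N) ln (INR i) =
  \rsum_(i : 'I_N | prime i && (m < i <= 2 * m)%N) ln (INR i).
  by apply: eq_bigl => p; lia.
apply: rsum_le => p /andP[Hp Hpm].
rewrite -[X in X <= _]Rmult_1_l; apply: Rmult_le_compat_r; first exact: ln_prime_ge0.
apply: (INR_leq (m := 1)); rewrite logn_gt0 mem_primes Hp bin_gt0 /=; apply/andP; split; first by lia.
(* p divides (2m)! but not m! *)
have E := @bin_fact (2 * m) m ltac:(lia).
have : (p %| (2 * m)`!)%N by apply: dvdn_fact; rewrite prime_gt0 //=; lia.
rewrite -E !Euclid_dvdM // => /orP [//|/orP H].
have [/(prime_dvd_fact Hp) H1|/(prime_dvd_fact Hp) H1] := H; lia.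
Qed.

(** Induction by halving. *)
Lemma chebyshev_le n : (n.+1 < N)%N -> chebyshev n <= 4 * INR n * ln 2.
Proof.
have Hl2 := ln_lt_2.
elim/ltn_ind: n => n IH Hn.
case: (ltnP n 3) => Hn3.
  have Hsmall : chebyshev n <= if (1 < n)%N then ln 2 else 0.
    rewrite /chebyshev; case: (boolP (1 < n)%N) => H1.
      have H2N : (2 < N)%N by lia.
      rewrite (bigD1 (Ordinal H2N)) /=; last by lia.
      rewrite big1 => [|p /andP[/andP[Hp Hpn] Hp2]]; first by rewrite Rplus_0_r /= (_ : 1 + 1 = 2); [lra|ring].
      have := prime_gt1 Hp; have : nat_of_ord p != 2%N by apply: contraNneq Hp2 => E; apply/eqP/val_inj.
      by move=> ? ?; exfalso; lia.
    rewrite big1 => [|p /andP[Hp Hpn]]; first by lra.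
    by have := prime_gt1 Hp; rewrite -leqNgt in H1; move=> Hp1; exfalso; lia.
  apply: (Rle_trans _ _ _ Hsmall); case: ifP => H1.
    have : 1 <= INR n by apply: (INR_leq (m := 1)); lia.
    by nra.
  by have := pos_INR n; nra.
pose m := uphalf n.
have Hm : (n <= 2 * m <= n.+1)%N by rewrite /m uphalf_half; have := odd_double_half n; case: (odd n); lia.
have Hmono : chebyshev n <= chebyshev (2 * m).
  rewrite /chebyshev [X in _ <= X](bigID (fun p : 'I_N => (p <= n)%N)) /=.
  apply: (Rle_trans _ (\rsum_(i : 'I_N | prime i && (i <= 2 * m)%N && (i <= n)%N) ln (INR i))).
    by right; apply: eq_bigl => p; lia.
  rewrite -[X in X <= _]Rplus_0_r; apply: Rplus_le_compat_l; apply: rsum_ge0 => p /andP[/andP[Hp _] _].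
  exact: ln_prime_ge0.
have H1 := @chebyshev_double m ltac:(lia).
have H2 := IH m ltac:(lia) ltac:(lia).
have H3 : 2 * INR m <= INR n + 1 by rewrite -S_INR -(INR_muln 2); apply: INR_leq; lia.
have H4 : 3 <= INR n by rewrite (_ : 3 = INR 3); [apply: INR_leq|rewrite /=; lra].
nra.
Qed.

Definition mertens (n : nat) : R := \rsum_(p : 'I_N | prime p && (p <= n)%N) (ln (INR p) / INR p).

Lemma fact_bounds n : (0 < n)%N -> INR n * ln (INR n) - INR n <= ln (INR n`!) <= INR n * ln (INR n).
Proof.
elim: n => [//|n IH] _.
case: (posnP n) => [->|Hn].
  by rewrite (_ : 1`! = 1)%N //= ln_1; lra.
have [H1 H2] := IH Hn.
have Hn0 := INR_gt0 Hn; have HS : 0 < INR n.+1 by exact: INR_gt0.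
rewrite factS INR_muln ln_mult //; last by apply: INR_gt0; exact: fact_gt0.
have Hln : ln (INR n) <= ln (INR n.+1) by apply: ln_le_mono => //; exact: INR_leq.
have Hd : INR n * (ln (INR n.+1) - ln (INR n)) <= 1.
  have : ln (INR n.+1 / INR n) <= INR n.+1 / INR n - 1.
    have Hz : 0 < INR n.+1 / INR n by exact: Rdiv_lt_0_compat.
    by have := exp_ineq1_le (ln (INR n.+1 / INR n)); rewrite exp_ln //; lra.
  rewrite {1}/Rdiv ln_mult //; last exact: Rinv_0_lt_compat.
  rewrite ln_Rinv // => H.
  apply: (Rle_trans _ (INR n * (INR n.+1 / INR n - 1))).
    by apply: Rmult_le_compat_l; lra.
  by right; rewrite S_INR; field; lra.
rewrite S_INR in Hln Hd HS *; split; nra.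
Qed.

Lemma logn_fact_lower p n : prime p -> (p <= n)%N -> INR n / INR p - 1 <= INR (logn p n`!).
Proof.
move=> Hp Hpn; have Hp0 := prime_gt0 Hp.
apply: (Rle_trans _ (INR (n %/ p))).
  have Hlt : INR n <= (INR (n %/ p) + 1) * INR p.
    by rewrite -S_INR -INR_muln; apply: INR_leq; have := ltn_ceil n Hp0; lia.
  have HIp := INR_gt0 Hp0.
  apply: (Rmult_le_reg_r (INR p)) => //.
  have -> : (INR n / INR p - 1) * INR p = INR n - INR p by field; lra.
  lra.
apply: INR_leq; rewrite logn_fact // big_ltn; last by lia.
by rewrite expn1; exact: leq_addr.
Qed.

Lemma logn_fact_upper p n : prime p -> INR (logn p n`!) <= INR n / (INR p - 1).
Proof.
move=> Hp; have Hp1 := prime_gt1 Hp.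
have HIp : 2 <= INR p by apply: (INR_leq (m := 2)).
rewrite logn_fact // big_add1 /=.
have H : forall K, INR (\sum_(0 <= i < K) n %/ p ^ i.+1) <= INR n / (INR p - 1) * (1 - / INR p ^ K).
  elim=> [|K IH]; first by rewrite big_geq //= Rinv_1; lra.
  rewrite big_nat_recr //= INR_addn.
  have Hpk : 0 < INR p ^ K by apply: pow_lt; lra.
  have Hdiv : INR (n %/ p ^ K.+1) <= INR n / (INR p * INR p ^ K).
    apply: (Rmult_le_reg_r (INR p * INR p ^ K)); first by apply: Rmult_lt_0_compat; lra.
    have -> : INR n / (INR p * INR p ^ K) * (INR p * INR p ^ K) = INR n by field; lra.
    rewrite -INR_expn -!INR_muln -expnS; apply: INR_leq; exact: leq_trunc_div.
  apply: (Rle_trans _ _ _ (Rplus_le_compat _ _ _ _ IH Hdiv)); right; field; lra.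
apply: (Rle_trans _ _ _ (H n)).
have Hpk : 0 < / INR p ^ n by apply: Rinv_0_lt_compat; apply: pow_lt; lra.
have Hn := pos_INR n.
have : 0 <= INR n / (INR p - 1) by apply: Rmult_le_pos => //; left; apply: Rinv_0_lt_compat; lra.
nra.
Qed.

(** The factorization of [n!] and [logn p n! >= n / p - 1]; the total correction is bounded by
   [chebyshev_le]. *)
Lemma mertens_upper n : (0 < n)%N -> (n.+1 < N)%N -> mertens n <= ln (INR n) + 4.
Proof.
move=> Hn HnN; have HIn := INR_gt0 Hn.
have [_ Hf] := fact_bounds Hn; rewrite ln_fact in Hf; last by lia.
have Hth := chebyshev_le HnN.
have Hlow : INR n * mertens n - chebyshev n <= \rsum_(p : 'I_N | prime p) (INR (logn p n`!) * ln (INR p)).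
  apply: (Rle_trans _ (\rsum_(p : 'I_N | prime p && (p <= n)%N) (INR (logn p n`!) * ln (INR p)))); last first.
    rewrite [X in _ <= X](bigID (fun p : 'I_N => (p <= n)%N)) /=.
    rewrite -[X in X <= _]Rplus_0_r; apply: Rplus_le_compat_l; apply: rsum_ge0 => p /andP[Hp _].
    by apply: Rmult_le_pos; [exact: pos_INR|exact: ln_prime_ge0].
  rewrite /mertens /chebyshev /Rminus rsum_distrr (big_morph Ropp Ropp_plus_distr Ropp_0) -rsum_plus.
  apply: rsum_le => p /andP[Hp Hpn].
  have HIp := INR_gt0 (prime_gt0 Hp).
  have -> : INR n * (ln (INR p) / INR p) + - ln (INR p) = (INR n / INR p - 1) * ln (INR p) by field; lra.
  by apply: Rmult_le_compat_r; [exact: ln_prime_ge0|exact: logn_fact_lower].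
have Hl2 : ln 2 <= 1.
  have := exp_ineq1_le (ln 2); rewrite exp_ln; lra.
apply: (Rmult_le_reg_l (INR n)) => //.
nra.
Qed.

(** The contribution of higher prime powers, taken over all integers to get a telescoping bound. *)
Let kk_sum n : (0 < n)%N -> (n < N)%N -> \rsum_(p : 'I_N | (1 < p <= n)%N) (ln (INR p) / (INR p * (INR p - 1))) <= 2 - (ln (INR n) + 2) / INR n.
Proof.
elim: n => [//|n IH] _ HN.
case: (posnP n) => [->|Hn].
  rewrite big_pred0; first by rewrite /= ln_1; lra.
  by move=> p; lia.
rewrite (bigD1 (Ordinal HN)) /=; last by lia.
have -> : \rsum_(i : 'I_N | (1 < i <= n.+1)%N && (i != Ordinal HN)) (ln (INR i) / (INR i * (INR i - 1))) =
   \rsum_(i : 'I_N | (1 < i <= n)%N) (ln (INR i) / (INR i * (INR i - 1))).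
  apply: eq_bigl => p; rewrite -(inj_eq val_inj) /=; lia.
have H := IH Hn ltac:(lia).
have HIn := INR_gt0 Hn; have H1 : 1 <= INR n by exact: (INR_leq (m := 1)).
change (match n with 0%N => 1 | S _ => INR n + 1 end) with (INR n.+1).
have Hd : -2 <= INR n.+1 * (ln (INR n) - ln (INR n.+1)).
  have HS : 0 < INR n.+1 by exact: INR_gt0.
  have : ln (INR n.+1 / INR n) <= INR n.+1 / INR n - 1.
    have Hz : 0 < INR n.+1 / INR n by exact: Rdiv_lt_0_compat.
    by have := exp_ineq1_le (ln (INR n.+1 / INR n)); rewrite exp_ln //; lra.
  rewrite {1}/Rdiv ln_mult //; last exact: Rinv_0_lt_compat.
  rewrite ln_Rinv // => H'.
  have : INR n.+1 * (ln (INR n.+1) + - ln (INR n)) <= INR n.+1 * (INR n.+1 / INR n - 1).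
    by apply: Rmult_le_compat_l; lra.
  have -> : INR n.+1 * (INR n.+1 / INR n - 1) = 1 + / INR n by rewrite S_INR; field; lra.
  have : / INR n <= 1 by rewrite -Rinv_1; apply: Rinv_le_contravar; lra.
  by lra.
apply: (Rle_trans _ _ _ (Rplus_le_compat_l _ _ _ H)).
suff : ln (INR n.+1) / (INR n.+1 * (INR n.+1 - 1)) <= (ln (INR n) + 2) / INR n - (ln (INR n.+1) + 2) / INR n.+1 by lra.
rewrite S_INR in Hd *.
have -> : (ln (INR n) + 2) / INR n - (ln (INR n + 1) + 2) / (INR n + 1) =
  (ln (INR n + 1) + (INR n + 1) * (ln (INR n) - ln (INR n + 1)) + 2) / ((INR n + 1) * (INR n + 1 - 1)) by field; lra.
by apply: Rmult_le_compat_r; [left; apply: Rinv_0_lt_compat; nra|lra].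
Qed.

(** The factorization of [n!] and [logn p n! <= n / (p - 1)]; the total correction is bounded by
   [kk_sum]. *)
Lemma mertens_lower n : (0 < n)%N -> (n.+1 < N)%N -> ln (INR n) - 3 <= mertens n.
Proof.
move=> Hn HnN; have HIn := INR_gt0 Hn.
have [Hf _] := fact_bounds Hn; rewrite ln_fact in Hf; last by lia.
have Hup : \rsum_(p : 'I_N | prime p) (INR (logn p n`!) * ln (INR p)) <= INR n * mertens n + INR n * 2.
  apply: (Rle_trans _ (INR n * mertens n + INR n * \rsum_(p : 'I_N | (1 < p <= n)%N) (ln (INR p) / (INR p * (INR p - 1))))).
    rewrite (bigID (fun p : 'I_N => (p <= n)%N)) /= [X in _ + X]big1 ?Rplus_0_r; last first.
      move=> p /andP[Hp Hpn]; have -> : logn p n`! = 0%N; last by rewrite /= Rmult_0_l.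
      by apply/eqP; rewrite -leqn0 leqNgt logn_gt0 mem_primes Hp fact_gt0 /=; apply: contra Hpn; exact: prime_dvd_fact.
    apply: (Rle_trans _ (INR n * mertens n + INR n * \rsum_(p : 'I_N | prime p && (p <= n)%N) (ln (INR p) / (INR p * (INR p - 1))))).
      rewrite /mertens !rsum_distrr -rsum_plus; apply: rsum_le => p /andP[Hp Hpn].
      have HIp : 2 <= INR p by apply: (INR_leq (m := 2)); exact: prime_gt1.
      have -> : INR n * (ln (INR p) / INR p) + INR n * (ln (INR p) / (INR p * (INR p - 1))) = INR n / (INR p - 1) * ln (INR p).
        by field; lra.
      by apply: Rmult_le_compat_r; [exact: ln_prime_ge0|exact: logn_fact_upper].
    apply: Rplus_le_compat_l; apply: Rmult_le_compat_l; first by lra.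
    rewrite [X in _ <= X](bigID (fun p : 'I_N => prime p)) /=.
    apply: (Rle_trans _ (\rsum_(i : 'I_N | (1 < i <= n)%N && prime i) (ln (INR i) / (INR i * (INR i - 1))))).
      right; apply: eq_bigl => p; case: (boolP (prime p)) => Hp; rewrite ?andbF //= andbT.
      by have := prime_gt1 Hp; lia.
    rewrite -[X in X <= _]Rplus_0_r; apply: Rplus_le_compat_l; apply: rsum_ge0 => p /andP[/andP[Hp _] _].
    have HIp : 2 <= INR p by apply: (INR_leq (m := 2)).
    apply: Rmult_le_pos; first by apply: ln_nonneg; lra.
    by left; apply: Rinv_0_lt_compat; nra.
  apply: Rplus_le_compat_l; apply: Rmult_le_compat_l; first by lra.
  apply: (Rle_trans _ _ _ (kk_sum Hn ltac:(lia))).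
  have : 0 <= (ln (INR n) + 2) / INR n.
    have := ln_nonneg (INR n) (INR_leq (m := 1) Hn) => H0.
    by apply: Rmult_le_pos; [lra|left; exact: Rinv_0_lt_compat].
  by lra.
apply: (Rmult_le_reg_l (INR n)) => //.
nra.
Qed.

Lemma mertens_block u v : (0 < u <= v)%N -> (v.+1 < N)%N ->
  ln (INR v) - ln (INR u) - 7 <= \rsum_(p : 'I_N | prime p && (u < p <= v)%N) (ln (INR p) / INR p).
Proof.
move=> Huv HN.
have H1 := @mertens_lower v ltac:(lia) HN; have H2 := @mertens_upper u ltac:(lia) ltac:(lia).
have E : mertens v = mertens u + \rsum_(p : 'I_N | prime p && (u < p <= v)%N) (ln (INR p) / INR p).
  rewrite /mertens (bigID (fun p : 'I_N => (p <= u)%N)) /=.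
  by congr Rplus; apply: eq_bigl => p; lia.
lra.
Qed.
End Mertens.

(** * Primes of an interval *)

Section Window.
Variables (N u v : nat).
Hypothesis HvN : (v.+1 < N)%N.
Hypothesis Huv : (0 < u <= v)%N.

Definition inwin : {pred 'I_N} := fun p => prime p && (u < p <= v)%N.
Definition window : finType := {p : 'I_N | p \in inwin}.
Definition wprime (p : window) : nat := val p.

Lemma wprime_inj : injective wprime.
Proof. by move=> p q H; apply: val_inj; apply: val_inj. Qed.

Lemma wprimeP (p : window) : prime (wprime p) && (u < wprime p <= v)%N.
Proof. exact: (valP p). Qed.

Lemma wprime_prime (p : window) : prime (wprime p).
Proof. by case/andP: (wprimeP p). Qed.

Lemma wprime_gt (p : window) : (u < wprime p)%N.
Proof. by case/andP: (wprimeP p) => _ /andP[]. Qed.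

Lemma wprime_le (p : window) : (wprime p <= v)%N.
Proof. by case/andP: (wprimeP p) => _ /andP[]. Qed.

Lemma win_sum (F : nat -> R) : \rsum_(p : window) F (wprime p) = \rsum_(p : 'I_N | prime p && (u < p <= v)%N) F p.
Proof. by rewrite -(big_sub inwin (fun p : 'I_N => F p)). Qed.

Lemma win_mertens_lower : ln (INR v) - ln (INR u) - 7 <= \rsum_(p : window) (ln (INR (wprime p)) / INR (wprime p)).
Proof. by rewrite (win_sum (fun p => ln (INR p) / INR p)); exact: mertens_block. Qed.

Lemma win_chebyshev : \rsum_(p : window) ln (INR (wprime p)) <= 4 * INR v * ln 2.
Proof.
rewrite (win_sum (fun p => ln (INR p))); apply: Rle_trans (chebyshev_le HvN).
rewrite /chebyshev [X in _ <= X](bigID (fun p : 'I_N => (u < p)%N)) /=.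
apply: (Rle_trans _ (\rsum_(i : 'I_N | prime i && (i <= v)%N && (u < i)%N) ln (INR i))).
  by right; apply: eq_bigl => p; lia.
rewrite -[X in X <= _]Rplus_0_r; apply: Rplus_le_compat_l; apply: rsum_ge0 => p /andP[/andP[Hp _] _].
by apply: ln_nonneg; apply: (INR_leq (m := 1)); exact: prime_gt0.
Qed.

Lemma win_mertens_upper : \rsum_(p : window) (ln (INR (wprime p)) / INR (wprime p)) <= ln (INR v) + 4.
Proof.
rewrite (win_sum (fun p => ln (INR p) / INR p)).
have Hv0 : (0 < v)%N by lia.
apply: Rle_trans (mertens_upper Hv0 HvN).
rewrite /mertens [X in _ <= X](bigID (fun p : 'I_N => (u < p)%N)) /=.
apply: (Rle_trans _ (\rsum_(i : 'I_N | prime i && (i <= v)%N && (u < i)%N) (ln (INR i) / INR i))).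
  by right; apply: eq_bigl => p; lia.
rewrite -[X in X <= _]Rplus_0_r; apply: Rplus_le_compat_l; apply: rsum_ge0 => p /andP[/andP[Hp _] _].
apply: Rmult_le_pos; first by apply: ln_nonneg; apply: (INR_leq (m := 1)); exact: prime_gt0.
by left; apply: Rinv_0_lt_compat; apply: INR_gt0; exact: prime_gt0.
Qed.

Lemma win_card : INR #|window| * ln (INR u) <= 4 * INR v * ln 2.
Proof.
apply: Rle_trans win_chebyshev; rewrite -(rsum_const_card (I := window) predT); apply: rsum_le => p _.
apply: ln_le_mono; first by apply: INR_gt0; lia.
by apply: INR_leq; have := wprime_gt p; lia.
Qed.
End Window.

Lemma large_ln (P : R -> Prop) : large P -> large (fun y => P (ln y)).
Proof.
move=> [a Ha]; exists (exp a) => y Hy; apply: Ha.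
by rewrite -(ln_exp a); apply: ln_le_mono => //; exact: exp_pos.
Qed.

Lemma large_ln_le (C del : R) : 0 < del -> large (fun z => ln z + C <= del * z).
Proof.
move=> Hd; have H := large_and _ _ (large_ge 1) (large_pow_exp (exp C) del 1 Hd).
apply: large_imp H => z [Hz H].
rewrite -(ln_exp (del * z)).
apply: (Rle_trans _ (ln (exp C * z ^ 1))); last by apply: ln_le_mono => //; apply: Rmult_lt_0_compat; [exact: exp_pos|rewrite /=; lra].
by rewrite /= Rmult_1_r ln_mult ?ln_exp; [lra|exact: exp_pos|lra].
Qed.

Lemma rprod_exp_le (I : finType) (F G : I -> R) : (forall i, exp (F i) <= G i) -> exp (\rsum_i F i) <= \rprod_i G i.
Proof.
move=> H; rewrite exp_rsum.
suff [] : 0 <= \rprod_i exp (F i) /\ \rprod_i exp (F i) <= \rprod_i G i by [].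
apply: (big_ind2 (fun a b => 0 <= a /\ a <= b)).
- by split; lra.
- by move=> a1 b1 a2 b2 [? ?] [? ?]; split; [exact: Rmult_le_pos|exact: Rmult_le_compat].
- by move=> i _; split => //; left; exact: exp_pos.
Qed.

Lemma rprod_const (I : finType) (a : R) : \big[Rmult/R1]_(i : I) a = a ^ #|I|.
Proof. by rewrite big_const; elim: #|I| => [|n IH] //=; rewrite IH. Qed.

Lemma ln_2_le1 : ln 2 <= 1.
Proof. by have := exp_ineq1_le (ln 2); rewrite exp_ln; lra. Qed.

Lemma ln_3_le : ln 3 <= 3 / 2.
Proof.
rewrite -(ln_exp (3 / 2)); apply: ln_le_mono; first by lra.
have -> : 3 / 2 = 3 / 4 + 3 / 4 by field.
by rewrite exp_plus; have := exp_ineq1_le (3 / 4); nra.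
Qed.

Lemma exp_le_1p2 z : 0 <= z <= 1 / 2 -> exp z <= 1 + 2 * z.
Proof.
move=> Hz; have H := exp_ineq1_le (- z).
have H2 : exp z * exp (- z) = 1 by rewrite -exp_plus Rplus_opp_r exp_0.
have := exp_pos z; have : (1 + 2 * z) * (1 - z) >= 1 by nra.
nra.
Qed.

(** The slack [exp Z] absorbs all the constants of the resonance inequality. *)
Lemma resonance_finish (D1 del E Y Z V : R) : 0 < D1 <= 1 -> 0 < del <= 1 -> 81 / (D1 * del) <= exp Z ->
  exp (Y + Z) <= E -> D1 * (E * del - 1) <= 24 * V + 56 -> 0 <= Y -> exp Y <= V.
Proof.
move=> HD Hdel HZ HE H HY0.
have HDd : 0 < D1 * del by apply: Rmult_lt_0_compat; lra.
have H1 : 81 <= D1 * del * exp Z.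
  by have := Rmult_le_compat_l _ _ _ (Rlt_le _ _ HDd) HZ; have -> : D1 * del * (81 / (D1 * del)) = 81 by field; lra.
have HeY : 1 <= exp Y by have := exp_ineq1_le Y; lra.
have H2 : 81 * exp Y <= D1 * del * E.
  apply: (Rle_trans _ (D1 * del * (exp Z * exp Y))).
    by rewrite -Rmult_assoc; apply: Rmult_le_compat_r; lra.
  apply: Rmult_le_compat_l; first by lra.
  by rewrite -exp_plus Rplus_comm.
nra.
Qed.

(** * The resonator to the right of the critical line *)

(** The factor [exp (- (18))] bounds [exp (- (9 * r * tau))] from below, as [r * tau <= 2]. With [S] the sum of
   [p^(- sigma)] over the chosen primes, [S >= (1 / tau) * exp (- (18)) * (kappa * y * ln y / 28) ^ tau / (2 * ln y)]
   is at least four times the exponent when [ctilde = exp (- (18)) / (4 * 56)]. *)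
Definition ctilde : R := exp (- (18)) / 224.

Lemma ctilde_gt0 : 0 < ctilde.
Proof. by apply: Rdiv_lt_0_compat; [exact: exp_pos|lra]. Qed.

Section PartB.
Variables (sigma kappa : R).
Hypothesis Hs : 1 / 2 < sigma < 1.
Hypothesis Hk : 0 < kappa < 1.
Let tau := 1 - sigma.
(** The primes are taken in an interval of logarithmic length [9 * r]: by Mertens' estimate the sum of
   [ln p / p] is then at least [r >= 1 / tau], while [p ^ tau] varies by a bounded factor only. *)
Let r : nat := (floorN (1 / tau)).+1.

Let Htau : 0 < tau < 1 / 2. Proof. by rewrite /tau; lra. Qed.

Let r_bounds : 1 / tau <= INR r /\ INR r * tau <= 2 /\ 1 <= INR r.
Proof.
have H0 : 0 <= 1 / tau by apply: Rmult_le_pos; [lra|left; apply: Rinv_0_lt_compat; lra].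
have [H1 H2] := floorNP H0; rewrite /r S_INR; split; first by lra.
have H3 := pos_INR (floorN (1 / tau)).
split; last by lra.
have : (INR (floorN (1 / tau)) + 1) * tau <= (1 / tau + 1) * tau by apply: Rmult_le_compat_r; lra.
have -> : (1 / tau + 1) * tau = 1 + tau by field; lra.
lra.
Qed.

Definition exponentB (y : R) : R :=
  ctilde * Rpower kappa (1 - sigma) / (1 - sigma) * (Rpower y (1 - sigma) / Rpower (ln y) sigma).

Lemma exponentB_large (M : R) : large (fun y => M <= exponentB y).
Proof.
pose c := ctilde * Rpower kappa tau / tau.
have Hc : 0 < c.
  apply: Rdiv_lt_0_compat; last by lra.
  by apply: Rmult_lt_0_compat; [exact: ctilde_gt0|exact: exp_pos].
pose M1 := Rmax M 1 / c.
have HM1 : 0 < M1 by apply: Rdiv_lt_0_compat => //; have := Rmax_r M 1; lra.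
have H := large_and _ _ (large_ln (large_ge 1)) (large_ln (large_ln_le (ln M1) (proj1 Htau))).
apply: large_imp H => y [HL H].
apply: (Rle_trans _ (Rmax M 1)); first exact: Rmax_l.
have -> : Rmax M 1 = c * M1 by rewrite /M1; field; lra.
rewrite /exponentB -/tau -/c; apply: Rmult_le_compat_l; first by lra.
rewrite /Rpower -{1}(exp_ln M1) // /Rdiv -exp_Ropp -exp_plus; apply: exp_le_mono.
have : 0 <= ln (ln y) by apply: ln_nonneg.
nra.
Qed.

(** All weights are [1] and all prices [0]: the support consists of all [3 ^ #|P|] exponent vectors, so [#|P|] can
   be a constant multiple of [kappa * y]. Each prime contributes a factor of about [1 + 2 / 3 * p^(- sigma)]. *)
Theorem partB_window : large (fun y => exists (P : finType) (pr : P -> nat),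
  [/\ injective pr, forall p, prime (pr p),
   exp 1 * (\big[Rmult/R1]_(p : P) (1 + 2 * exp (- 0))) <= exp (kappa * y),
   exp (4 * exponentB y / 3) <= \big[Rmult/R1]_(p : P) (pair_mass pr (fun=> 1) sigma p / (1 + 2 * 1 ^ 2))
   & (\big[Rplus/R0]_(p : P) (ln (INR (pr p)) * pair_shift pr (fun=> 1) sigma p)) / exp (ln y / 2) <= 1 / 2]).
Proof.
have Hlarge := large_and _ _ (large_ln (large_ge (28 / kappa + 18 * INR r + 4)))
  (large_and _ _ (large_ln (large_ln_le (9 * INR r + 5) (del := 1 / 2 - tau) ltac:(lra)))
  (large_and _ _ (large_ge (7 / kappa)) (large_ge 1))).
apply: large_imp Hlarge => y [H1 [H2 [H3 Hy1]]].
have [Hr1 [Hr2 Hr3]] := r_bounds.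
set L := ln y in H1 H2 *.
have HyL : y = exp L by rewrite /L exp_ln; lra.
have H28 : 28 <= 28 / kappa.
  by apply: (Rmult_le_reg_r kappa); [lra|rewrite /Rdiv Rmult_assoc Rinv_l; lra].
have HL1 : 18 * INR r + 32 <= L by lra.
have HkL : 28 <= kappa * L.
  have : 28 / kappa <= L by lra.
  by move/(Rmult_le_compat_l kappa _ _ (Rlt_le _ _ (proj1 Hk))); have -> : kappa * (28 / kappa) = 28 by field; lra.
pose V0 := kappa * y * L / 14.
have HV0 : 2 * y <= V0 by rewrite /V0; nra.
pose v := floorN V0.
have [Hv1 Hv2] : INR v <= V0 < INR v + 1 by apply: floorNP; lra.
have Hvy : y <= INR v by lra.
have Hv0 : V0 / 2 <= INR v by lra.
have HLv : L <= ln (INR v) by rewrite /L; apply: ln_le_mono; lra.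
have HvL : ln (INR v) <= L + ln L.
  rewrite {1}/L -ln_mult; [|lra|lra].
  apply: ln_le_mono; first by lra.
  apply: (Rle_trans _ _ _ Hv1); have HyL0 : 0 < y * L by nra.
  rewrite /V0 (_ : kappa * y * L / 14 = kappa / 14 * (y * L)); last by field.
  rewrite -[X in _ <= X]Rmult_1_l; apply: Rmult_le_compat_r; lra.
have HlnL : ln L <= L.
  by have := exp_ineq1_le (ln L); rewrite exp_ln; lra.
pose z := INR v * exp (- (9 * INR r)).
have Hz : z = exp (ln (INR v) - 9 * INR r) by rewrite /z /Rminus exp_plus exp_ln; lra.
have Hlnz : ln z = ln (INR v) - 9 * INR r by rewrite Hz ln_exp.
have Hz2 : 2 <= z by rewrite Hz; have := exp_ineq1_le (ln (INR v) - 9 * INR r); lra.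
pose u := floorN z.
have [Hu1 Hu2] : INR u <= z < INR u + 1 by apply: floorNP; lra.
have Hzu : z / 2 <= INR u by lra.
have Hu0 : (0 < u)%N.
  by rewrite lt0n; apply/eqP => E; rewrite E /= in Hzu; lra.
have Huv : (0 < u <= v)%N.
  rewrite Hu0; apply/leP; apply: INR_le; apply: (Rle_trans _ _ _ Hu1).
  rewrite -[X in _ <= X]Rmult_1_r; apply: Rmult_le_compat_l; first by lra.
  by rewrite -exp_0; apply: exp_le_mono; lra.
have Hlnu : L / 2 <= ln (INR u).
  apply: (Rle_trans _ (ln (z / 2))); last by apply: ln_le_mono; lra.
  by rewrite ln_div; [rewrite Hlnz; have := ln_2_le1; lra|lra|lra].
have HN : (v.+1 < v.+2)%N by [].
pose P := window v.+2 u v; pose pr := @wprime v.+2 u v.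
have Hcard : INR #|P| <= 8 * kappa * y / 14.
  have := win_card HN Huv; rewrite -/P => Hc.
  have Hc2 : INR #|P| * (L / 2) <= 4 * INR v.
    apply: (Rle_trans _ (INR #|P| * ln (INR u))); first by apply: Rmult_le_compat_l => //; exact: pos_INR.
    apply: (Rle_trans _ _ _ Hc); rewrite -[X in _ <= X]Rmult_1_r.
    by apply: Rmult_le_compat_l; [lra|exact: ln_2_le1].
  apply: (Rmult_le_reg_r (L / 2)); first by lra.
  apply: (Rle_trans _ _ _ Hc2); rewrite /V0 in Hv1.
  have -> : 8 * kappa * y / 14 * (L / 2) = 4 * (kappa * y * L / 14) by field; lra.
  lra.
pose lp (p : P) := ln (INR (pr p)).
pose e (p : P) := exp (- sigma * lp p).
have Hpr_z p : z <= INR (pr p).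
  have : INR u.+1 <= INR (pr p) by apply: INR_leq; exact: wprime_gt.
  by rewrite S_INR; lra.
have Hpr_v p : INR (pr p) <= INR v by apply: INR_leq; exact: wprime_le.
have Hlp p : ln z <= lp p <= ln (INR v).
  by split; apply: ln_le_mono => //; have := Hpr_z p; lra.
have Hlnz0 : 0 < ln z by lra.
have He p : 0 < e p <= 1.
  split; first exact: exp_pos.
  rewrite /e -exp_0; apply: exp_le_mono; have [Ha _] := Hlp p.
  have : 0 <= sigma * lp p by apply: Rmult_le_pos; lra.
  lra.
pose S := \big[Rplus/R0]_(p : P) e p.
have HS : INR r * exp (tau * ln z) / ln (INR v) <= S.
  have Hm := win_mertens_lower HN Huv; rewrite -/P -/pr in Hm.
  have Hlnuz : ln (INR u) <= ln z by apply: ln_le_mono; [exact: INR_gt0|lra].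
  have Hge : INR r <= \big[Rplus/R0]_(p : P) (lp p / INR (pr p)) by apply: Rle_trans Hm; lra.
  apply: (Rle_trans _ ((exp (tau * ln z) / ln (INR v)) * \big[Rplus/R0]_(p : P) (lp p / INR (pr p)))).
    have -> : INR r * exp (tau * ln z) / ln (INR v) = (exp (tau * ln z) / ln (INR v)) * INR r by field; lra.
    apply: Rmult_le_compat_l => //; apply: Rmult_le_pos; first by left; exact: exp_pos.
    by left; apply: Rinv_0_lt_compat; lra.
  rewrite rsum_distrr; apply: rsum_le => p _.
  have Hp0 : 0 < INR (pr p) by have := Hpr_z p; lra.
  have -> : e p = exp (tau * lp p) / INR (pr p).
    rewrite -{1}(exp_ln (INR (pr p))) // /Rdiv -exp_Ropp -exp_plus; congr exp; rewrite -/(lp p) /tau; ring.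
  have [Ha Hb] := Hlp p.
  have -> : exp (tau * ln z) / ln (INR v) * (lp p / INR (pr p)) = (exp (tau * ln z) * (lp p / ln (INR v))) / INR (pr p) by field; lra.
  apply: Rmult_le_compat_r; first by left; exact: Rinv_0_lt_compat.
  rewrite -[X in _ <= X]Rmult_1_r; apply: Rmult_le_compat; first by left; exact: exp_pos.
  - by apply: Rmult_le_pos; [lra|left; apply: Rinv_0_lt_compat; lra].
  - by apply: exp_le_mono; nra.
  - by apply: (Rmult_le_reg_r (ln (INR v))); [lra|rewrite /Rdiv Rmult_assoc Rinv_l; lra].
have HSY : 4 * exponentB y <= S.
  apply: Rle_trans HS.
  have Hz18 : exp (- (18)) * exp (tau * ln (INR v)) <= exp (tau * ln z).
    by rewrite -exp_plus; apply: exp_le_mono; rewrite Hlnz; lra.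
  have Hpv : exp (tau * (ln kappa + L + ln L)) / 28 <= exp (tau * ln (INR v)).
    have -> : exp (tau * (ln kappa + L + ln L)) / 28 = exp (tau * (ln kappa + L + ln L) - ln 28).
      by rewrite /Rminus exp_plus exp_Ropp exp_ln; lra.
    apply: exp_le_mono.
    have HlnV : ln kappa + L + ln L - ln 28 <= ln (INR v).
      apply: (Rle_trans _ (ln (V0 / 2))); last by apply: ln_le_mono; lra.
      right; rewrite /V0 (_ : kappa * y * L / 14 / 2 = kappa * y * L / 28); last by field.
      rewrite ln_div; [|by apply: Rmult_lt_0_compat; [apply: Rmult_lt_0_compat|]; lra|lra].
      by rewrite ln_mult; [rewrite ln_mult; [|lra|lra]|apply: Rmult_lt_0_compat; lra|lra].
    have H28' : 0 <= ln 28 by apply: ln_nonneg; lra.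
    have := Rmult_le_compat_l tau _ _ (Rlt_le _ _ (proj1 Htau)) HlnV.
    have : tau * ln 28 <= 1 * ln 28 by apply: Rmult_le_compat_r; lra.
    lra.
  have EB : exponentB y = ctilde / tau * (exp (tau * (ln kappa + L + ln L)) / L).
    rewrite /exponentB -/tau /Rpower -/L.
    have -> : exp (tau * (ln kappa + L + ln L)) / L = exp (tau * ln kappa) * (exp (tau * L) / exp (sigma * ln L)).
      rewrite -{3}(exp_ln L); last by lra.
      rewrite /Rdiv -!exp_Ropp -!exp_plus; congr exp; rewrite /tau; ring.
    by field; split; [have := exp_pos (sigma * ln L); lra|lra].
  rewrite EB /ctilde.
  apply: (Rle_trans _ ((1 / tau) * (exp (- (18)) * (exp (tau * (ln kappa + L + ln L)) / 28)) / (2 * L))).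
    by right; field; lra.
  have G0 : 0 < exp (tau * (ln kappa + L + ln L)) / 28 by apply: Rdiv_lt_0_compat; [exact: exp_pos|lra].
  have G1 : 0 < exp (- (18)) by exact: exp_pos.
  have G2 : 0 < 1 / tau by apply: Rdiv_lt_0_compat; lra.
  apply: Rmult_le_compat.
  - by apply: Rmult_le_pos; [lra|apply: Rmult_le_pos; lra].
  - by left; apply: Rinv_0_lt_compat; lra.
  - apply: Rmult_le_compat; [lra|apply: Rmult_le_pos; lra|exact: Hr1|].
    by apply: Rle_trans Hz18; apply: Rmult_le_compat_l; lra.
  - by apply: Rinv_le_contravar; lra.
exists P, pr; split; [exact: wprime_inj|exact: wprime_prime| | |].
- rewrite rprod_const Ropp_0 exp_0 (_ : 1 + 2 * 1 = 3); last by ring.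
  rewrite -{1}(exp_ln 3); last by lra.
  rewrite exp_pow -exp_plus; apply: exp_le_mono.
  have H3c : INR #|P| * ln 3 <= 8 * kappa * y / 14 * (3 / 2).
    by apply: Rmult_le_compat => //; [exact: pos_INR|apply: ln_nonneg; lra|exact: ln_3_le].
  have : 7 <= kappa * y.
    by have := Rmult_le_compat_l kappa _ _ (Rlt_le _ _ (proj1 Hk)) H3; have -> : kappa * (7 / kappa) = 7 by field; lra.
  lra.
- apply: (Rle_trans _ (exp (\big[Rplus/R0]_(p : P) (e p / 3)))).
    have -> : \big[Rplus/R0]_(p : P) (e p / 3) = S / 3 by rewrite /S /Rdiv rsum_distrl.
    by apply: exp_le_mono; lra.
  apply: rprod_exp_le => p; have := He p => Hep.
  have Hez : 0 <= e p / 3 <= 1 / 2 by lra.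
  apply: (Rle_trans _ _ _ (exp_le_1p2 Hez)).
  rewrite /pair_mass -/(lp p) -/(e p); have := pow2_ge_0 (e p) => Hep2.
  have -> : (1 + 2 * 1 ^ 2 + 2 * 1 * e p + 1 ^ 2 * e p ^ 2) / (1 + 2 * 1 ^ 2) = 1 + 2 * (e p / 3) + e p ^ 2 / 3 by field.
  lra.
- have HB : \big[Rplus/R0]_(p : P) (lp p * pair_shift pr (fun=> 1) sigma p) <= 16 * exp (9 * INR r) * exp (tau * ln (INR v)).
    apply: (Rle_trans _ (4 * exp (- sigma * ln z) * \big[Rplus/R0]_(p : P) lp p)).
      rewrite rsum_distrr; apply: rsum_le => p _; rewrite Rmult_comm.
      have [Ha Hb] := Hlp p; apply: Rmult_le_compat_r; first by lra.
      rewrite /pair_shift -/(lp p) -/(e p); have Hep := He p.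
      have : e p <= exp (- sigma * ln z).
        apply: exp_le_mono; rewrite -!Ropp_mult_distr_l; apply: Ropp_le_contravar.
        by apply: Rmult_le_compat_l; lra.
      rewrite /=; nra.
    have Hth := win_chebyshev HN Huv; rewrite -/P -/pr in Hth.
    have Hez : 0 < exp (- sigma * ln z) by exact: exp_pos.
    apply: (Rle_trans _ (4 * exp (- sigma * ln z) * (4 * INR v))).
      apply: Rmult_le_compat_l; first by lra.
      apply: (Rle_trans _ _ _ Hth); rewrite -[X in _ <= X]Rmult_1_r.
      by apply: Rmult_le_compat_l; [lra|exact: ln_2_le1].
    rewrite -{1}(exp_ln (INR v)); last by lra.
    have -> : 4 * exp (- sigma * ln z) * (4 * exp (ln (INR v))) = 16 * exp (- sigma * ln z + ln (INR v)) by rewrite exp_plus; ring.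
    rewrite Rmult_assoc -exp_plus; apply: Rmult_le_compat_l; first by lra.
    have Hsr : sigma * INR r <= 1 * INR r by apply: Rmult_le_compat_r; lra.
    by apply: exp_le_mono; rewrite Hlnz /tau; lra.
  apply: (Rmult_le_reg_r (exp (L / 2))); first exact: exp_pos.
  have HeL := exp_pos (L / 2).
  rewrite /Rdiv Rmult_assoc Rinv_l; last by lra.
  rewrite Rmult_1_r; apply: (Rle_trans _ _ _ HB).
  have H32 : 32 <= exp 5.
    by have := exp_pow 1 5; have := exp_ineq1_le 1; rewrite (_ : INR 5 * 1 = 5); [move=> Ha <-; have := pow_incr 2 (exp 1) 5 ltac:(lra); lra|rewrite /=; ring].
  have Hfin : exp 5 * (exp (9 * INR r) * exp (tau * ln (INR v))) <= exp (L / 2).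
    rewrite -!exp_plus; apply: exp_le_mono.
    have HlnL0 : 0 <= ln L by apply: ln_nonneg; lra.
    have T1 : tau * ln (INR v) <= tau * (L + ln L) by apply: Rmult_le_compat_l; lra.
    have T2 : tau * ln L <= 1 * ln L by apply: Rmult_le_compat_r; lra.
    lra.
  have : 0 < exp (9 * INR r) * exp (tau * ln (INR v)) by apply: Rmult_lt_0_compat; exact: exp_pos.
  rewrite Rmult_assoc => Hq.
  have := Rmult_le_compat_r _ _ _ (Rlt_le _ _ Hq) H32; lra.
Qed.
End PartB.

(** * The resonator on the critical line *)

(** With [L = ln y], the primes between [y * exp (i0 * h)] and [y * exp (i1 * h) <= y ^ (1 + del)] are cut into
   blocks at the points [grid i], close to [y * exp (i * h)]. On a block [ln p - L] is about [i * h], and Mertens'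
   estimate gives mass at least [h - 8 = (1 - del) * h]. Summing [1 / i] over the blocks produces the iterated
   logarithm. *)
Section WindowSum.
Variables (L h del : R) (i0 i1 : nat).
Hypothesis Hdel : 0 < del < 1 / 20.
Hypothesis Hh : h = 8 / del.
Hypothesis HL : 1 <= L.
Hypothesis Hi0 : (0 < i0 <= i1)%N.
Hypothesis Hi1 : INR i1 * h <= del * L.

Definition grid (i : nat) : nat := floorN (exp (L + INR i * h)).

Let h_ge : 160 <= h.
Proof.
rewrite Hh; apply: (Rmult_le_reg_r del); first by lra.
by rewrite /Rdiv Rmult_assoc Rinv_l; lra.
Qed.

Lemma grid_bounds i : INR (grid i) <= exp (L + INR i * h) < INR (grid i) + 1.
Proof. by apply: floorNP; left; exact: exp_pos. Qed.

Let exp_ge2 i : 2 <= exp (L + INR i * h).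
Proof.
have := exp_ineq1_le (L + INR i * h); have := Rmult_le_pos _ _ (pos_INR i) (_ : 0 <= h); lra.
Qed.

Lemma grid_gt0 i : (0 < grid i)%N.
Proof.
rewrite lt0n; apply/eqP => E; have := grid_bounds i; rewrite E /=; have := exp_ge2 i; lra.
Qed.

Lemma ln_grid i : L + INR i * h - 1 <= ln (INR (grid i)) <= L + INR i * h.
Proof.
have [H1 H2] := grid_bounds i; have H3 := exp_ge2 i; have H4 := INR_gt0 (grid_gt0 i).
split; last by rewrite -[X in _ <= X]ln_exp; apply: ln_le_mono.
have : ln (exp (L + INR i * h) / 2) <= ln (INR (grid i)) by apply: ln_le_mono; lra.
rewrite ln_div; [|exact: exp_pos|lra].
by rewrite ln_exp; have := ln_2_le1; lra.
Qed.

Lemma grid_mono i j : (i <= j)%N -> (grid i <= grid j)%N.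
Proof.
move=> Hij; rewrite -ltnS; apply/ltP; apply: INR_lt; rewrite S_INR.
have [H1 _] := grid_bounds i; have [_ H2] := grid_bounds j.
apply: (Rle_lt_trans _ _ _ H1); apply: (Rle_lt_trans _ _ _ _ H2); apply: exp_le_mono.
by have := Rmult_le_compat_r h _ _ _ (INR_leq Hij); lra.
Qed.

Lemma gt_grid i p : (grid i < p)%N -> L + INR i * h <= ln (INR p).
Proof.
move=> Hp; rewrite -(ln_exp (L + INR i * h)); apply: ln_le_mono; first exact: exp_pos.
have [_ H] := grid_bounds i; have : INR (grid i).+1 <= INR p by exact: INR_leq.
by rewrite S_INR; lra.
Qed.

Lemma le_grid i p : (0 < p)%N -> (p <= grid i)%N -> ln (INR p) <= L + INR i * h.
Proof.
move=> Hp Hpi; apply: Rle_trans (proj2 (ln_grid i)); apply: ln_le_mono; first exact: INR_gt0.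
exact: INR_leq.
Qed.

Variable N : nat.
Hypothesis HN : ((grid i1).+1 < N)%N.

Let w (p : nat) : R := / (INR p * (ln (INR p) - L)).

Let block_lower i : (i0 <= i < i1)%N ->
  (1 - del) / ((1 + del) * L * (INR i + 1)) <= \rsum_(p : 'I_N | prime p && (grid i < p <= grid i.+1)%N) w p.
Proof.
move=> Hi.
have Huv : (0 < grid i <= grid i.+1)%N by rewrite grid_gt0 grid_mono.
have HvN : ((grid i.+1).+1 < N)%N by have := @grid_mono i.+1 i1 ltac:(lia); lia.
have Hm := mertens_block Huv HvN.
have Hi' : INR i + 1 <= INR i1 by rewrite -S_INR; apply: INR_leq; lia.
have Hi1' : 1 <= INR i by apply: (INR_leq (m := 1)); lia.
have Hmass : (1 - del) * h <= \rsum_(p : 'I_N | prime p && (grid i < p <= grid i.+1)%N) (ln (INR p) / INR p).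
  apply: Rle_trans Hm; have [_ H1] := ln_grid i; have [H2 _] := ln_grid i.+1.
  rewrite S_INR in H2; have : del * h = 8 by rewrite Hh; field; lra.
  lra.
have Hih : 0 < INR i * h by apply: Rmult_lt_0_compat; lra.
have Hih1 : (INR i + 1) * h <= del * L by apply: Rle_trans Hi1; apply: Rmult_le_compat_r; lra.
have Hden : 0 < (1 + del) * L * ((INR i + 1) * h) by apply: Rmult_lt_0_compat; [nra|lra].
apply: (Rle_trans _ (/ ((1 + del) * L * ((INR i + 1) * h)) * \rsum_(p : 'I_N | prime p && (grid i < p <= grid i.+1)%N) (ln (INR p) / INR p))).
  have -> : (1 - del) / ((1 + del) * L * (INR i + 1)) = / ((1 + del) * L * ((INR i + 1) * h)) * ((1 - del) * h) by field; lra.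
  by apply: Rmult_le_compat_l => //; left; exact: Rinv_0_lt_compat.
rewrite rsum_distrr; apply: rsum_le => p /andP[Hp /andP[Hp1 Hp2]].
have Hp0 := prime_gt0 Hp; have HIp := INR_gt0 Hp0.
have G1 := gt_grid Hp1; have G2 := le_grid Hp0 Hp2; rewrite S_INR in G2.
have Hk : 0 < ln (INR p) - L by lra.
have -> : / ((1 + del) * L * ((INR i + 1) * h)) * (ln (INR p) / INR p) =
  (ln (INR p) / ((1 + del) * L)) * ((ln (INR p) - L) / ((INR i + 1) * h)) * w p.
  by rewrite /w; field; repeat split; lra.
have Hw : 0 <= w p by left; apply: Rinv_0_lt_compat; exact: Rmult_lt_0_compat.
have Hq (a b : R) : 0 <= a -> 0 < b -> a <= b -> 0 <= a / b <= 1.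
  move=> Ha Hb Hab; split; first by apply: Rmult_le_pos => //; left; exact: Rinv_0_lt_compat.
  by apply: (Rmult_le_reg_r b) => //; rewrite /Rdiv Rmult_assoc Rinv_l; lra.
have F1 := Hq (ln (INR p)) ((1 + del) * L) ltac:(lra) ltac:(nra) ltac:(lra).
have F2 := Hq (ln (INR p) - L) ((INR i + 1) * h) ltac:(lra) ltac:(nra) ltac:(lra).
rewrite -[X in _ <= X]Rmult_1_l; apply: Rmult_le_compat_r => //.
by apply: (Rle_trans _ (1 * 1)); [apply: Rmult_le_compat; lra|lra].
Qed.

Let sum_upto j : (i0 <= j <= i1)%N ->
  (1 - del) / ((1 + del) * L) * (ln (INR j + 1) - ln (INR i0 + 1)) <=
  \rsum_(p : 'I_N | prime p && (grid i0 < p <= grid j)%N) w p.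
Proof.
elim: j => [|j IH] Hj; first by exfalso; lia.
have Hc : 0 <= (1 - del) / ((1 + del) * L).
  by apply: Rmult_le_pos; [lra|left; apply: Rinv_0_lt_compat; nra].
case: (ltnP i0 j.+1) => Hij; last first.
  have -> : j.+1 = i0 by lia.
  rewrite Rminus_diag Rmult_0_r; right; rewrite big_pred0 // => p; lia.
have H1 := IH ltac:(lia); have H2 := @block_lower j ltac:(lia).
have -> : \rsum_(p : 'I_N | prime p && (grid i0 < p <= grid j.+1)%N) w p =
  \rsum_(p : 'I_N | prime p && (grid i0 < p <= grid j)%N) w p + \rsum_(p : 'I_N | prime p && (grid j < p <= grid j.+1)%N) w p.
  rewrite (bigID (fun p : 'I_N => (p <= grid j)%N)) /=.
  have M1 := @grid_mono i0 j ltac:(lia); have M2 := @grid_mono j j.+1 ltac:(lia).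
  by congr Rplus; apply: eq_bigl => p; lia.
have Hj0 := pos_INR j.
have Hln : ln (INR j.+1 + 1) - ln (INR j + 1) <= / (INR j + 1).
  rewrite -ln_div; [|rewrite S_INR; lra|lra].
  have Hz : 0 < (INR j.+1 + 1) / (INR j + 1) by rewrite S_INR; apply: Rdiv_lt_0_compat; lra.
  have := exp_ineq1_le (ln ((INR j.+1 + 1) / (INR j + 1))); rewrite exp_ln //.
  have -> : (INR j.+1 + 1) / (INR j + 1) = 1 + / (INR j + 1) by rewrite S_INR; field; lra.
  lra.
have Hb : (1 - del) / ((1 + del) * L) * (ln (INR j.+1 + 1) - ln (INR j + 1)) <= (1 - del) / ((1 + del) * L * (INR j + 1)).
  have -> : (1 - del) / ((1 + del) * L * (INR j + 1)) = (1 - del) / ((1 + del) * L) * / (INR j + 1) by field; lra.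
  exact: Rmult_le_compat_l.
lra.
Qed.

Lemma window_sum_lower :
  (1 - del) / ((1 + del) * L) * (ln (INR i1 + 1) - ln (INR i0 + 1)) <=
  \rsum_(p : window N (grid i0) (grid i1)) (/ (INR (wprime p) * (ln (INR (wprime p)) - L))).
Proof. by rewrite (win_sum _ _ _ w); apply: sum_upto; lia. Qed.
End WindowSum.

Lemma large_up (Q : R -> Prop) : large Q -> large (fun z => forall k, z <= k -> Q k).
Proof. by move=> [a Ha]; exists a => z Hz k Hk; apply: Ha; lra. Qed.

(** Here [y = ln T], [L = ln ln T] and [z = ln ln ln T]. A deviation at [p] has price about [ln p - L].
   The weights [weightA p = lam / (sqrt p * (ln p - L))] maximise the first-order gain, the sum of
   [2 * x p / sqrt p], under the budget [rho * kappa * y] for the mean price, the sum of [2 * x p ^ 2 * (ln p - L)]; the budget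
   determines [lam]. *)
Section SqrtResonator.
Variables (y L z del kappa k0 : R) (P : finType) (pr : P -> nat).
Hypothesis Hdel : 0 < del < 1 / 20.
Hypothesis Hkap : 0 < kappa < 1.
Let rho : R := 1 - 6 * del.
Hypothesis HyL : y = exp L.
Hypothesis Hy : 4 / del <= y.
Hypothesis HL : 4 <= L.
Hypothesis Hz : 2 <= z.
Hypothesis HLy : 49 * L <= (del * kappa) ^ 2 * y.
Hypothesis Hk0 : 8 / del <= k0.
Hypothesis HLk0 : L <= exp k0.
Hypothesis Hlnk : forall k, k0 <= k -> ln k - ln (rho * kappa / 2) / 2 <= del / 2 * k.
Hypothesis Hpr : forall p, prime (pr p).
Let k (p : P) : R := ln (INR (pr p)) - L.
Let w (p : P) : R := / (INR (pr p) * k p).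
Let S : R := \rsum_p w p.
Hypothesis Hlo : forall p, k0 <= k p.
Hypothesis Hhi : forall p, ln (INR (pr p)) <= 2 * L.
Hypothesis HS : (1 - 3 * del) * (z / L) <= S.
Hypothesis HM : \rsum_p (ln (INR (pr p)) / INR (pr p)) <= 3 * L.

Let k0_ge : 160 <= k0.
Proof.
apply: Rle_trans Hk0; apply: (Rmult_le_reg_r del); first by lra.
by rewrite /Rdiv Rmult_assoc Rinv_l; lra.
Qed.

Let y_gt0 : 0 < y. Proof. by rewrite HyL; exact: exp_pos. Qed.

Let pr_gt0 p : 0 < INR (pr p). Proof. by apply: INR_gt0; exact: prime_gt0. Qed.

Let pr_exp p : INR (pr p) = y * exp (k p).
Proof. by rewrite HyL -exp_plus /k Rplus_minus exp_ln. Qed.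

Let k_ge p : 160 <= k p. Proof. by have := Hlo p; lra. Qed.

Let w_gt0 p : 0 < w p.
Proof. by apply: Rinv_0_lt_compat; apply: Rmult_lt_0_compat; [exact: pr_gt0|have := k_ge p; lra]. Qed.

Let pinv p : / INR (pr p) = k p * w p.
Proof. by rewrite /w; field; have := k_ge p; have := pr_gt0 p; lra. Qed.

Let pr_ge_y p : y <= INR (pr p).
Proof.
rewrite pr_exp -{1}(Rmult_1_r y); apply: Rmult_le_compat_l; first by lra.
by have := exp_ineq1_le (k p); have := k_ge p; lra.
Qed.

Let pinv_small p : 0 < / INR (pr p) <= del / 4.
Proof.
split; first exact: Rinv_0_lt_compat.
have -> : del / 4 = / (4 / del) by field; lra.
apply: Rinv_le_contravar; last by apply: Rle_trans (pr_ge_y p).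
by apply: Rdiv_lt_0_compat; lra.
Qed.

Let pinv_sum : \rsum_p / INR (pr p) <= 3.
Proof.
apply: (Rmult_le_reg_l L); first by lra.
rewrite rsum_distrr (Rmult_comm L 3); apply: Rle_trans HM; apply: rsum_le => p _.
apply: Rmult_le_compat_r; first by left; exact: (proj1 (pinv_small p)).
by have := k_ge p; rewrite /k; lra.
Qed.

Let S_bounds : 0 < S <= 1.
Proof.
split.
  apply: Rlt_le_trans HS; apply: Rmult_lt_0_compat; first by lra.
  by apply: Rdiv_lt_0_compat; lra.
apply: (Rle_trans _ ((\rsum_p / INR (pr p)) / 3)).
  rewrite /Rdiv rsum_distrl; apply: rsum_le => p _.
  rewrite pinv; have H1 := w_gt0 p; have H2 := k_ge p.
  by have := Rmult_le_compat_r (w p) _ _ ltac:(lra) H2; lra.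
by have := pinv_sum; lra.
Qed.

Let rho_b : 7 / 10 <= rho <= 1. Proof. by rewrite /rho; lra. Qed.

Let lam2 : R := rho * kappa * y / (2 * S).
Let lam : R := sqrt lam2.

Let rky : 0 < rho * kappa * y.
Proof. by apply: Rmult_lt_0_compat => //; apply: Rmult_lt_0_compat; lra. Qed.

Let lam2S : lam2 * S = rho * kappa * y / 2.
Proof. by rewrite /lam2; field; lra. Qed.

Let lam2_lo : rho * kappa / 2 * y <= lam2.
Proof.
have Hl : 0 < lam2 by apply: Rdiv_lt_0_compat; lra.
have : lam2 * S <= lam2 * 1 by apply: Rmult_le_compat_l; lra.
lra.
Qed.

Let lam2_gt0 : 0 < lam2.
Proof. by apply: Rdiv_lt_0_compat; lra. Qed.

Let lam_sq : lam ^ 2 = lam2. Proof. by apply: pow2_sqrt; lra. Qed.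
Let lam_gt0 : 0 < lam. Proof. exact: sqrt_lt_R0. Qed.

Let lam2_hi : lam2 <= y * L.
Proof.
apply: (Rmult_le_reg_r S); first by lra.
rewrite lam2S.
have H1 : 1 / L <= S.
  apply: Rle_trans HS; rewrite /Rdiv -Rmult_assoc; apply: Rmult_le_compat_r; last by nra.
  by left; apply: Rinv_0_lt_compat; lra.
have H2 : y * L * (1 / L) <= y * L * S by apply: Rmult_le_compat_l => //; apply: Rmult_le_pos; lra.
have -> : rho * kappa * y / 2 = (rho * kappa) * (y / 2) by field.
have : (rho * kappa) * (y / 2) <= 1 * (y / 2) by apply: Rmult_le_compat_r; [lra|nra].
have E : y * L * (1 / L) = y by field; lra.
lra.
Qed.

Let e (p : P) : R := exp (- (1 / 2) * ln (INR (pr p))).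
Let e_gt0 p : 0 < e p. Proof. exact: exp_pos. Qed.
Let e_sq p : e p ^ 2 = / INR (pr p).
Proof.
rewrite /e exp_pow (_ : INR 2 * _ = - ln (INR (pr p))); last by rewrite /=; field.
by rewrite exp_Ropp exp_ln.
Qed.

Definition weightA (p : P) : R := lam * e p / k p.
(** With this price [exp (- c p)] is [x p ^ 2], so that Rankin's bound is governed by the same sum as
   the norm of the resonator. *)
Definition priceA (p : P) : R := - ln (weightA p ^ 2).

Let weightA_gt0 p : 0 < weightA p.
Proof. by apply: Rdiv_lt_0_compat; [apply: Rmult_lt_0_compat => //; exact: e_gt0|have := k_ge p; lra]. Qed.

Let xe p : weightA p * e p = lam * w p.
Proof.
have H : weightA p * e p = lam / k p * e p ^ 2 by rewrite /weightA; field; have := k_ge p; lra.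
by rewrite H e_sq /w; field; have := k_ge p; have := pr_gt0 p; lra.
Qed.

Let x2 p : weightA p ^ 2 = lam2 * w p / k p.
Proof.
have -> : weightA p ^ 2 = lam ^ 2 * e p ^ 2 / k p ^ 2 by rewrite /weightA; field; have := k_ge p; lra.
by rewrite lam_sq e_sq /w; field; have := k_ge p; have := pr_gt0 p; lra.
Qed.

Let x2_small p : 0 < weightA p ^ 2 <= del / 4.
Proof.
split; first exact: pow_lt.
rewrite x2.
have Hk1 := k_ge p; have Hk2 := Hlo p.
have Hp : y * L <= INR (pr p).
  rewrite pr_exp; apply: Rmult_le_compat_l; first by lra.
  by apply: Rle_trans HLk0 _; apply: exp_le_mono.
have -> : lam2 * w p / k p = (lam2 / INR (pr p)) * (/ k p * / k p).
  by rewrite /w; field; have := pr_gt0 p; lra.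
have Ha : 0 <= lam2 / INR (pr p) <= 1.
  split; first by left; apply: Rdiv_lt_0_compat.
  by apply: (Rmult_le_reg_r (INR (pr p))) => //; rewrite /Rdiv Rmult_assoc Rinv_l; have := pr_gt0 p; lra.
have Hb : 0 < / k p <= 1.
  split; first by apply: Rinv_0_lt_compat; lra.
  by rewrite -Rinv_1; apply: Rinv_le_contravar; lra.
have Hc : / k p <= del / 8.
  have -> : del / 8 = / (8 / del) by field; lra.
  by apply: Rinv_le_contravar; [apply: Rdiv_lt_0_compat|]; lra.
apply: (Rle_trans _ (1 * (1 * (del / 8)))); last by lra.
apply: Rmult_le_compat; [lra|apply: Rmult_le_pos; lra|lra|].
by apply: Rmult_le_compat; lra.
Qed.

Lemma weightA_ge0 p : 0 <= weightA p. Proof. exact: Rlt_le. Qed.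

Lemma priceA_ge0 p : 0 <= priceA p.
Proof.
have H := x2_small p; rewrite /priceA; suff : ln (weightA p ^ 2) <= ln 1 by rewrite ln_1; lra.
by apply: ln_le_mono; lra.
Qed.

Let exp_priceA p : exp (- priceA p) = weightA p ^ 2.
Proof. by rewrite /priceA Ropp_involutive exp_ln //; exact: (proj1 (x2_small p)). Qed.

Let priceA_le p : priceA p <= (1 + del) * k p.
Proof.
have Hk1 := k_ge p; have Hp := pr_gt0 p.
have Hrk : 0 < rho * kappa / 2 by apply: Rdiv_lt_0_compat; [apply: Rmult_lt_0_compat; lra|lra].
have Hl : ln (rho * kappa / 2) + L <= ln lam2.
  rewrite -{1}(ln_exp L) -HyL -ln_mult //.
  by apply: ln_le_mono => //; apply: Rmult_lt_0_compat.
have -> : priceA p = ln (INR (pr p)) + 2 * ln (k p) - ln lam2.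
  have Hkk : 0 < k p by lra.
  have -> : priceA p = - (ln lam2 - (ln (INR (pr p)) + (ln (k p) + ln (k p)))).
    rewrite -!ln_mult //; last exact: Rmult_lt_0_compat.
    have Hkk2 : 0 < k p * k p by exact: Rmult_lt_0_compat.
    rewrite -ln_div //; last exact: Rmult_lt_0_compat.
    rewrite /priceA x2; congr (- ln _); rewrite /w; field; lra.
  lra.
have := Hlnk (Hlo p); rewrite /k in Hk1 *; lra.
Qed.

Let sum_lw (a : R) : \rsum_p (a * w p) = a * S.
Proof. by rewrite -rsum_distrr. Qed.

(** As [ln p - L] is large, the sum of [x p ^ 2] is small compared with the budget, which is that sum
   weighted by [2 * (ln p - L)]. *)
Lemma card_A : exp ((1 - del) * kappa * y) * (\rprod_p (1 + 2 * exp (- priceA p))) <= exp (kappa * y).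
Proof.
apply: (Rle_trans _ (exp ((1 - del) * kappa * y) * exp (\rsum_p (2 * weightA p ^ 2)))).
  apply: Rmult_le_compat_l; first by left; exact: exp_pos.
  rewrite exp_rsum.
  suff [] : 0 <= \rprod_p (1 + 2 * exp (- priceA p)) /\ \rprod_p (1 + 2 * exp (- priceA p)) <= \rprod_p exp (2 * weightA p ^ 2) by [].
  apply: (big_ind2 (fun a b => 0 <= a /\ a <= b)).
  - by split; lra.
  - by move=> a1 b1 a2 b2 [? ?] [? ?]; split; [exact: Rmult_le_pos|exact: Rmult_le_compat].
  - move=> p _; rewrite exp_priceA; have := x2_small p; have := exp_ineq1_le (2 * weightA p ^ 2); lra.
rewrite -exp_plus; apply: exp_le_mono.
suff : \rsum_p (2 * weightA p ^ 2) <= del * kappa * y by lra.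
apply: (Rle_trans _ (del / 4 * (lam2 * S))).
  rewrite -Rmult_assoc -sum_lw; apply: rsum_le => p _; rewrite x2.
  have Hk1 := k_ge p; have Hk2 := Hlo p; have Hw := w_gt0 p.
  have Hc : / k p <= del / 8.
    have -> : del / 8 = / (8 / del) by field; lra.
    by apply: Rinv_le_contravar; [apply: Rdiv_lt_0_compat|]; lra.
  have := Rmult_le_compat_l (lam2 * w p) _ _ (Rlt_le _ _ (Rmult_lt_0_compat _ _ lam2_gt0 Hw)) Hc.
  by rewrite /Rdiv; lra.
rewrite lam2S.
have : 0 <= del * (kappa * y) by apply: Rmult_le_pos; [lra|apply: Rmult_le_pos; lra].
have : rho * (del * (kappa * y)) <= 1 * (del * (kappa * y)).
  by apply: Rmult_le_compat_r; [apply: Rmult_le_pos; [lra|apply: Rmult_le_pos; lra]|lra].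
lra.
Qed.

(** Each factor is at least [1 / (1 - q)], hence at least [exp q], where [q] is [2 * x p / sqrt p] up to a factor [1 - del]. *)
Lemma ratio_A : exp ((1 - del) * sqrt (2 * rho * kappa * (1 - 3 * del) * (y * z / L))) <=
  \rprod_p (pair_mass pr weightA (1 / 2) p / (1 + 2 * weightA p ^ 2)).
Proof.
apply: (Rle_trans _ (exp (\rsum_p ((1 - del) * (2 * lam) * w p)))).
  rewrite sum_lw; apply: exp_le_mono; rewrite !Rmult_assoc; apply: Rmult_le_compat_l; first by lra.
  have Hb : 0 <= 2 * (lam * S) by apply: Rmult_le_pos; [lra|apply: Rmult_le_pos; lra].
  rewrite -(sqrt_pow2 (2 * (lam * S))) //; apply: sqrt_le_1_alt.
  have -> : (2 * (lam * S)) ^ 2 = 4 * (lam2 * S) * S by rewrite -lam_sq; ring.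
  rewrite lam2S.
  have := Rmult_le_compat_l _ _ _ (Rlt_le _ _ rky) HS.
  have -> : rho * kappa * y * ((1 - 3 * del) * (z / L)) = rho * (kappa * ((1 - 3 * del) * (y * z / L))) by field; lra.
  lra.
apply: rprod_exp_le => p.
have Hx := weightA_gt0 p; have He := e_gt0 p; have Hx2 := x2_small p.
have He2 : 0 < e p ^ 2 <= del / 4 by rewrite e_sq.
have Hxe : 0 < weightA p * e p by exact: Rmult_lt_0_compat.
have -> : (1 - del) * (2 * lam) * w p = (1 - del) * (2 * (weightA p * e p)) by rewrite xe; ring.
set s := 2 * weightA p ^ 2 + 2 * (weightA p * e p).
have Hs : 0 < s <= del.
  split; first by rewrite /s; lra.
  by have := pow2_ge_0 (weightA p - e p); rewrite /s; lra.
set a := 2 * (weightA p * e p).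
pose q := a / (1 + s).
have Hq1 : (1 - del) * a <= q.
  apply: (Rmult_le_reg_r (1 + s)); first by lra.
  have -> : q * (1 + s) = a by rewrite /q; field; lra.
  have Ha : 0 < a by rewrite /a; lra.
  have : (1 - del) * (1 + s) <= 1 by nra.
  by move=> H; have := Rmult_le_compat_l _ _ _ (Rlt_le _ _ Ha) H; lra.
apply: (Rle_trans _ (exp q)); first exact: exp_le_mono.
have Hq2 : exp q * (1 - q) <= 1.
  apply: (Rle_trans _ (exp q * exp (- q))); last by rewrite -exp_plus Rplus_opp_r exp_0; lra.
  by apply: Rmult_le_compat_l; [left; exact: exp_pos|have := exp_ineq1_le (- q); lra].
have E : 1 - q = (1 + 2 * weightA p ^ 2) / (1 + s) by rewrite /q /s /a; field; rewrite -/s; lra.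
have Hb : 0 < 1 + 2 * weightA p ^ 2 by lra.
apply: (Rle_trans _ ((1 + s) / (1 + 2 * weightA p ^ 2))).
  apply: (Rmult_le_reg_r ((1 + 2 * weightA p ^ 2) / (1 + s))); first by apply: Rdiv_lt_0_compat; lra.
  rewrite -E; apply: Rle_trans Hq2 _; right; rewrite E; field; lra.
apply: Rmult_le_compat_r; first by left; exact: Rinv_0_lt_compat.
rewrite /pair_mass -/(e p) /s.
have : 0 <= weightA p ^ 2 * e p ^ 2 by apply: Rmult_le_pos; lra.
lra.
Qed.

(** The mean price is close to [rho * kappa * y]; the margin [6 * del] in [rho] leaves a fraction of the mass after
   Markov's inequality. *)
Lemma cost_A : (\rsum_p (priceA p * (pair_mass pr weightA (1 / 2) p - 1))) / ((1 - del) * kappa * y) <= 1 - del.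
Proof.
have Hky : 0 < kappa * y by apply: Rmult_lt_0_compat; lra.
have Hlam : 7 * lam <= del * kappa * y.
  apply: Rsqr_incr_0; [|lra|]; last by rewrite Rmult_assoc; apply: Rmult_le_pos; lra.
  rewrite !Rsqr_pow2.
  have -> : (7 * lam) ^ 2 = 49 * lam2 by rewrite -lam_sq; ring.
  have := Rmult_le_compat_l _ _ _ (Rlt_le _ _ y_gt0) HLy.
  have -> : (del * kappa * y) ^ 2 = y * ((del * kappa) ^ 2 * y) by ring.
  by have := lam2_hi; lra.
have Hsum : \rsum_p (priceA p * (pair_mass pr weightA (1 / 2) p - 1)) <= (1 + del) * ((1 + del / 8) * 2 * lam2 * S + 2 * lam * 3).
  apply: (Rle_trans _ ((1 + del) * ((1 + del / 8) * 2 * lam2 * S + 2 * lam * \rsum_p / INR (pr p)))); last first.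
    apply: Rmult_le_compat_l; first by lra.
    by apply: Rplus_le_compat_l; apply: Rmult_le_compat_l; [lra|exact: pinv_sum].
  rewrite -sum_lw rsum_distrr -rsum_plus rsum_distrr; apply: rsum_le => p _.
  have Hk1 := k_ge p; have Hw := w_gt0 p; have Hp := pinv_small p; have Hx2 := x2_small p.
  have Hxe : 0 < weightA p * e p by apply: Rmult_lt_0_compat.
  have -> : pair_mass pr weightA (1 / 2) p - 1 = 2 * weightA p ^ 2 + 2 * (weightA p * e p) + weightA p ^ 2 * e p ^ 2 by rewrite /pair_mass -/(e p); ring.
  apply: (Rle_trans _ ((1 + del) * k p * (2 * weightA p ^ 2 + 2 * (weightA p * e p) + weightA p ^ 2 * e p ^ 2))).
    apply: Rmult_le_compat_r; last exact: priceA_le.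
    by have := pow2_ge_0 (weightA p * e p); rewrite Rpow_mult_distr; lra.
  rewrite Rmult_assoc; apply: Rmult_le_compat_l; first by lra.
  rewrite xe e_sq.
  have E1 : k p * weightA p ^ 2 = lam2 * w p by rewrite x2; field; lra.
  have -> : k p * (2 * weightA p ^ 2 + 2 * (lam * w p) + weightA p ^ 2 * / INR (pr p)) =
    2 * (k p * weightA p ^ 2) + 2 * lam * (k p * w p) + (k p * weightA p ^ 2) * / INR (pr p) by ring.
  rewrite -pinv E1.
  have := Rmult_le_compat_l _ _ _ (Rlt_le _ _ (Rmult_lt_0_compat _ _ lam2_gt0 Hw)) (proj2 Hp).
  lra.
have HT : 0 < (1 - del) * kappa * y by rewrite Rmult_assoc; apply: Rmult_lt_0_compat; lra.
apply: (Rmult_le_reg_r ((1 - del) * kappa * y)) => //.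
rewrite /Rdiv Rmult_assoc Rinv_l; last by lra.
rewrite Rmult_1_r; apply: Rle_trans Hsum _.
have -> : (1 + del) * ((1 + del / 8) * 2 * lam2 * S + 2 * lam * 3) =
  (1 + del) * (1 + del / 8) * 2 * (lam2 * S) + (1 + del) * 6 * lam by ring.
rewrite lam2S.
have F1 : (1 + del) * (1 + del / 8) * 2 * (rho * kappa * y / 2) <= (1 - 4 * del) * (kappa * y).
  have -> : (1 + del) * (1 + del / 8) * 2 * (rho * kappa * y / 2) = (1 + del) * (1 + del / 8) * rho * (kappa * y) by field.
  by apply: Rmult_le_compat_r; [lra|rewrite /rho; nra].
have F2 : (1 + del) * 6 * lam <= 7 * lam by apply: Rmult_le_compat_r; lra.
have F3 : (1 - 3 * del) * (kappa * y) <= (1 - del) * (1 - del) * (kappa * y) by apply: Rmult_le_compat_r; [lra|nra].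
lra.
Qed.

Lemma log_A : (\rsum_p (ln (INR (pr p)) * pair_shift pr weightA (1 / 2) p)) / (16 / del * L * exp (L / 2)) <= del / 2.
Proof.
have HeL := exp_pos (L / 2).
have HLS : lam * S <= exp (L / 2).
  apply: Rsqr_incr_0; [|apply: Rmult_le_pos; lra|lra].
  rewrite !Rsqr_pow2 exp_pow (_ : INR 2 * (L / 2) = L); last by rewrite /=; field.
  rewrite -HyL (_ : (lam * S) ^ 2 = lam2 * S * S); last by rewrite -lam_sq; ring.
  rewrite lam2S.
  have F1 : rho * kappa * y / 2 * S <= rho * kappa * y / 2 * 1 by apply: Rmult_le_compat_l; lra.
  have F2 : rho * kappa * y <= 1 * y by apply: Rmult_le_compat_r; [lra|nra].
  lra.
have Hsum : \rsum_p (ln (INR (pr p)) * pair_shift pr weightA (1 / 2) p) <= 8 * L * lam * S.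
  rewrite -sum_lw; apply: rsum_le => p _.
  have Hx := weightA_gt0 p; have He := e_gt0 p; have Hw := w_gt0 p.
  have Hx2 := x2_small p; have He2 := pinv_small p; rewrite -e_sq in He2.
  have Hxe : 0 < weightA p * e p by apply: Rmult_lt_0_compat.
  have Hxe1 : weightA p * e p <= 1 by have := pow2_ge_0 (weightA p - e p); lra.
  have HB : 0 <= pair_shift pr weightA (1 / 2) p <= 4 * (lam * w p).
    rewrite -xe /pair_shift -/(e p).
    have -> : 2 * weightA p * e p + 2 * weightA p ^ 2 * e p ^ 2 = 2 * (weightA p * e p) * (1 + weightA p * e p) by ring.
    split; first by apply: Rmult_le_pos; lra.
    have : weightA p * e p * (1 + weightA p * e p) <= weightA p * e p * 2 by apply: Rmult_le_compat_l; lra.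
    lra.
  have Hk1 := k_ge p; rewrite /k in Hk1.
  have -> : 8 * L * lam * w p = 2 * L * (4 * (lam * w p)) by ring.
  by apply: Rmult_le_compat; [lra|lra|exact: Hhi|lra].
have HD : 0 < 16 / del * L * exp (L / 2).
  apply: Rmult_lt_0_compat => //; apply: Rmult_lt_0_compat; last by lra.
  by apply: Rdiv_lt_0_compat; lra.
apply: (Rmult_le_reg_r (16 / del * L * exp (L / 2))) => //.
rewrite /Rdiv Rmult_assoc Rinv_l; last by move: HD; rewrite /Rdiv; lra.
rewrite Rmult_1_r; apply: Rle_trans Hsum _.
have -> : del * / 2 * (16 * / del * L * exp (L * / 2)) = 8 * L * exp (L / 2) by rewrite /Rdiv; field; lra.
rewrite Rmult_assoc; apply: Rmult_le_compat_l; lra.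
Qed.
Lemma sqrt_resonator : exists x c : P -> R, [/\ forall p, 0 <= x p, forall p, 0 <= c p &
  [/\ exp ((1 - del) * kappa * y) * (\rprod_p (1 + 2 * exp (- c p))) <= exp (kappa * y),
      exp ((1 - del) * sqrt (2 * (1 - 6 * del) * kappa * (1 - 3 * del) * (y * z / L))) <=
        \rprod_p (pair_mass pr x (1 / 2) p / (1 + 2 * x p ^ 2)),
      (\rsum_p (c p * (pair_mass pr x (1 / 2) p - 1))) / ((1 - del) * kappa * y) <= 1 - del
    & (\rsum_p (ln (INR (pr p)) * pair_shift pr x (1 / 2) p)) / (16 / del * L * exp (L / 2)) <= del / 2]].
Proof.
exists weightA, priceA; split; [exact: weightA_ge0|exact: priceA_ge0|].
by split; [exact: card_A|exact: ratio_A|exact: cost_A|exact: log_A].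
Qed.
End SqrtResonator.

Theorem partA_window (del kappa : R) : 0 < del < 1 / 20 -> 0 < kappa < 1 ->
  large (fun y => exists (P : finType) (pr : P -> nat) (x c : P -> R),
  [/\ injective pr, forall p, prime (pr p), forall p, 0 <= x p, forall p, 0 <= c p &
  [/\ exp ((1 - del) * kappa * y) * (\big[Rmult/R1]_(p : P) (1 + 2 * exp (- c p))) <= exp (kappa * y),
      exp ((1 - del) * sqrt (2 * (1 - 6 * del) * kappa * (1 - 3 * del) * (y * ln (ln y) / ln y))) <=
        \big[Rmult/R1]_(p : P) (pair_mass pr x (1 / 2) p / (1 + 2 * x p ^ 2)),
      (\big[Rplus/R0]_(p : P) (c p * (pair_mass pr x (1 / 2) p - 1))) / ((1 - del) * kappa * y) <= 1 - del
    & (\big[Rplus/R0]_(p : P) (ln (INR (pr p)) * pair_shift pr x (1 / 2) p)) / (16 / del * ln y * exp (ln y / 2)) <= del / 2]]).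
Proof.
move=> Hdel Hkap.
pose C1 := ln 2 + ln (8 / del ^ 2).
pose C2 := - (ln ((1 - 6 * del) * kappa / 2) / 2).
have Hd2 : 0 < del ^ 2 by apply: pow_lt; lra.
have Hdk : 0 < (del * kappa) ^ 2 / 49 by apply: Rdiv_lt_0_compat; [apply: pow_lt; apply: Rmult_lt_0_compat|]; lra.
have Hlarge := large_and _ _ (large_ln (large_ln (large_ge 2)))
  (large_and _ _ (large_ln (large_ln (large_ln_le C1 (proj1 Hdel))))
  (large_and _ _ (large_ln (large_ln (large_up (large_ln_le C2 (del := del / 2) ltac:(lra)))))
  (large_and _ _ (large_ln_le 0 Hdk)
  (large_and _ _ (large_ge (4 / del)) (large_and _ _ (large_ln (large_ge 4)) (large_ge 1)))))).
apply: large_imp Hlarge => y [Hz [H1 [H2 [H3 [H4 [HL Hy1]]]]]].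
set L := ln y in Hz H1 H2 H3 HL *.
set z := ln L in Hz H1 H2 *.
have HyL : y = exp L by rewrite /L exp_ln; lra.
have HLz : L = exp z by rewrite /z exp_ln; lra.
pose h := 8 / del.
have Hh : 160 <= h.
  by apply: (Rmult_le_reg_r del); [lra|rewrite /h /Rdiv Rmult_assoc Rinv_l; lra].
have HdL : 0 < del * L by apply: Rmult_lt_0_compat; lra.
have Hq0 : 0 < del * L / h by apply: Rdiv_lt_0_compat; lra.
(* [i0 * h >= z] gives [exp (ln p - L) >= L], which keeps the weights small *)
pose i0 := (floorN z).+1; pose i1 := floorN (del * L / h).
have [Ha1 Ha2] := floorNP (x := z) ltac:(lra).
have [Hb1 Hb2] := floorNP (Rlt_le _ _ Hq0).
rewrite -/i1 in Hb1 Hb2.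
have Hi0 : INR i0 = INR (floorN z) + 1 by rewrite /i0 S_INR.
have Hgap : (1 - del) * z <= ln (INR i1 + 1) - ln (INR i0 + 1).
  have F1 : ln (INR i0 + 1) <= ln 2 + ln z.
    by rewrite -ln_mult; [apply: ln_le_mono; have := pos_INR i0; lra|lra|lra].
  have F2 : z - ln (8 / del ^ 2) <= ln (INR i1 + 1).
    rewrite /z -ln_div; [|lra|by apply: Rdiv_lt_0_compat; lra].
    have E : L / (8 / del ^ 2) = del * L / h by rewrite /h; field; lra.
    by rewrite E; apply: ln_le_mono; lra.
  by rewrite /C1 in H1; lra.
have Hpos0 : 0 < (1 - del) * z by apply: Rmult_lt_0_compat; lra.
have Hi01 : (0 < i0 <= i1)%N.
  rewrite /= ; apply/leP; apply: INR_le.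
  case: (Rle_lt_dec (INR i0) (INR i1)) => // Hlt; exfalso.
  have := ln_le_mono (INR i1 + 1) (INR i0 + 1); have := pos_INR i1; lra.
have Hi1h : INR i1 * h <= del * L.
  have := Rmult_le_compat_r h _ _ ltac:(lra) Hb1.
  by have -> : del * L / h * h = del * L by field; lra.
have HL1 : 1 <= L by lra.
pose u := grid L h i0; pose v := grid L h i1; pose N := v.+2.
have HN : ((grid L h i1).+1 < N)%N by [].
have Huv : (0 < u <= v)%N.
  by rewrite (grid_gt0 Hdel (erefl h) HL1 i0) (grid_mono L Hdel (erefl h)) //; case/andP: Hi01.
pose P := window N u v; pose pr : P -> nat := @wprime N u v.
have HS := window_sum_lower Hdel (erefl h) HL1 Hi01 Hi1h HN.
rewrite -/u -/v -/P -/pr in HS.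
have HS' : (1 - 3 * del) * (z / L) <= \big[Rplus/R0]_(p : P) (/ (INR (pr p) * (ln (INR (pr p)) - L))).
  apply: Rle_trans HS.
  have Hc : 0 <= (1 - del) / ((1 + del) * L).
    by left; apply: Rdiv_lt_0_compat; [lra|apply: Rmult_lt_0_compat; lra].
  apply: Rle_trans (Rmult_le_compat_l _ _ _ Hc Hgap).
  have -> : (1 - del) / ((1 + del) * L) * ((1 - del) * z) = ((1 - del) * (1 - del) / (1 + del)) * (z / L) by field; lra.
  apply: Rmult_le_compat_r; first by left; apply: Rdiv_lt_0_compat; lra.
  apply: (Rmult_le_reg_r (1 + del)); first by lra.
  by rewrite /Rdiv Rmult_assoc Rinv_l; nra.
have Hlnv : ln (INR v) <= L + del * L.
  by have [_ H] := ln_grid Hdel (erefl h) HL1 i1; rewrite -/v in H; lra.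
have HM : \big[Rplus/R0]_(p : P) (ln (INR (pr p)) / INR (pr p)) <= 3 * L.
  apply: Rle_trans (win_mertens_upper HN Huv) _; rewrite -/v.
  have : del * L <= 1 / 20 * L by apply: Rmult_le_compat_r; lra.
  lra.
have Hprime p : prime (pr p) by exact: wprime_prime.
have Hlo p : INR i0 * h <= ln (INR (pr p)) - L.
  by have := gt_grid (wprime_gt p); rewrite -/pr; lra.
have Hhi p : ln (INR (pr p)) <= 2 * L.
  have : ln (INR (pr p)) <= ln (INR v).
    apply: ln_le_mono; first by apply: INR_gt0; exact: prime_gt0.
    by apply: INR_leq; exact: wprime_le.
  have : del * L <= 1 / 20 * L by apply: Rmult_le_compat_r; lra.
  lra.
have Hz0 : z <= INR i0 by lra.
have Hi0h : INR i0 <= INR i0 * h.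
  by rewrite -{1}(Rmult_1_r (INR i0)); apply: Rmult_le_compat_l; lra.
have Hk0 : 8 / del <= INR i0 * h.
  by rewrite -/h -{1}(Rmult_1_l h); apply: Rmult_le_compat_r; [lra|rewrite Hi0; have := pos_INR (floorN z); lra].
have HLk0 : L <= exp (INR i0 * h) by rewrite HLz; apply: exp_le_mono; lra.
have Hlnk k : INR i0 * h <= k -> ln k - ln ((1 - 6 * del) * kappa / 2) / 2 <= del / 2 * k.
  by move=> Hk; have := H2 k ltac:(lra); rewrite /C2; lra.
have HLy : 49 * L <= (del * kappa) ^ 2 * y by lra.
have [x [c [G1 G2 G3]]] := sqrt_resonator Hdel Hkap HyL H4 HL Hz HLy Hk0 HLk0 Hlnk Hprime Hlo Hhi HS' HM.
by exists P, pr, x, c; split => //; exact: wprime_inj.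
Qed.

(** * Large values of the derivatives of zeta *)

Section Extreme.
Variables (zeta : C -> C) (l : nat) (beta : R).
Hypothesis Hz : is_riemann_zeta zeta.
Hypothesis Hb : 0 <= beta < 1.

Let Zl (sigma t : R) : R := Cmod (C_derive_n zeta l (RtoC sigma + Ci * RtoC t)%C).

Definition Zbound (sigma y V : R) : Prop := forall t, exp (beta * y) <= t <= exp y -> Zl sigma t <= V.

Lemma max_exists sigma a b : sigma < 1 -> a <= b -> exists m, is_max_on (Zl sigma) a b m.
Proof.
move=> Hs Hab.
have [|tm [H1 H2]] := continuity_ab_maj (Zl sigma) a b Hab.
  move=> t _; apply: (continuity_pt_ext (fun x => Cmod (Ci ^ l * C_derive_n zeta l (RtoC sigma + Ci * RtoC x))%C)).
    by move=> x; rewrite Cmod_mult Cmod_pow Cmod_Ci pow1 Rmult_1_l.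
  exact: vderiv_cont_Cmod (zeta_vertical zeta sigma l Hz Hs t).
by exists (Zl sigma tm); split => //; exists tm.
Qed.

Lemma max_of_bounds sigma (Y : R -> R) : sigma < 1 ->
  large (fun y => forall V, Zbound sigma y V -> exp (Y y) <= V) ->
  exists T0, forall T, T0 <= T -> exists m, is_max_on (Zl sigma) (Rpower T beta) T m /\ m >= exp (Y (ln T)).
Proof.
move=> Hs [y0 H]; exists (exp (Rmax y0 0)) => T HT.
have HT0 : 0 < T by have := exp_pos (Rmax y0 0); lra.
have Hy : Rmax y0 0 <= ln T.
  by rewrite -(ln_exp (Rmax y0 0)); apply: ln_le_mono => //; exact: exp_pos.
have Hy0 : y0 <= ln T by have := Rmax_l y0 0; lra.
have Hy1 : 0 <= ln T by have := Rmax_r y0 0; lra.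
have Hab : Rpower T beta <= T.
  rewrite -{2}(exp_ln T) //; apply: exp_le_mono.
  by rewrite -{2}(Rmult_1_l (ln T)); apply: Rmult_le_compat_r; lra.
have [m Hm] := max_exists Hs Hab; exists m; split => //.
apply: Rle_ge; apply: (H _ Hy0) => t Ht; apply: (proj2 Hm).
by rewrite exp_ln // in Ht.
Qed.

Lemma quarter_pow : 0 < (1 / 4) ^ l <= 1.
Proof.
split; first by apply: pow_lt; lra.
by rewrite -[X in _ <= X](pow1 l); apply: pow_incr; lra.
Qed.

(** The interval is long enough for [beta1 = beta + g] and [eps = g] with [2 * g = 1 - beta - kappa]. Logarithms up to
   [Lam = sqrt y] suffice, for which smoothing costs a constant factor. *)
Lemma large_partB sigma kappa : 1 / 2 < sigma < 1 -> 0 < kappa < 1 - beta ->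
  large (fun y => forall V, Zbound sigma y V -> exp (exponentB sigma kappa y) <= V).
Proof.
move=> Hs Hk.
pose g := (1 - beta - kappa) / 2.
have [A [HA HR]] := @zeta_resonance zeta l beta (beta + g) g kappa Hz
  ltac:(rewrite /g; lra) ltac:(rewrite /g; lra) ltac:(rewrite /g; lra) ltac:(rewrite /g; lra).
pose D1 := (1 / 4) ^ l * exp (- (4 * A)).
have Hq := quarter_pow.
have HD : 0 < D1 <= 1.
  have He := exp_pos (- (4 * A)).
  have He1 : exp (- (4 * A)) <= 1 by rewrite -exp_0; apply: exp_le_mono; lra.
  split; first by apply: Rmult_lt_0_compat; lra.
  by rewrite -[X in _ <= X](Rmult_1_l 1); apply: Rmult_le_compat; lra.
have Hk1 : 0 < kappa < 1 by lra.
have Hlarge := large_and _ _ HR (large_and _ _ (partB_window Hs Hk1)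
  (large_and _ _ (exponentB_large kappa Hs (3 * Rmax 0 (ln (81 / (D1 * (1 / 2)))))) (large_ge 1))).
apply: large_imp Hlarge => y [{}HR [[P [pr [Hinj Hpr Hcard Hprod Hlog]]] [HZ Hy]]] V HV.
have HsY : exp (ln y / 2) * exp (ln y / 2) = y.
  by rewrite -exp_plus (_ : ln y / 2 + ln y / 2 = ln y); [rewrite exp_ln; lra|field].
have HsY1 : 1 <= exp (ln y / 2).
  by have := exp_ineq1_le (ln y / 2); have := ln_nonneg y Hy; lra.
have := HR sigma P pr (fun=> 1) (fun=> 0) 1 (exp (ln y / 2)) V ltac:(lra) Hinj Hpr (fun _ => Rle_0_1)
  (fun _ => Rle_refl 0) Rlt_0_1 _ Hcard HV.
rewrite (big1 (op := Rplus)); last by move=> p _; rewrite Rmult_0_l.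
have -> : 4 * A * exp (ln y / 2) ^ 2 / y = 4 * A by rewrite /= Rmult_1_r HsY; field; lra.
rewrite -/D1.
set E := \big[Rmult/R1]_p _ in Hprod *.
set Q := (\big[Rplus/R0]_p _) / _ in Hlog *.
move=> Hmain; have {}Hmain := Hmain ltac:(split; [lra|nra]).
have HM := Rmax_l 0 (ln (81 / (D1 * (1 / 2)))); have HM' := Rmax_r 0 (ln (81 / (D1 * (1 / 2)))).
have HDh : 0 < 81 / (D1 * (1 / 2)) by apply: Rdiv_lt_0_compat; lra.
apply: (@resonance_finish D1 (1 / 2) E (exponentB sigma kappa y) (exponentB sigma kappa y / 3)) => //; try lra.
- by rewrite -{1}(exp_ln (81 / (D1 * (1 / 2)))) //; apply: exp_le_mono; lra.
- by have -> : exponentB sigma kappa y + exponentB sigma kappa y / 3 = 4 * exponentB sigma kappa y / 3 by field.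
- apply: Rle_trans Hmain; apply: Rmult_le_compat_l; first by lra.
  have HE : 0 <= E by apply: Rle_trans Hprod; left; exact: exp_pos.
  have : E * (1 / 2) <= E * (1 - 0 / 1 - Q) by apply: Rmult_le_compat_l => //; lra.
  lra.
Qed.

(** Proportional to the gap [g], [del] is small enough for the exponent to remain at least
   [c' * sqrt (y * z / L)] with [c' > c]. The difference of the two exponents outweighs the loss [exp (- (K * L ^ 2))] due to
   smoothing, as [Lam] is [sqrt y] up to a factor of order [L]. *)
Lemma large_partA c : 0 < c -> c < sqrt (2 * (1 - beta)) ->
  large (fun y => forall V, Zbound (1 / 2) y V -> exp (c * sqrt (y * ln (ln y) / ln y)) <= V).
Proof.
move=> Hc Hcb.
pose b := 1 - beta; pose g := 2 * b - c ^ 2; pose del := g / 56.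
have Hc2 : c ^ 2 < 2 * b.
  rewrite -(pow2_sqrt (2 * b)); last by rewrite /b; lra.
  by rewrite /=; have := Rmult_le_0_lt_compat c _ c _ ltac:(lra) ltac:(lra) Hcb Hcb; rewrite -/b; lra.
have Hc20 : 0 < c ^ 2 by apply: pow_lt.
have Hg : 0 < g <= 2 by rewrite /g /b in Hc2 *; lra.
have Hdel : 0 < del < 1 / 20 by rewrite /del; lra.
pose kappa := b * (1 - del).
have Hbd : 0 < b * del by apply: Rmult_lt_0_compat; rewrite /b; lra.
have Hkap : 0 < kappa < 1.
  by rewrite /kappa; split; [apply: Rmult_lt_0_compat; rewrite /b; lra|rewrite /b in Hbd *; lra].
pose eps := (b * del) / 2.
have [A [HA HR]] := @zeta_resonance zeta l beta (beta + eps) eps kappa Hz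
  ltac:(rewrite /eps; lra) ltac:(move: Hkap; rewrite /eps /kappa /b; lra)
  ltac:(rewrite /eps; lra) ltac:(rewrite /eps /kappa /b; lra).
(* halfway between [c ^ 2] and [2 * b] *)
pose c' := sqrt (c ^ 2 + g / 2).
have Hcc : c < c'.
  by rewrite -{1}(sqrt_pow2 c); [apply: sqrt_lt_1_alt; lra|lra].
have Hc's : c' ^ 2 = c ^ 2 + g / 2 by apply: pow2_sqrt; lra.
have Hexp : c' <= (1 - del) * sqrt (2 * (1 - 6 * del) * kappa * (1 - 3 * del)).
  rewrite -{1}(sqrt_pow2 (1 - del)); last by lra.
  rewrite -sqrt_mult_alt; last by apply: pow_le; lra.
  apply: sqrt_le_1_alt.
  have -> : (1 - del) ^ 2 * (2 * (1 - 6 * del) * kappa * (1 - 3 * del)) = 2 * b * ((1 - del) ^ 3 * ((1 - 6 * del) * (1 - 3 * del))).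
    by rewrite /kappa; ring.
  have H3 : 1 - 3 * del <= (1 - del) ^ 3 by rewrite /=; nra.
  have H9 : 1 - 9 * del <= (1 - 6 * del) * (1 - 3 * del) by nra.
  (* [2 * b * 12 * del <= 3 / 7 * g] stays below the available [g / 2] *)
  have H12 : 1 - 12 * del <= (1 - del) ^ 3 * ((1 - 6 * del) * (1 - 3 * del)).
    apply: (Rle_trans _ ((1 - 3 * del) * (1 - 9 * del))); first by nra.
    by apply: Rmult_le_compat; lra.
  have Hb2 : 0 < 2 * b by rewrite /b; lra.
  apply: Rle_trans (Rmult_le_compat_l _ _ _ (Rlt_le _ _ Hb2) H12).
  have Hbb : b * g <= 1 * g by apply: Rmult_le_compat_r; [lra|rewrite /b; lra].
  by rewrite /del (_ : 2 * b * (1 - 12 * (g / 56)) = 2 * b - 3 / 7 * (b * g)); [rewrite /g in Hbb *; lra|field].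
pose K := 4 * A * (256 / del ^ 2).
have Hd2 : 0 < del ^ 2 by apply: pow_lt; lra.
have HK : 0 < K by apply: Rmult_lt_0_compat; [lra|apply: Rdiv_lt_0_compat; lra].
have Hq := quarter_pow.
pose M := Rmax 0 (ln (81 / ((1 / 4) ^ l * (del / 2)))) + K.
have HM : 0 <= Rmax 0 (ln (81 / ((1 / 4) ^ l * (del / 2)))) by exact: Rmax_l.
have HM' : ln (81 / ((1 / 4) ^ l * (del / 2))) <= Rmax 0 (ln (81 / ((1 / 4) ^ l * (del / 2)))) by exact: Rmax_r.
pose r := c' - c.
have Hr : 0 < r by rewrite /r; lra.
have Hlarge := large_and _ _ HR (large_and _ _ (partA_window Hdel Hkap)
  (large_and _ _ (large_ln (large_ln (large_ge 1)))
  (large_and _ _ (large_ln (large_pow_exp (M ^ 2 / r ^ 2) 1 5 ltac:(lra)))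
  (large_and _ _ (large_ln (large_pow_exp (16 / del) (1 / 2) 1 ltac:(lra)))
  (large_and _ _ (large_ln (large_ge 1)) (large_ge 1)))))).
apply: large_imp Hlarge => y [{}HR [[P [pr [x [cc [Hinj Hpr Hx Hcst [Hcard Hprod Hcost Hlog]]]]]] [Hz1 [HMy [HLam [HL Hy]]]]]] V HV.
set L := ln y in Hprod Hlog Hz1 HMy HLam HL *.
set z := ln L in Hprod Hz1 *.
have HyL : y = exp L by rewrite /L exp_ln; lra.
pose Lam := 16 / del * L * exp (L / 2).
have HeL := exp_pos (L / 2).
have HLam0 : 0 < Lam.
  by apply: Rmult_lt_0_compat => //; apply: Rmult_lt_0_compat; [apply: Rdiv_lt_0_compat; lra|lra].
have Hee : exp (L / 2) * exp (L / 2) = y by rewrite -exp_plus HyL; congr exp; field.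
have HLamy : Lam <= y.
  rewrite -Hee /Lam; apply: Rmult_le_compat_r; first by lra.
  by move: HLam; rewrite /= Rmult_1_r (_ : 1 / 2 * L = L / 2); [|field].
have HTh : 0 < (1 - del) * kappa * y.
  by apply: Rmult_lt_0_compat; [apply: Rmult_lt_0_compat|]; lra.
have Hmain := HR (1 / 2) P pr x cc ((1 - del) * kappa * y) Lam V ltac:(lra) Hinj Hpr Hx Hcst HTh ltac:(lra) Hcard HV.
have HLam2 : 4 * A * Lam ^ 2 / y = K * L ^ 2.
  rewrite /Lam /K -Hee; field; lra.
rewrite HLam2 in Hmain.
set D1 := (1 / 4) ^ l * _ in Hmain.
set E := \big[Rmult/R1]_p _ in Hprod Hmain.
set Q1 := _ / ((1 - del) * kappa * y) in Hcost Hmain.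
set Q2 := _ / Lam in Hmain.
have {}Hlog : Q2 <= del / 2 by [].
have HD : 0 < D1 <= 1.
  have He := exp_pos (- (K * L ^ 2)).
  have HKL : 0 <= K * L ^ 2 by apply: Rmult_le_pos; [lra|apply: pow_le; lra].
  have He1 : exp (- (K * L ^ 2)) <= 1 by rewrite -exp_0; apply: exp_le_mono; lra.
  split; first by apply: Rmult_lt_0_compat; lra.
  by rewrite -[X in _ <= X](Rmult_1_l 1); apply: Rmult_le_compat; lra.
pose W := sqrt (y * z / L).
have HW0 : 0 <= W by exact: sqrt_pos.
have HML : 1 <= L ^ 2 by rewrite -(pow1 2); apply: pow_incr; lra.
have HMW : M * L ^ 2 <= r * W.
  apply: (Rmult_le_reg_l (/ r)); first exact: Rinv_0_lt_compat.
  have -> : / r * (r * W) = W by field; lra.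
  have HMr : 0 <= / r * (M * L ^ 2).
    apply: Rmult_le_pos; first by left; exact: Rinv_0_lt_compat.
    by apply: Rmult_le_pos; rewrite /M; lra.
  rewrite -(sqrt_pow2 _ HMr); apply: sqrt_le_1_alt.
  apply: (Rmult_le_reg_r L); first by lra.
  have -> : y * z / L * L = y * z by field; lra.
  have -> : (/ r * (M * L ^ 2)) ^ 2 * L = M ^ 2 / r ^ 2 * L ^ 5 by field; lra.
  apply: Rle_trans HMy _; rewrite Rmult_1_l -HyL -{1}(Rmult_1_r y).
  by apply: Rmult_le_compat_l; lra.
have HMax : Rmax 0 (ln (81 / ((1 / 4) ^ l * (del / 2)))) <= Rmax 0 (ln (81 / ((1 / 4) ^ l * (del / 2)))) * L ^ 2.
  by rewrite -{1}(Rmult_1_r (Rmax _ _)); apply: Rmult_le_compat_l.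
have Hq0 : 0 < (1 / 4) ^ l * (del / 2) by apply: Rmult_lt_0_compat; lra.
apply: (@resonance_finish D1 (del / 2) E (c * W) (r * W)) => //; try lra.
- have -> : 81 / (D1 * (del / 2)) = 81 / ((1 / 4) ^ l * (del / 2)) * exp (K * L ^ 2).
    rewrite /D1 exp_Ropp; have := exp_pos (K * L ^ 2) => Hek; field; lra.
  rewrite -{1}(exp_ln (81 / ((1 / 4) ^ l * (del / 2)))); last by apply: Rdiv_lt_0_compat; lra.
  rewrite -exp_plus; apply: exp_le_mono.
  rewrite /M in HMW; lra.
- apply: Rle_trans Hprod; apply: exp_le_mono.
  have -> : c * W + r * W = c' * W by rewrite /r; ring.
  rewrite sqrt_mult_alt.
    by rewrite -Rmult_assoc; apply: Rmult_le_compat_r.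
  apply: Rmult_le_pos; [apply: Rmult_le_pos|]; lra.
- apply: Rle_trans Hmain; apply: Rmult_le_compat_l; first by lra.
  have HE : 0 <= E by apply: Rle_trans Hprod; left; exact: exp_pos.
  have : E * (del / 2) <= E * (1 - Q1 - Q2) by apply: Rmult_le_compat_l => //; lra.
  lra.
- by apply: Rmult_le_pos; lra.
Qed.
End Extreme.

End Resonator.

Theorem theorem2 :
  exists ctilde : R, 0 < ctilde /\
  forall zeta : C -> C, is_riemann_zeta zeta ->
  forall (l : nat) (beta : R), (1 <= l)%nat -> 0 <= beta < 1 ->
    (forall c : R, 0 < c -> c < sqrt (2 * (1 - beta)) ->
       exists T0 : R, forall T : R, T0 <= T ->
         exists m : R,
           is_max_on
             (fun t => Cmod (C_derive_n zeta l (RtoC (1 / 2) + Ci * RtoC t)%C))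
             (Rpower T beta) T m /\
           m >= exp (c * sqrt (ln T * log3 T / log2 T))) /\
    (forall sigma kappa : R, 1 / 2 < sigma < 1 -> 0 < kappa -> kappa < 1 - beta ->
       exists T0 : R, forall T : R, T0 <= T ->
         exists m : R,
           is_max_on
             (fun t => Cmod (C_derive_n zeta l (RtoC sigma + Ci * RtoC t)%C))
             (Rpower T beta) T m /\
           m >= exp (ctilde * Rpower kappa (1 - sigma) / (1 - sigma)
                     * (Rpower (ln T) (1 - sigma) / Rpower (log2 T) sigma))).
Proof.
  exists Resonator.ctilde. split; [exact Resonator.ctilde_gt0|].
  intros zeta Hz l beta _ Hb. split.
  - intros c Hc Hcb.
    apply (@Resonator.max_of_bounds zeta l beta Hz Hb (1 / 2) (fun y => c * sqrt (y * ln (ln y) / ln y))); [lra|].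
    exact (@Resonator.large_partA zeta l beta Hz Hb c Hc Hcb).
  - intros sigma kappa Hs Hk Hkb.
    apply (@Resonator.max_of_bounds zeta l beta Hz Hb sigma (Resonator.exponentB sigma kappa)); [lra|].
    exact (@Resonator.large_partB zeta l beta Hz Hb sigma kappa Hs (conj Hk Hkb)).
Qed.
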